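(* Let $\nu$ be a probability measure on $\mathbb{R}$ with a finite first moment, and put $m=\int_{\mathbb{R}} x\,d\nu(x)$. Let $p\in(0,1)\setminus\{p_c\}$. Then for $\mu_p$-almost every $G$, $$\lim_{n\to+\infty}\frac{1}{|\Lambda_n|}\sum_{x\in\Lambda_n}X(x)=(1-\theta(p))\,m+\theta(p)\,Z\qquad P^{G,\nu}\text{-almost surely},$$ where $Z$ is the value taken by $X(\cdot)$ along the infinite connected component of $G$ if it exists, and $Z=0$ otherwise.
   Context: Fix an integer $d\ge 1$. $\mathbb{L}^d=(\mathbb{Z}^d,E_d)$ is the cubic lattice, $E_d=\{\{x,y\}\subset\mathbb{Z}^d:\sum_{i=1}^d|x_i-y_i|=1\}$. A subgraph of $\mathbb{L}^d$ means a graph $G=(\mathbb{Z}^d,E)$ with $E\subset E_d$. Its connected components are also called clusters, and $C(x)$ is the cluster of $x$. For $p\in(0,1)$, $\mu_p$ is the law of the random subgraph obtained by Bernoulli bond percolation: each edge of $E_d$ is kept independently with probability $p$. Put $\theta(p)=\mu_p(|C(0)|=+\infty)$ and $p_c=\inf\{p\in(0,1):\theta(p)>0\}$ (with $\inf\varnothing=1$). It is known that for $\mu_p$-almost every $G$ there is no infinite cluster if $p<p_c$, and exactly one infinite cluster if $p>p_c$. For a subgraph $G$ of $\mathbb{L}^d$ and a probability measure $\nu$ on $\mathbb{R}$, the color measure $P^{G,\nu}$ is the unique probability measure on $(\mathbb{R}^{\mathbb{Z}^d},\mathcal{B}(\mathbb{R}^{\mathbb{Z}^d}))$ under which the canonical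 projections $X(x)=X_x:\omega\mapsto\omega_x$ satisfy: each $X_x$ has law $\nu$; for every set $S\subset\mathbb{Z}^d$ whose elements lie in pairwise distinct clusters of $G$, the variables $(X_x)_{x\in S}$ are independent; for every connected set $S$ of $G$, the variables $(X_x)_{x\in S}$ are ($P^{G,\nu}$-a.s.) all equal. In other words, each cluster is painted with a single color, and the colors of distinct clusters are i.i.d. with law $\nu$. $\Lambda_n=\{-n,\dots,n\}^d$, and $|\cdot|$ denotes cardinality. *)

(* Defs.v *)
From HB Require Import structures.
From mathcomp Require Import all_boot all_order all_algebra finmap.
From mathcomp Require Import all_classical all_reals all_analysis.

Set Implicit Arguments.
Unset Strict Implicit.
Unset Printing Implicit Defensive.

Import Order.TTheory GRing.Theory Num.Theory.
Import numFieldNormedType.Exports.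

Local Open Scope classical_set_scope.
Local Open Scope ring_scope.

Notation Zd d := {ffun 'I_d -> int}.

Definition Ed (d : nat) : set (set (Zd d)) :=
  [set e | exists x y : Zd d, e = [set x; y] /\ \sum_(i < d) `|x i - y i| = 1].

Arguments Ed : clear implicits.

(* A subgraph (Z^d, E) is identified with its edge set E, a subset of E_d. *)
Notation edge d := (set_type (Ed d)).
Notation subgraph d := (set (edge d)).

Definition adj (d : nat) (G : subgraph d) (x y : Zd d) : Prop :=
  exists e : edge d, G e /\ val e = [set x; y].

(* [linked G S x y]: some walk of G from x to y has all its vertices in S. *)
Definition linked (d : nat) (G : subgraph d) (S : set (Zd d)) (x y : Zd d) :
    Prop :=
  exists s : seq (Zd d),
    [/\ path (fun u v => `[< adj G u v >]) x s, last x s = y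
      & forall z, z \in x :: s -> S z].

Definition cluster_of (d : nat) (G : subgraph d) (x : Zd d) : set (Zd d) :=
  [set y | linked G setT x y].

Definition connected_subset (d : nat) (G : subgraph d) (S : set (Zd d)) : Prop :=
  forall x y, S x -> S y -> linked G S x y.

Definition box (d n : nat) : set (Zd d) :=
  [set x | forall i, - n%:Z <= x i <= n%:Z].
Arguments box : clear implicits.

Definition independent_events (disp : measure_display) (T : measurableType disp)
    (R : realType) (P : probability T R) (I : choiceType) (A : I -> set T) :
    Prop :=
  forall J : {fset I},
    P (\bigcap_(i in [set` J]) A i) = (\prod_(i <- J) P (A i))%E.

(* Independence of the subfamily (X_i)_{i in S}. *)
Definition independent_vars_on (disp : measure_display)
    (T : measurableType disp) (R : realType) (P : probability T R)
    (I : choiceType) (S : set I) (X : I -> T -> R) : Prop :=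
  forall (J : {fset I}) (B : I -> set (measurableTypeR R)),
    [set` J] `<=` S -> (forall i, measurable (B i)) ->
    P (\bigcap_(i in [set` J]) (X i @^-1` B i)) =
      (\prod_(i <- J) P (X i @^-1` B i))%E.

(* Subgraphs of L^d with the product sigma-algebra of {0,1}^{E_d}. *)
Definition edge_events (d : nat) : set (set (subgraph d)) :=
  [set A | exists e : edge d, A = [set G | G e]].
Arguments edge_events : clear implicits.
Notation subgraph_space d := (g_sigma_algebraType (edge_events d)).

Definition bond_percolation (d : nat) (R : realType) (p : R)
    (mu : probability (subgraph_space d) R) : Prop :=
  (forall e : edge d, mu [set G : subgraph d | G e] = p%:E) /\
  independent_events mu (fun e : edge d => [set G : subgraph d | G e]).

Definition theta (d : nat) (R : realType)
    (mu : R -> probability (subgraph_space d) R) (p : R) : R :=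
  fine (mu p [set G : subgraph d | infinite_set (cluster_of G 0)]).

(* The case split implements the convention inf(empty) = 1; the library's inf
   sends the empty set to 0. *)
Definition pc (d : nat) (R : realType)
    (mu : R -> probability (subgraph_space d) R) : R :=
  let A := [set p : R | 0 < p < 1 /\ 0 < theta mu p] in
  if pselect (A !=set0) then inf A else 1.

(* R^{Z^d} with the Borel sigma-algebra of the product topology. *)
Notation coloring_space d R := (g_sigma_algebraType (@open {ptws Zd d -> R})).

Definition X (d : nat) (R : realType) (x : Zd d) (w : coloring_space d R) : R :=
  w x.

Definition color_measure (d : nat) (R : realType) (G : subgraph d)
    (nu : probability (measurableTypeR R) R)
    (P : probability (coloring_space d R) R) : Prop :=
  [/\ forall (x : Zd d) (B : set (measurableTypeR R)), measurable B ->
        P (X x @^-1` B) = nu B,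
      forall S : set (Zd d),
        (forall x y, S x -> S y -> x <> y -> cluster_of G x <> cluster_of G y) ->
        independent_vars_on P S (@X d R)
    & forall S : set (Zd d), connected_subset G S ->
        {ae P, forall w, forall x y, S x -> S y -> X x w = X y w}].

(* The infinite cluster is represented by one of its vertices; which one is
   irrelevant almost surely, as the coloring is a.s. constant on clusters. *)
Definition infinite_cluster_color (d : nat) (R : realType) (G : subgraph d)
    (w : coloring_space d R) : R :=
  let I := [set x : Zd d | infinite_set (cluster_of G x)] in
  if pselect (I !=set0) then X (xget 0 I) w else 0.

(* Main.v *)
Require Import Defs.
From HB Require Import structures.
From mathcomp Require Import all_boot all_order all_algebra finmap.
From mathcomp Require Import all_classical all_reals all_analysis.
From mathcomp Require Import measurable_realfun ring lra zify.
Set Implicit Arguments.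
Unset Strict Implicit.
Unset Printing Implicit Defensive.
Import Order.TTheory GRing.Theory Num.Theory.
Import numFieldNormedType.Exports.
Local Open Scope classical_set_scope.
Local Open Scope ring_scope.

(* Write each color as the difference of its positive and negative parts, and
   treat the finite clusters and the infinite one separately.

   Infinite cluster: it is unique, by the argument of Aizenman, Kesten and Newman
   (see also Gandolfi, Grimmett and Russo). For a set of boundary vertices, the
   quantity (1 - p) #open - p #closed, counted over the edges touching its
   cluster, is the value of a martingale that explores the cluster. Comparing the
   clusters of the single boundary vertices with the cluster of the whole boundary
   bounds the number of closed edges separating two clusters which reach the
   boundary of a box. This number is negligible with respect to the volume, so a
   closed edge almost surely never joins two infinite clusters, and a finite
   modification of the graph excludes two infinite clusters.

   Finite clusters: color the lattice by an i.i.d. family independent of the graph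
   and let each finite cluster take the color of its root, its least vertex for
   the lexicographic order. The result is a stationary field, whose box averages
   converge by a maximal inequality (Vitali covering) and a second moment bound for
   the bounded local approximations of the field. By Fubini the convergence holds
   for almost every graph, and for a fixed graph the law of the colors of the
   finite clusters is the one given by the color measure.

   No i.i.d. family is assumed to exist: almost every graph has infinitely many
   finite clusters, and if a color measure exists for one such graph, then the
   colors of its roots provide an i.i.d. family. *)

(** * Exploration of clusters in a finite set of edges *)

(** A single almost sure set of graphs must serve every color measure, while a color measure depends
    on its graph. The limit theorem is therefore proved under one product measure on graphs and
    i.i.d. colors, and reaches a color measure only through the joint law of the root colors. Only a
    first moment is available, so second moments are used for truncated fields of finite range
    alone, and the maximal inequality carries the convergence over to the original field. The
    density theta(p) needs no separate ergodic theorem: the same limit theorem with the constant 1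
    in place of the color gives the proportion of vertices in finite clusters. Uniqueness is
    obtained without a zero-one law for the number of infinite clusters. Counting the translates of
    one edge in a box shows that this edge joins two infinite clusters with probability zero. The
    count succeeds because the squared martingale divided by the number of explored edges has an
    expectation of logarithmic order: a boundary of order N^(d-1) then contributes N^(d-1) log N,
    against a volume of order N^d. *)

Section bernoulli_expectation.
Context (R : realType) (E : choiceType) (p : R).
Hypothesis p01 : 0 <= p <= 1.
Implicit Types (D : seq E) (G : set E) (f g : set E -> R).

Definition open_edge (e : E) G : set E := e |` G.
Definition close_edge (e : E) G : set E := G `\ e.

(* Expectation of [f] when the edges of [D] are open independently with
   probability [p] and all the other edges are closed. *)
Fixpoint bexp D f : R :=
  if D is e :: D' then
    p * bexp D' (f \o open_edge e) + (1 - p) * bexp D' (f \o close_edge e)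
  else f set0.

Lemma open_edge_neq e e' G : e' != e -> open_edge e G e' = G e'.
Proof.
move=> /eqP ne; apply/propext; split=> [[/= ?|//]|?]; last by right.
by case: ne.
Qed.

Lemma close_edge_neq e e' G : e' != e -> close_edge e G e' = G e'.
Proof. by move=> /eqP ne; apply/propext; split=> [[]|]. Qed.

Lemma open_edgeE e G : open_edge e G e = True.
Proof. by apply/propext; split=> // _; left. Qed.

Lemma close_edgeE e G : close_edge e G e = False.
Proof. by apply/propext; split=> // -[_]; apply. Qed.

Lemma open_open_edgeC e e' G :
  open_edge e (open_edge e' G) = open_edge e' (open_edge e G).
Proof. by rewrite /open_edge setUCA. Qed.

Lemma close_close_edgeC e e' G :
  close_edge e (close_edge e' G) = close_edge e' (close_edge e G).
Proof. by rewrite /close_edge !setDDl setUC. Qed.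

Lemma open_close_edgeC e e' G : e != e' ->
  open_edge e (close_edge e' G) = close_edge e' (open_edge e G).
Proof.
move=> /eqP ne; apply/seteqP; split=> z.
  by move=> [/= ->|[? ?]]; split => //; [left|right].
by move=> [[/= ->|?] ?]; [left|right].
Qed.

Lemma bexp_ext D f g : f =1 g -> bexp D f = bexp D g.
Proof. by move=> /funext ->. Qed.

Lemma bexpD D f g : bexp D (fun G => f G + g G) = bexp D f + bexp D g.
Proof. by elim: D f g => //= e D IH f g; rewrite !IH; ring. Qed.

Lemma bexpZ D c f : bexp D (fun G => c * f G) = c * bexp D f.
Proof. by elim: D f => //= e D IH f; rewrite !IH; ring. Qed.

Lemma bexp_cst D c : bexp D (fun=> c) = c.
Proof. by elim: D => //= e D IH; rewrite !IH; ring. Qed.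

Lemma bexp_sum I (r : seq I) D (F : I -> set E -> R) :
  bexp D (fun G => \sum_(i <- r) F i G) = \sum_(i <- r) bexp D (F i).
Proof.
elim: r => [|i r IH].
  by under bexp_ext do rewrite big_nil; rewrite big_nil bexp_cst.
by under bexp_ext do rewrite big_cons; rewrite bexpD IH big_cons.
Qed.

Lemma le_bexp D f g : (forall G, f G <= g G) -> bexp D f <= bexp D g.
Proof.
have /andP[p0 p1] := p01.
elim: D f g => //= e D IH f g fg; apply: lerD; apply: ler_wpM2l => //.
- by apply: IH => G; exact: fg.
- by rewrite subr_ge0.
- by apply: IH => G; exact: fg.
Qed.

(** [bexp] conditions on the head of the list, whereas the exploration conditions on whichever edge
    touches the explored set. Modifications at distinct edges commute, so any edge may come
    first. *)
Lemma bexp_rem D e f : uniq D -> e \in D ->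
  bexp D f = p * bexp (rem e D) (f \o open_edge e) +
             (1 - p) * bexp (rem e D) (f \o close_edge e).
Proof.
elim: D f => //= e' D IH f /andP[e'D uD]; rewrite inE.
have [->|ne /= eD] := eqVneq e e'; first by [].
rewrite !(IH _ uD eD).
have -> : f \o open_edge e' \o close_edge e = f \o close_edge e \o open_edge e'.
  by apply/funext => G /=; rewrite open_close_edgeC// eq_sym.
have -> : f \o open_edge e' \o open_edge e = f \o open_edge e \o open_edge e'.
  by apply/funext => G /=; rewrite open_open_edgeC.
have -> : f \o close_edge e' \o open_edge e = f \o open_edge e \o close_edge e'.
  by apply/funext => G /=; rewrite open_close_edgeC.
have -> : f \o close_edge e' \o close_edge e = f \o close_edge e \o close_edge e'.
  by apply/funext => G /=; rewrite close_close_edgeC.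
ring.
Qed.

End bernoulli_expectation.

(** * The exploration martingale and the count of separating edges *)

Section exploration.
Context (R : realType) (E V : choiceType) (p : R) (inc : E -> set V).
Hypothesis p01 : 0 <= p <= 1.
Implicit Types (D : seq E) (G H : set E) (S : set V) (B : seq V).

Inductive reach H S : V -> Prop :=
| reach_start x of S x : reach H S x
| reach_step x e y of reach H S x & H e & inc e x & inc e y : reach H S y.

Definition open_in D G : set E := [set e | e \in D /\ G e].

Definition touched D G S (e : E) : bool :=
  `[< exists2 v, inc e v & reach (open_in D G) S v >].

Definition weight G (e : E) : R := if `[< G e >] then 1 - p else - p.

Definition nb_touched D G S : R := \sum_(e <- D) (touched D G S e)%:R.

Definition drift D G S : R :=
  \sum_(e <- D) (touched D G S e)%:R * weight G e.

Lemma reach_sub H S S' x :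
  (forall y, S y -> reach H S' y) -> reach H S x -> reach H S' x.
Proof.
move=> SS'; elim=> [y /SS'//|y e z _ Sy He ey ez].
exact: reach_step Sy He ey ez.
Qed.

(** One step of the exploration: an open edge touching [S] can be deleted once its endpoints join
    the starting set, which leaves a problem of the same form with one edge fewer. *)
Lemma reach_open_edge D G S e : uniq D -> e \in D ->
  (exists2 v, inc e v & S v) ->
  reach (open_in D (open_edge e G)) S =
  reach (open_in (rem e D) G) (S `|` inc e).
Proof.
move=> uD eD [v ev Sv]; apply/funext => y; apply/propext; split.
  elim=> [z Sz|z e' w _ IH [e'D Ge'] e'z e'w].
    by apply: reach_start; left.
  have [ee'|ne] := eqVneq e' e.
    by apply: reach_start; right; rewrite -ee'.
  apply: (reach_step IH _ e'z e'w); split; last by rewrite -(open_edge_neq _ ne).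
  by rewrite mem_rem_uniq// inE ne.
elim=> [z [Sz|ez]|z e' w _ IH [e'D Ge'] e'z e'w].
- exact: reach_start.
- apply: (reach_step (reach_start _ Sv) _ ev ez).
  by split => //; rewrite open_edgeE.
- apply: (reach_step IH _ e'z e'w); move: e'D.
  rewrite mem_rem_uniq// inE => /andP[ne e'D].
  by split => //; rewrite open_edge_neq.
Qed.

Lemma reach_close_edge D G S e : uniq D -> e \in D ->
  reach (open_in D (close_edge e G)) S = reach (open_in (rem e D) G) S.
Proof.
move=> uD eD; congr reach; apply/seteqP; split => e'.
  move=> [e'D [Ge' ne]]; split => //.
  by rewrite mem_rem_uniq// inE e'D andbT; apply/eqP.
move=> [+ Ge']; rewrite mem_rem_uniq// inE => /andP[/eqP ? ?].
by split.
Qed.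

Lemma weight_open_edge G e : weight (open_edge e G) e = 1 - p.
Proof. by rewrite /weight asboolT// open_edgeE. Qed.

Lemma weight_close_edge G e : weight (close_edge e G) e = - p.
Proof. by rewrite /weight asboolF// close_edgeE. Qed.

Lemma touched_start D G S e : (exists2 v, inc e v & S v) -> touched D G S e.
Proof. by move=> [v ev Sv]; apply/asboolP; exists v => //; exact: reach_start. Qed.

Section step.
Variables (D : seq E) (S : set V) (e : E).
Hypotheses (uD : uniq D) (eD : e \in D) (eS : exists2 v, inc e v & S v).

Let touchedo G e' :
  touched D (open_edge e G) S e' = touched (rem e D) G (S `|` inc e) e'.
Proof. by rewrite /touched reach_open_edge. Qed.

Let touchedc G e' :
  touched D (close_edge e G) S e' = touched (rem e D) G S e'.
Proof. by rewrite /touched reach_close_edge. Qed.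

Lemma nb_touched_open G : nb_touched D (open_edge e G) S =
  1 + nb_touched (rem e D) G (S `|` inc e).
Proof.
rewrite /nb_touched (big_rem e)//= touched_start//; congr (_ + _).
by apply: eq_bigr => e' _; rewrite touchedo.
Qed.

Lemma nb_touched_close G : nb_touched D (close_edge e G) S =
  1 + nb_touched (rem e D) G S.
Proof.
rewrite /nb_touched (big_rem e)//= touched_start//; congr (_ + _).
by apply: eq_bigr => e' _; rewrite touchedc.
Qed.

Lemma drift_open G : drift D (open_edge e G) S =
  1 - p + drift (rem e D) G (S `|` inc e).
Proof.
rewrite /drift (big_rem e)//= touched_start// mul1r weight_open_edge.
congr (_ + _); apply: eq_big_seq => e'; rewrite mem_rem_uniq// inE => /andP[ne _].
by rewrite touchedo /weight open_edge_neq.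
Qed.

Lemma drift_close G : drift D (close_edge e G) S =
  - p + drift (rem e D) G S.
Proof.
rewrite /drift (big_rem e)//= touched_start// mul1r weight_close_edge.
congr (_ + _); apply: eq_big_seq => e'; rewrite mem_rem_uniq// inE => /andP[ne _].
by rewrite touchedc /weight close_edge_neq.
Qed.

End step.

Lemma untouched D G S e : ~ (exists2 e', e' \in D & exists2 v, inc e' v & S v) ->
  e \in D -> touched D G S e = false.
Proof.
move=> noe eD; apply/negbTE/negP => /asboolP[v ev rv].
have : S v.
  elim: rv => // x e' y _ Sx [e'D _] e'x _.
  by exfalso; apply: noe; exists e' => //; exists x.
by move=> Sv; apply: noe; exists e => //; exists v.
Qed.

(** Revealing an edge that touches [S] adds 1 - p with probability p and - p with probability 1 - p,
    hence nothing on average. When no edge touches [S], the exploration is over and the drift is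
    0. *)
Lemma bexp_drift D S : uniq D -> bexp p D (fun G => drift D G S) = 0.
Proof.
move: {2}(size D) (leqnn (size D)) => n; elim: n D S => [|n IH] D S.
  by rewrite leqn0 => /nilP -> _; rewrite /= /drift big_nil.
move=> sD uD.
have [[e eD eS]|noe] := pselect (exists2 e, e \in D & exists2 v, inc e v & S v).
  rewrite (bexp_rem _ _ uD eD).
  under bexp_ext do rewrite /= drift_open//.
  under [X in _ + _ * X]bexp_ext do rewrite /= drift_close//.
  by rewrite !bexpD !bexp_cst !IH ?rem_uniq ?size_rem//;
    [ring| |]; case: D sD {uD} eD.
rewrite -(bexp_cst p D 0); apply: bexp_ext => G; rewrite /drift big1_seq// => e.
by move=> /andP[_ eD]; rewrite untouched// mul0r.
Qed.

Lemma nb_touched_ge0 D G S : 0 <= nb_touched D G S.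
Proof. by apply: sumr_ge0 => e _; exact: ler0n. Qed.

(** The offsets [M] and [t] carry the value of the martingale and the number of revealed edges
    through the induction. A step adds p (1 - p), at most 1, to the second moment and 1 to [t], so
    the normalized square grows at most like a harmonic sum. *)
Lemma bexp_drift_sqr D S (M t : R) : uniq D -> 0 < t ->
  bexp p D (fun G => (M + drift D G S) ^+ 2 / (t + nb_touched D G S)) <=
  M ^+ 2 / t + \sum_(i < size D) (t + i.+1%:R)^-1.
Proof.
move: {2}(size D) (leqnn (size D)) => n; elim: n D S M t => [|n IH] D S M t.
  rewrite leqn0 => /nilP -> _ t0; rewrite /= /drift /nb_touched !big_nil.
  by rewrite big_ord0 !addr0.
move=> sD uD t0.
have sum_ge0 (k : nat) : 0 <= \sum_(i < k) (t + i.+1%:R)^-1.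
  by apply: sumr_ge0 => i _; rewrite invr_ge0 addr_ge0// ltW.
have [[e eD eS]|noe] := pselect (exists2 e, e \in D & exists2 v, inc e v & S v);
  last first.
  have dr0 G : drift D G S = 0.
    by rewrite /drift big1_seq// => e /andP[_ eD]; rewrite untouched// mul0r.
  have nb0 G : nb_touched D G S = 0.
    by rewrite /nb_touched big1_seq// => e /andP[_ eD]; rewrite untouched.
  under bexp_ext do rewrite dr0 nb0 !addr0.
  by rewrite bexp_cst lerDl.
rewrite (bexp_rem _ _ uD eD).
under bexp_ext do rewrite /= drift_open// nb_touched_open// !addrA.
under [X in _ + _ * X]bexp_ext do rewrite /= drift_close// nb_touched_close// !addrA.
have ur : uniq (rem e D) by rewrite rem_uniq.
have sr : (size (rem e D) <= n)%N by rewrite size_rem//; case: D sD {uD}  eD ur => //.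
have t10 : 0 < t + 1 by rewrite addr_gt0.
have /andP[p0 p1] := p01.
have Ho := IH _ (S `|` inc e) (M + 1 - p) _ sr ur t10.
have Hc := IH _ S (M - p) _ sr ur t10.
have sz : size D = (size (rem e D)).+1 by rewrite size_rem//; case: D {sD uD sr ur Ho Hc} eD.
rewrite sz big_ord_recl /=.
set s := \sum_(i < _) (t + 1 + _)^-1 in Ho Hc.
have -> : \sum_(i < size (rem e D)) (t + (bump 0 i).+1%:R)^-1 = s.
  by apply: eq_bigr => i _; rewrite /bump/= add1n -addrA [1 + _]addrC natr1.
apply: (@le_trans _ _ (p * ((M + 1 - p) ^+ 2 / (t + 1) + s) +
   (1 - p) * ((M - p) ^+ 2 / (t + 1) + s))).
  by apply: lerD; apply: ler_wpM2l => //; rewrite subr_ge0.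
(* The cross terms cancel because an increment has mean zero; only its variance is added. *)
have -> : p * ((M + 1 - p) ^+ 2 / (t + 1) + s) +
   (1 - p) * ((M - p) ^+ 2 / (t + 1) + s) =
   M ^+ 2 / (t + 1) + p * (1 - p) / (t + 1) + s by ring.
rewrite !addrA lerD2r; apply: lerD.
  by rewrite ler_wpM2l ?sqr_ge0// lef_pV2 ?posrE// lerDl.
rewrite -[leRHS]mul1r ler_wpM2r//; first by rewrite invr_ge0 ltW.
nra.
Qed.

Lemma reach_trans H S x y : reach H S x -> reach H [set x] y -> reach H S y.
Proof. by move=> Sx; apply: reach_sub => _ ->. Qed.

Lemma reach_edge H S e x y : reach H S x -> H e -> inc e x -> inc e y -> reach H S y.
Proof. exact: reach_step. Qed.

Lemma reach_sym H x y : reach H [set x] y -> reach H [set y] x.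
Proof.
elim=> [_ ->|z e t _ zx He ez et]; first exact: reach_start.
by apply: reach_trans zx; apply: (reach_edge _ He et ez); exact: reach_start.
Qed.

Lemma reach_cons H b B x : reach H [set` b :: B] x <->
  reach H [set b] x \/ reach H [set` B] x.
Proof.
split.
  elim=> [y /=|y e z _ [] IH He ey ez].
  - by rewrite inE => /predU1P[->|?]; [left|right]; exact: reach_start.
  - by left; exact: reach_edge IH He ey ez.
  - by right; exact: reach_edge IH He ey ez.
move=> [] ; apply: reach_sub => y /= yB; apply: reach_start => /=; rewrite inE.
  by rewrite yB eqxx.
by rewrite yB orbT.
Qed.

Definition sep D G (B : seq V) e : Prop :=
  ~ G e /\ exists u v, [/\ inc e = [set u; v], reach (open_in D G) [set` B] u,
    reach (open_in D G) [set` B] v & ~ reach (open_in D G) [set u] v].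

(* Sum of [F] over one representative of each cluster meeting [B]. *)
Fixpoint rep_sum H (F : V -> R) (B : seq V) : R :=
  if B is b :: B' then
    (if `[< reach H [set` B'] b >] then 0 else F b) + rep_sum H F B'
  else 0.

Lemma rep_sum_sum H I (r : seq I) (F : I -> V -> R) B :
  rep_sum H (fun b => \sum_(i <- r) F i b) B = \sum_(i <- r) rep_sum H (F i) B.
Proof.
elim: B => [|b B IH] /=; first by rewrite big1.
by rewrite big_split/= IH; case: asboolP => _; rewrite ?big1_eq.
Qed.

Lemma reach_disjoint H b B x : ~ reach H [set` B] b ->
  reach H [set b] x -> ~ reach H [set` B] x.
Proof. by move=> nb /reach_sym bx Bx; apply: nb; exact: reach_trans bx. Qed.

Lemma reach_cons_id H b B : reach H [set` B] b ->
  reach H [set` b :: B] = reach H [set` B].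
Proof.
move=> Bb; apply/funext => x; apply/propext; rewrite reach_cons; split; last by right.
by move=> [|//]; exact: reach_trans.
Qed.

Lemma touched_cons D G b B e :
  touched D G [set` b :: B] e = touched D G [set b] e || touched D G [set` B] e.
Proof.
apply/idP/idP.
  move=> /asboolP[v ev /reach_cons[bv|Bv]]; apply/orP; [left|right];
    by apply/asboolP; exists v.
move=> /orP[] /asboolP[v ev bv]; apply/asboolP; exists v => //; apply/reach_cons.
  by left.
by right.
Qed.

(** The sum over representatives counts an open touched edge once, since its endpoints share a
    cluster, and a closed one once per cluster that it touches. A separating edge is counted twice
    with weight - p, against once for the whole of [B]: the gap is p. *)
Lemma sep_rep_sum D G B e : e \in D ->
  p * (`[< sep D G B e >])%:R +
    rep_sum (open_in D G) (fun b => (touched D G [set b] e)%:R * weight G e) B <=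
  (touched D G [set` B] e)%:R * weight G e.
Proof.
have /andP[p0 p1] := p01.
move=> eD; elim: B => [|b B IH] /=.
  have -> : touched D G [set` [::]] e = false.
    apply/negbTE/negP => /asboolP[v _]; elim=> //.
  rewrite asboolF ?mulr0 ?mul0r ?addr0// => -[_ [u [v [_ + _ _]]]].
  by elim.
case: (asboolP (reach _ _ b)) => [Bb|nBb].
  have -> : sep D G (b :: B) e = sep D G B e by rewrite /sep reach_cons_id.
  by rewrite add0r /(touched _ _ _ e) reach_cons_id.
rewrite touched_cons addrCA; apply: (@le_trans _ _ (p * (`[< sep D G (b :: B) e >])%:R
  - p * (`[< sep D G B e >])%:R + (touched D G [set b] e)%:R * weight G e
  + (touched D G [set` B] e)%:R * weight G e)).
  by move: IH; set rs := rep_sum _ _ _; lra.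
have [Ge|nGe] := pselect (G e).
  have H1 : touched D G [set b] e -> touched D G [set` B] e -> False.
    move=> /asboolP[v ev bv] /asboolP[w ew Bw]; apply: (reach_disjoint nBb _ Bw).
    exact: (reach_edge bv _ ev ew).
  have ns B' : `[< sep D G B' e >] = false by apply: asboolF => -[].
  rewrite !ns /=.
  move: H1; case: (touched D G [set b] e); case: (touched D G [set` B] e) => //= H1;
    rewrite ?mulr0 ?mul0r; try lra.
have -> : weight G e = - p by rewrite /weight asboolF.
have : `[< sep D G (b :: B) e >] ->
    `[< sep D G B e >] || touched D G [set b] e && touched D G [set` B] e.
  move=> /asboolP[_ [u [v [euv]]]] /reach_cons[] ru /reach_cons[] rv nuv.
  - by exfalso; apply: nuv; exact: reach_trans (reach_sym ru) rv.
  - apply/orP; right; apply/andP; split; apply/asboolP.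
      by exists u => //; rewrite euv; left.
    by exists v => //; rewrite euv; right.
  - apply/orP; right; apply/andP; split; apply/asboolP.
      by exists v => //; rewrite euv; right.
    by exists u => //; rewrite euv; left.
  - by apply/orP; left; apply/asboolP; split => //; exists u, v.
case: (`[< sep D G (b :: B) e >]); case: (`[< sep D G B e >]);
  case: (touched D G [set b] e); case: (touched D G [set` B] e) => //= H1;
  rewrite ?mulr0 ?mul0r ?mulr1 ?mul1r ?add0r ?addr0 ?subr0; try lra.
all: by have := H1 isT.
Qed.

(** The clusters of distinct representatives are disjoint, so each endpoint lies in at most one of
    them. *)
Lemma rep_sum_touched D G B e u v : inc e = [set u; v] ->
  rep_sum (open_in D G) (fun b => (touched D G [set b] e)%:R) B <=
  (`[< reach (open_in D G) [set` B] u >])%:R +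
  (`[< reach (open_in D G) [set` B] v >])%:R.
Proof.
move=> euv; elim: B => [|b B IH] /=; first by rewrite addr_ge0.
case: (asboolP (reach _ _ b)) => [Bb|nBb].
  by rewrite add0r; move: IH; rewrite -(reach_cons_id Bb).
rewrite addrC; apply: (le_trans (lerD IH (lexx _))).
have T : touched D G [set b] e -> `[< reach (open_in D G) [set b] u >] ||
    `[< reach (open_in D G) [set b] v >].
  by move=> /asboolP[w]; rewrite euv => -[->|->] r; apply/orP; [left|right];
    apply/asboolP.
have C x : (`[< reach (open_in D G) [set` b :: B] x >])%:R =
    (`[< reach (open_in D G) [set b] x >])%:R +
    (`[< reach (open_in D G) [set` B] x >])%:R :> R.
  case: (asboolP (reach _ [set b] x)) => bx.
    by rewrite asboolT ?asboolF ?addr0//; [exact: reach_disjoint bx|apply/reach_cons; left].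
  rewrite add0r; congr (_ %:R); congr nat_of_bool; apply/asbool_equiv_eq.
  by rewrite reach_cons; split => [[]//|?]; right.
rewrite !C; move: T.
case: (touched _ _ _ _); case: `[< _ >]; case: `[< _ >]; case: `[< _ >]; case: `[< _ >] => //= T;
  try lra; by have := T isT.
Qed.

Lemma ler_rep_sum H (F F' : V -> R) B : (forall b, F b <= F' b) ->
  rep_sum H F B <= rep_sum H F' B.
Proof.
move=> FF'; elim: B => //= b B IH; apply: lerD => //.
by case: ifP.
Qed.

Lemma le_rep_sum_sum H (F : V -> R) B : (forall b, 0 <= F b) ->
  rep_sum H F B <= \sum_(b <- B) F b.
Proof.
move=> F0; elim: B => [|b B IH] /=; rewrite ?big_nil// big_cons; apply: lerD => //.
by case: ifP.
Qed.

Lemma rep_sumD H (F F' : V -> R) B :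
  rep_sum H (fun b => F b + F' b) B = rep_sum H F B + rep_sum H F' B.
Proof. by elim: B => [|b B IH] /=; rewrite ?addr0// IH; case: ifP => _; ring. Qed.

Lemma rep_sumZ H c (F : V -> R) B :
  rep_sum H (fun b => c * F b) B = c * rep_sum H F B.
Proof. by elim: B => [|b B IH] /=; rewrite ?mulr0// IH; case: ifP => _; ring. Qed.

Hypothesis inc2 : forall e, exists u v, inc e = [set u; v].

(** Summed over the edges, [sep_rep_sum] bounds the separating ones by the drift of [B] minus the
    drifts of its clusters. Each term - h is at most lam h^2 / a + a / lam with a = 1 + N, because
    h^2 / a is the quantity whose expectation is controlled; the a of the different clusters add up
    to at most |B| + 2 |D|. *)
Lemma sum_sep_le D G B (lam : R) : 0 < lam ->
  p * (\sum_(e <- D) (`[< sep D G B e >])%:R) <=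
  drift D G [set` B] +
  lam * (\sum_(b <- B) (0 + drift D G [set b]) ^+ 2 / (1 + nb_touched D G [set b])) +
  ((size B)%:R + 2 * (size D)%:R) / lam.
Proof.
move=> l0; set H := open_in D G.
have s1 : p * (\sum_(e <- D) (`[< sep D G B e >])%:R) +
    rep_sum H (fun b => drift D G [set b]) B <= drift D G [set` B].
  rewrite rep_sum_sum mulr_sumr -big_split /= /drift !big_seq.
  by apply: ler_sum => e eD; exact: sep_rep_sum.
have s2 : rep_sum H (fun b => nb_touched D G [set b]) B <= 2 * (size D)%:R.
  rewrite rep_sum_sum -[in leRHS](sum1_size D) natr_sum mulr_sumr.
  apply: ler_sum => e _; have [u [v euv]] := inc2 e.
  apply: (le_trans (rep_sum_touched D G B euv)).
  by do 2 case: `[< _ >] => /=; lra.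
have s3 : rep_sum H (fun b => - drift D G [set b]) B <=
    rep_sum H (fun b => lam * ((0 + drift D G [set b]) ^+ 2 / (1 + nb_touched D G [set b]))
      + lam^-1 * (1 + nb_touched D G [set b])) B.
  apply: ler_rep_sum => b; rewrite add0r.
  have := nb_touched_ge0 D G [set b]; set N := nb_touched _ _ _; set h := drift _ _ _.
  move=> N0; have N1 : 0 < 1 + N by rewrite ltr_pwDl.
  set a := 1 + N in N1 *.
  have -> : lam * (h ^+ 2 / a) + lam^-1 * a = (lam * h + a) ^+ 2 / (lam * a) - 2 * h.
    by field; rewrite !gt_eqF.
  have -> : - h = ((lam * h + a) ^+ 2 - (lam * h + a) ^+ 2 - h * (lam * a)) / (lam * a).
    by field; rewrite !gt_eqF.
  have -> : (lam * h + a) ^+ 2 / (lam * a) - 2 * h =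
      ((lam * h + a) ^+ 2 - 2 * h * (lam * a)) / (lam * a).
    by field; rewrite !gt_eqF.
  by rewrite ler_pM2r ?invr_gt0 ?mulr_gt0//; nra.
have N1 : rep_sum H (fun b => -1 * drift D G [set b]) B =
    - rep_sum H (fun b => drift D G [set b]) B by rewrite rep_sumZ mulN1r.
have {}N1 : rep_sum H (fun b => - drift D G [set b]) B =
    - rep_sum H (fun b => drift D G [set b]) B.
  by rewrite -N1; congr rep_sum; apply/funext => b; rewrite mulN1r.
rewrite N1 rep_sumD !rep_sumZ rep_sumD in s3.
have s4 : rep_sum H (fun=> 1) B <= (size B)%:R.
  rewrite -(sum1_size B) natr_sum.
  by apply: (@le_rep_sum_sum H (fun=> 1)) => b; exact: ler01.
have s5 := le_rep_sum_sum H B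
    (F := fun b => (0 + drift D G [set b]) ^+ 2 / (1 + nb_touched D G [set b])).
have {}s5 := s5 (fun b => divr_ge0 (sqr_ge0 _) (addr_ge0 ler01 (nb_touched_ge0 D G [set b]))).
have li : 0 <= lam^-1 by rewrite invr_ge0 ltW.
have s6 := lerD s4 s2; have {}s6 := ler_wpM2l li s6.
have {}s5 := ler_wpM2l (ltW l0) s5.
rewrite [_ / lam]mulrC; lra.
Qed.

(* Aizenman-Kesten-Newman. When [D] is the set of edges of a box and [B] its
   boundary, optimizing over [lam] makes the bound negligible with respect to
   [size D]. *)
Lemma bexp_sep_le D B (lam : R) : uniq D -> 0 < lam ->
  p * (\sum_(e <- D) bexp p D (fun G => (`[< sep D G B e >])%:R)) <=
  lam * ((size B)%:R * \sum_(i < size D) (1 + i.+1%:R)^-1) +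
  ((size B)%:R + 2 * (size D)%:R) / lam.
Proof.
move=> uD l0; rewrite -bexp_sum -bexpZ.
apply: (le_trans (le_bexp p01 _ (fun G => sum_sep_le D G B l0))).
rewrite !bexpD bexp_drift// bexp_cst bexpZ bexp_sum add0r lerD2r.
apply: ler_wpM2l; first exact: ltW.
rewrite -[in leRHS](sum1_size B) natr_sum mulr_suml; apply: ler_sum => b _.
apply: (le_trans (bexp_drift_sqr _ _ uD ltr01)).
by rewrite expr0n/= mul0r add0r mul1r.
Qed.

End exploration.

(** * Bernoulli bond percolation *)

Section measure_tools.
Context d (T : measurableType d) (R : realType).

Lemma measurable_preimage d' (T' : measurableType d') (f : T -> T') B :
  measurable_fun setT f -> measurable B -> measurable (f @^-1` B).
Proof. by move=> mf mB; rewrite -[X in measurable X]setTI; exact: mf. Qed.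

Lemma measurable_exists (U : countType) (F : U -> set T) :
  (forall u, measurable (F u)) -> measurable [set t | exists u, F u t].
Proof.
move=> mF; rewrite (_ : [set t | _] = \bigcup_u F u).
  by apply: countable_bigcupT_measurable => //; exact: countableP.
by apply/seteqP; split=> [t [u]|t [u _]] Fu; exists u.
Qed.

Lemma measurable_forall (U : countType) (F : U -> set T) :
  (forall u, measurable (F u)) -> measurable [set t | forall u, F u t].
Proof.
move=> mF; rewrite -[X in measurable X]setCK; apply: measurableC.
rewrite (_ : ~` _ = [set t | exists u, (~` F u) t]).
  by apply: measurable_exists => u; exact: measurableC.
by apply/seteqP; split=> [t /existsNP|t [u Fu] /(_ u)].
Qed.

Lemma measurable_prop (Q : Prop) : measurable [set _ : T | Q].
Proof.
have [q|nq] := pselect Q.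
  by rewrite (_ : [set _ | _] = setT)//; apply/seteqP; split.
by rewrite (_ : [set _ | _] = set0)//; apply/seteqP; split.
Qed.

Lemma measurable_fun_gsigma (U : pointedType) (G : set (set U))
    (f : T -> g_sigma_algebraType G) :
  (forall B, G B -> measurable (f @^-1` B)) -> measurable_fun setT f.
Proof.
move=> mf; apply: (@measurability _ _ T (g_sigma_algebraType G) setT f G) => // _ [B GB <-].
by rewrite setTI; exact: mf.
Qed.

Section image_prob.
Context d' (T' : measurableType d') (P : probability T R) (f : T -> T').
Hypothesis mf : measurable_fun setT f.
Let phi : {mfun T >-> T'} := HB.pack f (isMeasurableFun.Build _ _ _ _ f mf).

Definition image_prob : probability T' R := distribution P phi.

Lemma image_probE A : image_prob A = P (f @^-1` A).
Proof. by []. Qed.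

End image_prob.

End measure_tools.

Lemma eq_measure_gsigma (R : realType) (U : pointedType) (G C : set (set U))
    (m1 m2 : {measure set (g_sigma_algebraType G) -> \bar R}) :
  G `<=` C -> C `<=` <<s G >> -> setI_closed C -> C setT ->
  (m1 setT < +oo)%E -> (forall A, C A -> m1 A = m2 A) ->
  forall A, measurable A -> m1 A = m2 A.
Proof.
move=> GC CG CI CT m1T m12 A mA.
apply: (@measure_unique _ R (g_sigma_algebraType G) C (fun=> setT)) => //.
  apply/seteqP; split; first exact: sub_sigma_algebra2.
  by apply: smallest_sub => //; exact: smallest_sigma_algebra.
by apply/seteqP; split=> // x _; exists 0%N.
Qed.

Section bond_measure.
Context (R : realType) (d : nat).
Implicit Types (e : edge d) (J : {fset edge d}) (A : set (subgraph_space d)).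

(** Only open edges are prescribed: such cylinders already form a generating pi-system, and
    [bond_percolation] gives their probabilities directly. *)
Definition cyl J : set (subgraph_space d) :=
  \bigcap_(e in [set` J]) [set G : subgraph d | G e].

Lemma measurable_edge e : measurable ([set G : subgraph d | G e] : set (subgraph_space d)).
Proof. by apply: sub_sigma_algebra; exists e. Qed.

Lemma measurable_cyl J : measurable (cyl J).
Proof. by apply: fin_bigcap_measurable => // e _; exact: measurable_edge. Qed.

Lemma cylI J J' : cyl J `&` cyl J' = cyl (J `|` J')%fset.
Proof. by rewrite /cyl -bigcap_setU set_fsetU. Qed.

Lemma cyl0 : cyl fset0 = setT.
Proof. by rewrite /cyl set_fset0 bigcap_set0. Qed.

Lemma eq_measure_cyl (m1 m2 : {measure set (subgraph_space d) -> \bar R}) :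
  (m1 setT < +oo)%E -> (forall J, m1 (cyl J) = m2 (cyl J)) ->
  forall A, measurable A -> m1 A = m2 A.
Proof.
move=> m1T m12; apply: (@eq_measure_gsigma _ _ _ [set A | exists J, A = cyl J]) => //.
- by move=> A [e ->]; exists [fset e]%fset; rewrite /cyl set_fset1 bigcap_set1.
- by move=> A [J ->]; exact: measurable_cyl.
- by move=> A B [J ->] [J' ->]; rewrite cylI; eexists.
- by exists fset0; rewrite cyl0.
- by move=> A [J ->].
Qed.

Lemma measurable_open_edge e :
  measurable_fun setT (open_edge e : subgraph_space d -> subgraph_space d).
Proof.
apply: measurable_fun_gsigma => _ [e' ->].
have [->|ne] := eqVneq e' e.
  rewrite (_ : _ @^-1` _ = setT)//; apply/seteqP; split => // G _ /=.
  by rewrite open_edgeE.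
rewrite (_ : _ @^-1` _ = [set G | G e']); first exact: measurable_edge.
by apply/seteqP; split => // G /=; rewrite open_edge_neq.
Qed.

Lemma measurable_close_edge e :
  measurable_fun setT (close_edge e : subgraph_space d -> subgraph_space d).
Proof.
apply: measurable_fun_gsigma => _ [e' ->].
have [->|ne] := eqVneq e' e.
  rewrite (_ : _ @^-1` _ = set0)//; apply/seteqP; split => // G /=.
  by rewrite close_edgeE.
rewrite (_ : _ @^-1` _ = [set G | G e']); first exact: measurable_edge.
by apply/seteqP; split => // G /=; rewrite close_edge_neq.
Qed.

Definition determined (D : seq (edge d)) A :=
  forall G G' : subgraph d, (forall e, e \in D -> G e <-> G' e) -> A G -> A G'.

Lemma determined_open e (D : seq (edge d)) A : determined (e :: D) A ->
  determined D (open_edge e @^-1` A).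
Proof.
move=> dA G G' GG' /=; apply: dA => e'; rewrite inE.
have [->|ne /= e'D] := eqVneq e' e; first by rewrite !open_edgeE.
by rewrite !open_edge_neq//; exact: GG'.
Qed.

Lemma determined_close e (D : seq (edge d)) A : determined (e :: D) A ->
  determined D (close_edge e @^-1` A).
Proof.
move=> dA G G' GG' /=; apply: dA => e'; rewrite inE.
have [->|ne /= e'D] := eqVneq e' e; first by rewrite !close_edgeE.
by rewrite !close_edge_neq//; exact: GG'.
Qed.

Lemma open_edge_id e (G : subgraph d) : G e -> open_edge e G = G.
Proof. by move=> Ge; apply/seteqP; split => z; [case=> [/= ->|]|right]. Qed.

Lemma close_edge_id e (G : subgraph d) : ~ G e -> close_edge e G = G.
Proof.
by move=> nGe; apply/seteqP; split => z; [case|move=> Gz; split => //= ze; apply: nGe; rewrite -ze].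
Qed.

Lemma determined_nil A : determined [::] A -> A = set0 \/ A = setT.
Proof.
move=> dA; have [[G AG]|nA] := pselect (exists G, A G).
  by right; apply/seteqP; split => // G' _; exact: dA AG.
by left; apply/seteqP; split => // G AG; apply: nA; exists G.
Qed.

Lemma determined_measurable (D : seq (edge d)) A : determined D A -> measurable A.
Proof.
elim: D A => [A /determined_nil[]->//|e D IH A dA].
have me := measurable_edge e.
rewrite (_ : A = ([set G | G e] `&` (open_edge e @^-1` A)) `|`
   (~` [set G | G e] `&` (close_edge e @^-1` A))).
  apply: measurableU; apply: measurableI => //.
  - by apply: IH; apply: determined_open.
  - exact: (measurableC me).
  - by apply: IH; apply: determined_close.
apply/seteqP; split => G.
  move=> AG; have [Ge|nGe] := pselect (G e); [left|right]; split => //=.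
    by rewrite open_edge_id.
  by rewrite close_edge_id.
by move=> [[/= Ge]|[/= nGe]]; rewrite ?open_edge_id// close_edge_id.
Qed.

Section fixed_p.
Context (p : R) (mu : probability (subgraph_space d) R).
Hypotheses (p01 : 0 < p < 1) (hmu : bond_percolation p mu).

Let p0 : 0 <= p. Proof. by case/andP: p01 => /ltW. Qed.
Let p1 : 0 <= 1 - p. Proof. by case/andP: p01 => _ /ltW; rewrite subr_ge0. Qed.

Lemma mu_cyl J : mu (cyl J) = (p ^+ #|` J|)%:E.
Proof.
case: hmu => mue ->; under eq_bigr do rewrite mue.
rewrite prodEFin big_const_seq count_predT; congr EFin.
by elim: (size J) => //= n ->; rewrite exprS.
Qed.

(** Tossing the coin of [e] afresh does not change the law: both sides are measures in [A], so
    cylinders suffice. Finite computations, independence and finite energy all derive from this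
    identity. *)
Lemma resample e A : measurable A ->
  mu A = (p%:E * mu (open_edge e @^-1` A) + (1 - p)%:E * mu (close_edge e @^-1` A))%E.
Proof.
move=> mA; pose mo := image_prob mu (measurable_open_edge e).
pose mc := image_prob mu (measurable_close_edge e).
pose m := measure_add (mscale (NngNum p0) mo) (mscale (NngNum p1) mc).
have mE B : m B = (p%:E * mu (open_edge e @^-1` B) + (1 - p)%:E * mu (close_edge e @^-1` B))%E.
  by rewrite /m measure_addE.
rewrite -mE; apply: eq_measure_cyl => //.
  by rewrite -ge0_fin_numE ?measure_ge0// fin_num_measure.
move=> J; apply: (eq_trans _ (esym (mE _))); rewrite [LHS]mu_cyl.
have [eJ|eJ] := boolP (e \in J).
  have -> : close_edge e @^-1` cyl J = set0.
    apply/seteqP; split => // G /= /(_ e eJ).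
    by rewrite /= close_edgeE.
  have -> : open_edge e @^-1` cyl J = cyl (J `\ e)%fset.
    apply/seteqP; split => G GJ e' /=.
      rewrite !inE => /andP[ne e'J]; have := GJ e' e'J.
      by rewrite /= open_edge_neq.
    move=> e'J; have [->|ne] := eqVneq e' e; first by rewrite open_edgeE.
    by rewrite open_edge_neq//; apply: GJ; rewrite /= !inE ne.
  rewrite measure0 mule0 adde0 mu_cyl -EFinM -exprS; congr (_ ^+ _)%:E.
  by rewrite (cardfsD1 e J) eJ.
have -> : close_edge e @^-1` cyl J = cyl J.
  apply/seteqP; split => G GJ e' /= e'J; have := GJ e' e'J => /=;
  by rewrite close_edge_neq//; apply: contraNneq eJ => <-.
have -> : open_edge e @^-1` cyl J = cyl J.
  apply/seteqP; split => G GJ e' /= e'J; have := GJ e' e'J => /=;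
  by rewrite open_edge_neq//; apply: contraNneq eJ => <-.
by rewrite mu_cyl -!EFinM -EFinD; congr EFin; ring.
Qed.

Lemma mu_fin_num A : measurable A -> mu A \is a fin_num.
Proof. exact: fin_num_measure. Qed.

Lemma mu_determined (D : seq (edge d)) A : uniq D -> determined D A ->
  mu A = (bexp p D (fun G => (`[< A G >])%:R))%:E.
Proof.
elim: D A => [A _ /determined_nil[]-> /=|e D IH A /= /andP[eD uD] dA].
- by rewrite measure0 asboolF.
- by rewrite probability_setT asboolT.
rewrite (resample e (determined_measurable dA)).
by rewrite (IH _ uD (determined_open dA)) (IH _ uD (determined_close dA)).
Qed.

(** The edges of [D] are resampled one at a time until [A] becomes trivial. [B] is unaffected by
    this, so it may depend on infinitely many edges. *)
Lemma mu_independent (D : seq (edge d)) A (B : set (subgraph_space d)) :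
  determined D A -> measurable B ->
  (forall G G' : subgraph d, (forall e, e \notin D -> G e <-> G' e) -> B G -> B G') ->
  mu (A `&` B) = (mu A * mu B)%E.
Proof.
move=> + mB; elim: D A => [A /determined_nil[]-> _|e D IH A dA iB].
- by rewrite set0I measure0 mul0e.
- by rewrite setTI probability_setT mul1e.
have mA := determined_measurable dA.
have eB : open_edge e @^-1` B = B.
  apply/seteqP; split => G /=; apply: iB => e'; rewrite inE negb_or => /andP[ne _];
  by rewrite open_edge_neq.
have cB : close_edge e @^-1` B = B.
  apply/seteqP; split => G /=; apply: iB => e'; rewrite inE negb_or => /andP[ne _];
  by rewrite close_edge_neq.
have {}iB : forall G G' : subgraph d, (forall e, e \notin D -> G e <-> G' e) -> B G -> B G'.
  by move=> G G' GG'; apply: iB => e'; rewrite inE negb_or => /andP[_ /GG'].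
rewrite (resample e (measurableI _ _ mA mB)) (resample e mA) !preimage_setI eB cB.
rewrite (IH _ (determined_open dA))// (IH _ (determined_close dA))//.
have mo := measurable_preimage (measurable_open_edge e) mA.
have mc := measurable_preimage (measurable_close_edge e) mA.
move: (mu_fin_num mo) (mu_fin_num mc) (mu_fin_num mB).
move=> /fineK <- /fineK <- /fineK <-.
by rewrite -!(EFinM, EFinD); congr EFin; ring.
Qed.

(** Finite energy: by [resample], [mu A] is at least p times the probability of the preimage, and p
    > 0. *)
Lemma null_open_edge e A : measurable A -> mu A = 0%E -> mu (open_edge e @^-1` A) = 0%E.
Proof.
move=> mA; rewrite (resample e mA) => /eqP.
have /andP[p_gt0 _] := p01.
rewrite padde_eq0 ?mule_ge0 ?lee_fin// => /andP[+ _].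
by rewrite mule_eq0 eqe gt_eqF//= => /eqP.
Qed.

Lemma null_close_edge e A : measurable A -> mu A = 0%E -> mu (close_edge e @^-1` A) = 0%E.
Proof.
move=> mA; rewrite (resample e mA) => /eqP.
have /andP[_ p_lt1] := p01.
rewrite padde_eq0 ?mule_ge0 ?lee_fin// => /andP[_ +].
by rewrite mule_eq0 eqe subr_eq0 gt_eqF//= => /eqP.
Qed.

End fixed_p.

End bond_measure.

(** * The lattice and its translations *)

Section lattice.
Context (d : nat).
Implicit Types (x y z v w : Zd d) (e : edge d) (G : subgraph d) (n m : nat).

Definition ends e : set (Zd d) := val e.

Lemma endsP e : exists x y, ends e = [set x; y] /\ \sum_(i < d) `|x i - y i| = 1.
Proof. by have := set_mem (valP e). Qed.

Lemma ends2 e : exists x y, ends e = [set x; y].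
Proof. by have [x [y [exy _]]] := endsP e; exists x, y. Qed.

Lemma zdD x y i : (x + y) i = x i + y i.
Proof. by rewrite ffunE. Qed.

Lemma zdN x i : (- x) i = - x i.
Proof. by rewrite ffunE. Qed.

Lemma zd0 i : (0 : Zd d) i = 0.
Proof. by rewrite ffunE. Qed.

Lemma boxP n x : box d n x <-> forall i, `|x i| <= n%:Z.
Proof. by split=> h i; have := h i; rewrite ler_norml. Qed.

Lemma box_add n m x y : box d n x -> box d m y -> box d (n + m) (x + y).
Proof. by move=> hx hy i; have := hx i; have := hy i; rewrite zdD; lia. Qed.

Lemma box_opp n x : box d n x -> box d n (- x).
Proof. by move=> hx i; have := hx i; rewrite zdN; lia. Qed.

Lemma box_sub n m x y : box d n x -> box d m y -> box d (n + m) (x - y).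
Proof. by move=> hx hy; apply: box_add => //; exact: box_opp. Qed.

Lemma box_le n m x : (n <= m)%N -> box d n x -> box d m x.
Proof. by move=> nm hx i; have := hx i; lia. Qed.

Lemma box0 n : box d n 0.
Proof. by move=> i; rewrite zd0; lia. Qed.

Lemma ends_box e x y : ends e x -> ends e y -> box d 1 (x - y).
Proof.
have [u [v [euv uv]]] := endsP e; rewrite euv.
have B (a b : Zd d) : \sum_(i < d) `|a i - b i| = 1 -> box d 1 (a - b).
  move=> ab; apply/boxP => i; rewrite -[1%:Z]/(1 : int) -ab (bigD1 i)//= zdD zdN lerDl.
  by apply: sumr_ge0.
have uv' : \sum_(i < d) `|v i - u i| = 1.
  by rewrite -uv; apply: eq_bigr => i _; rewrite distrC.
by move=> [] -> [] ->; rewrite ?subrr; try exact: B; exact: box0.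
Qed.

Definition box_fun n (f : {ffun 'I_d -> 'I_(n.*2.+1)}) : Zd d :=
  [ffun i => (f i)%:Z - n%:Z].

Lemma box_fun_inj n : injective (@box_fun n).
Proof.
move=> f g /ffunP fg; apply/ffunP => i; apply/val_inj => /=.
by have := fg i; rewrite !ffunE => /addIr[].
Qed.

Lemma box_image n : box d n = @box_fun n @` setT.
Proof.
apply/seteqP; split => x; last first.
  by move=> [f _ <-] i; rewrite ffunE; have := ltn_ord (f i); lia.
move=> hx; have lt i : (absz (x i + n%:Z)%R < n.*2.+1)%N by have := hx i; lia.
exists [ffun i => Ordinal (lt i)] => //; apply/ffunP => i; rewrite !ffunE /=.
by have := hx i; lia.
Qed.

Lemma finite_box n : finite_set (box d n).
Proof. by rewrite box_image; apply: finite_image; exact: finite_finset. Qed.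

Definition bx n : {fset Zd d} := fset_set (box d n).

Lemma in_bx n x : (x \in bx n) <-> box d n x.
Proof. by rewrite /bx in_fset_set ?inE//; exact: finite_box. Qed.

Lemma card_bx n : #|` bx n| = (n.*2.+1 ^ d)%N.
Proof.
have -> : bx n = [fset box_fun f | f in [set: {ffun 'I_d -> 'I_(n.*2.+1)}]%SET]%fset.
  apply/fsetP => x; apply/idP/idP => [/in_bx|].
    by rewrite box_image => -[f _ <-]; apply/imfsetP; exists f; rewrite //= inE.
  by move=> /imfsetP[f _ ->]; apply/in_bx; rewrite box_image; exists f.
rewrite card_imfset /=; last exact: box_fun_inj.
by rewrite -cardE cardsT card_ffun !card_ord.
Qed.

Lemma finite_sub_box (A : set (Zd d)) : finite_set A -> exists n, A `<=` box d n.
Proof.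
move=> /finite_fsetP[F ->].
exists (\sum_(x <- F) \sum_(i < d) `|x i|)%N => x /= xF i.
have : (`|x i| <= \sum_(x <- F) \sum_(i < d) `|x i|)%N.
  rewrite (big_rem x)//= (bigD1 i)//= -addnA; exact: leq_addr.
move: (\sum_(_ <- _) _)%N => s xs; rewrite -ler_norml.
by rewrite -abszE lez_nat.
Qed.

Lemma ends_inj : injective ends.
Proof. exact: val_inj. Qed.

Lemma finite_edges (F : set (Zd d)) : finite_set F ->
  finite_set [set e | ends e `<=` F].
Proof.
move=> finF; have [n Fn] := finite_sub_box finF.
apply: (@sub_finite_set _ _ (ends @^-1` ((fun xy => [set xy.1; xy.2]) @` (box d n `*` box d n)))).
  move=> e /= eF; have [x [y exy]] := ends2 e.
  exists (x, y); last by rewrite exy.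
  by split; apply: Fn; apply: eF; rewrite exy; [left|right].
apply: finite_preimage; first by move=> ? ? _ _; exact: ends_inj.
by apply: finite_image; apply: finite_setX; exact: finite_box.
Qed.

Lemma shift_edge_proof v e : Ed d [set x + v | x in ends e].
Proof.
have [x [y [-> xy]]] := endsP e; exists (x + v), (y + v); split.
  by rewrite image_setU !image_set1.
by rewrite -xy; apply: eq_bigr => i _; rewrite !ffunE opprD addrACA subrr addr0.
Qed.

Definition shift_edge v e : edge d := SigSub (mem_set (shift_edge_proof v e)).

Lemma ends_shift v e x : ends (shift_edge v e) x <-> ends e (x - v).
Proof.
split; first by move=> [y ey <-]; rewrite addrK.
by move=> ?; exists (x - v) => //; rewrite subrK.
Qed.

Lemma shift_edgeD v w e : shift_edge v (shift_edge w e) = shift_edge (v + w) e.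
Proof.
apply/ends_inj/seteqP; split => x.
  by move=> /ends_shift/ends_shift ?; apply/ends_shift; rewrite opprD addrA.
by move=> /ends_shift ?; apply/ends_shift/ends_shift; rewrite -addrA -opprD.
Qed.

Lemma shift_edge0 e : shift_edge 0 e = e.
Proof.
by apply/ends_inj/seteqP; split => x; [move=> /ends_shift|move=> ?; apply/ends_shift];
  rewrite subr0.
Qed.

Lemma shift_edge_inj v : injective (shift_edge v).
Proof.
move=> e e' /(congr1 (shift_edge (- v))).
by rewrite !shift_edgeD addNr !shift_edge0.
Qed.

(** The sign is chosen so that the origin of [shift_graph v G] sees what [v] sees in [G]. *)
Definition shift_graph v G : subgraph d := [set e | G (shift_edge v e)].

Lemma shift_graphD v w G : shift_graph v (shift_graph w G) = shift_graph (v + w) G.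
Proof. by apply/seteqP; split => e; rewrite /shift_graph/= shift_edgeD addrC. Qed.

Lemma shift_graph0 G : shift_graph 0 G = G.
Proof. by apply/seteqP; split => e; rewrite /shift_graph/= shift_edge0. Qed.

Notation conn G x := (reach ends G [set x]).

Lemma conn_shift_sub v G x y : conn (shift_graph v G) x y -> conn G (x + v) (y + v).
Proof.
elim=> [_ ->|{}y e z _ IH Ge ey ez]; first exact: reach_start.
by apply: (reach_step IH Ge); apply/ends_shift; rewrite addrK.
Qed.

Lemma conn_shift v G x y : conn (shift_graph v G) x y <-> conn G (x + v) (y + v).
Proof.
split; first exact: conn_shift_sub.
rewrite -{1}(shift_graph0 G) -(subrr v) addrC -shift_graphD => /conn_shift_sub.
by rewrite !addrK.
Qed.

Lemma linked_conn G S x y : linked G S x y -> conn G x y.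
Proof.
move=> [s [+ + _]]; elim: s x => [x _ <-|z s IH x /= /andP[/asboolP[e [Ge exz]] zs] lz].
  exact: reach_start.
apply: (reach_trans _ (IH _ zs lz)).
have ex : ends e x by rewrite /ends exz; left.
have ez : ends e z by rewrite /ends exz; right.
by apply: (reach_step _ Ge ex ez); exact: reach_start.
Qed.

Lemma conn_linked G x y : conn G x y -> linked G (conn G x) x y.
Proof.
elim=> [z ->|{}y e z xy [s [ps ls sS]] Ge ey ez].
  exists [::]; split => // w; rewrite inE => /eqP ->; exact: reach_start.
have [->|yz] := eqVneq z y; first by exists s.
exists (rcons s z); split.
- rewrite rcons_path ps /= ls; apply/asboolP; exists e; split => //.
  have [a [b eab]] := ends2 e; move: ey ez yz; rewrite -/(ends e) eab.
  by move=> [] -> [] ->; rewrite ?eqxx// setUC.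
- by rewrite last_rcons.
- move=> w; rewrite -rcons_cons mem_rcons inE => /predU1P[->|]; last exact: sS.
  exact: reach_step xy Ge ey ez.
Qed.

Lemma linked_sub G (S S' : set (Zd d)) x y : S `<=` S' -> linked G S x y -> linked G S' x y.
Proof. by move=> SS' [s [? ? h]]; exists s; split => // z /h/SS'. Qed.

Lemma cluster_ofE G x : cluster_of G x = conn G x.
Proof.
apply/seteqP; split => y; first exact: linked_conn.
by move=> /conn_linked; apply: linked_sub.
Qed.

Lemma conn_refl G x : conn G x x.
Proof. exact: reach_start. Qed.

Lemma conn_eq G x y : conn G x y -> conn G x = conn G y.
Proof.
move=> xy; apply/funext => z; apply/propext; split => [xz|]; last exact: reach_trans.
exact: reach_trans (reach_sym xy) xz.
Qed.

Lemma connected_cluster G x : Defs.connected_subset G (cluster_of G x).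
Proof.
move=> y z; rewrite cluster_ofE => xy xz.
rewrite (conn_eq xy); apply: conn_linked.
by rewrite -(conn_eq xy).
Qed.

Definition inf_cluster G x := infinite_set (conn G x).

Lemma inf_clusterE G x : infinite_set (cluster_of G x) = inf_cluster G x.
Proof. by rewrite cluster_ofE. Qed.

Definition in_ball n G x : Prop := forall y, conn G x y -> box d n (y - x).

(** Finiteness becomes a countable increasing union of events determined by finitely many edges.
    Measurability and the local approximations of the field rest on this form. *)
Lemma finite_clusterP G x : ~ inf_cluster G x <-> exists n, in_ball n G x.
Proof.
split=> [/contrapT fx|[n bn]].
  have [n Fn] := finite_sub_box (finite_image (fun y => y - x) fx).
  by exists n => y xy; apply: Fn; exists y.
apply; apply: (@sub_finite_set _ _ [set y + x | y in box d n]).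
  by move=> y /bn ?; exists (y - x) => //; rewrite subrK.
exact/finite_image/finite_box.
Qed.

Lemma inf_cluster_conn G x y : conn G x y -> inf_cluster G x -> inf_cluster G y.
Proof. by rewrite /inf_cluster => /conn_eq ->. Qed.

Lemma in_ball_shift n v G x : in_ball n (shift_graph v G) x <-> in_ball n G (x + v).
Proof.
split=> h y xy.
  have : box d n (y - v - x) by apply: h; apply/conn_shift; rewrite subrK.
  by rewrite opprD addrA addrAC.
have : box d n (y + v - (x + v)) by apply: h; apply/conn_shift.
by rewrite opprD addrACA subrr addr0.
Qed.

Lemma inf_cluster_shift v G x : inf_cluster (shift_graph v G) x <-> inf_cluster G (x + v).
Proof.
have H : (~ inf_cluster (shift_graph v G) x) <-> ~ inf_cluster G (x + v).
  rewrite !finite_clusterP; split => -[n h]; exists n.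
    exact: (iffLR (in_ball_shift _ _ _ _) h).
  exact: (iffRL (in_ball_shift _ _ _ _) h).
split => h; apply: contrapT => h'; first by move/H: h'.
by move: h'; rewrite H.
Qed.

(** The radius is n + 1 rather than n: to know that a cluster stays within distance n, one must also
    see that the edges leaving the ball are closed. *)
Definition near_edges n x : seq (edge d) :=
  fset_set [set e | ends e `<=` [set y | box d n.+1 (y - x)]].

Lemma in_near_edges n x e : (e \in near_edges n x) <-> ends e `<=` [set y | box d n.+1 (y - x)].
Proof.
rewrite /near_edges in_fset_set ?inE//; apply: finite_edges.
rewrite (_ : [set y | _] = [set y + x | y in box d n.+1]).
  exact/finite_image/finite_box.
by apply/seteqP; split => y /=; [exists (y - x); rewrite ?subrK|move=> [z ? <-]; rewrite addrK].
Qed.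

Lemma near_edges_disjoint n x y e : ~ box d (n.+1 + n.+1) (x - y) ->
  e \in near_edges n x -> e \notin near_edges n y.
Proof.
move=> xy /in_near_edges ex; apply/negP => /in_near_edges ey; apply: xy.
have [a [b eab]] := ends2 e.
have /ex /= h1 : ends e a by rewrite eab; left.
have /ey /= h2 : ends e a by rewrite eab; left.
by have := box_sub h2 h1; rewrite opprB addrC subrKA.
Qed.

Lemma conn_near n x G G' : (forall e, e \in near_edges n x -> G e -> G' e) ->
  in_ball n G x -> forall y, conn G x y -> conn G' x y.
Proof.
move=> GG' bG y; elim=> [z ->|{}y e z xy IH Ge ey ez]; first exact: conn_refl.
apply: (reach_step IH _ ey ez); apply: GG' => //; apply/in_near_edges => w ew /=.
have := box_add (bG _ xy) (ends_box ew ey).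
by rewrite addrC subrKA addn1.
Qed.

Lemma in_ball_near n x G G' : (forall e, e \in near_edges n x -> G e <-> G' e) ->
  in_ball n G x -> conn G x = conn G' x.
Proof.
move=> GG' bG; apply/seteqP; split => y.
  by apply: (conn_near _ bG) => e /GG'[].
elim=> [z ->|{}y e z _ xy Ge ey ez]; first exact: conn_refl.
apply: (reach_step xy _ ey ez); apply/GG' => //; apply/in_near_edges => w ew /=.
have := box_add (bG _ xy) (ends_box ew ey).
by rewrite addrC subrKA addn1.
Qed.

Lemma determined_in_ball n x :
  determined (near_edges n x) [set G : subgraph d | in_ball n G x].
Proof. by move=> G G' GG' /= bG y; rewrite -(in_ball_near GG' bG) => /bG. Qed.

Lemma measurable_shift_graph v :
  measurable_fun setT (shift_graph v : subgraph_space d -> subgraph_space d).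
Proof. by apply: measurable_fun_gsigma => _ [e ->]; exact: measurable_edge. Qed.

Lemma measurable_adj x y : measurable ([set G | adj G x y] : set (subgraph_space d)).
Proof.
have [[e exy]|ne] := pselect (exists e, ends e = [set x; y]).
  rewrite (_ : [set G | _] = [set G : subgraph d | G e]); first exact: measurable_edge.
  apply/seteqP; split => G; last by exists e.
  by move=> [e' [Ge']]; rewrite -/(ends e') -exy => /ends_inj <-.
rewrite (_ : [set G | _] = set0)//; apply/seteqP; split => // G [e [_ exy]].
by apply: ne; exists e.
Qed.

Lemma measurable_conn x y : measurable ([set G | conn G x y] : set (subgraph_space d)).
Proof.
rewrite (_ : [set G | _] = [set G : subgraph d | exists s : seq (Zd d),
   path (fun u v => `[< adj G u v >]) x s /\ last x s = y]).
  apply: (@measurable_exists _ (subgraph_space d) _ (fun s => [set G : subgraph d |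
   path (fun u v => `[< adj G u v >]) x s /\ last x s = y])) => s.
  apply: measurableI; last exact: measurable_prop.
  elim: s x => [|z s IH] x /=; first exact: measurable_prop.
  rewrite [X in measurable X](_ : _ = [set G | adj G x z] `&`
      [set G : subgraph d | path (fun u v => `[< adj G u v >]) z s]).
    by apply: measurableI; [exact: measurable_adj|exact: IH].
  by apply/seteqP; split => G /=; [move=> /andP[/asboolP ? ?]|move=> [/asboolP -> ->]].
apply/seteqP; split => G /=.
  by move=> /conn_linked[s [? ? _]]; exists s.
by move=> [s [? ?]]; apply: (@linked_conn _ setT); exists s.
Qed.

Lemma measurable_inf_cluster x :
  measurable ([set G | inf_cluster G x] : set (subgraph_space d)).
Proof.
rewrite -[X in measurable X]setCK; apply: measurableC.
rewrite (_ : ~` _ = [set G : subgraph d | exists n, in_ball n G x]).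
  apply: (@measurable_exists _ (subgraph_space d) _
    (fun n => [set G : subgraph d | in_ball n G x])) => n.
  by apply: determined_measurable; apply: determined_in_ball.
by apply/seteqP; split => G /= /finite_clusterP.
Qed.

Lemma mu_shift (R : realType) (p : R) (mu : probability (subgraph_space d) R) v
    (A : set (subgraph_space d)) :
  bond_percolation p mu -> measurable A -> mu (shift_graph v @^-1` A) = mu A.
Proof.
move=> hmu; rewrite -(image_probE mu (measurable_shift_graph v)).
apply: eq_measure_cyl => /=.
  by rewrite -ge0_fin_numE ?measure_ge0// fin_num_measure.
move=> J; rewrite [LHS]/distribution /pushforward (mu_cyl hmu).
have -> : shift_graph v @^-1` cyl J = cyl [fset shift_edge v e | e in J]%fset.
  apply/seteqP; split => G GJ e /=.
    by move=> /imfsetP[e' /= e'J ->]; exact: GJ.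
  by move=> eJ; apply: GJ; apply/imfsetP; exists e.
by rewrite (mu_cyl hmu) card_imfset//; exact: shift_edge_inj.
Qed.

End lattice.
Notation conn G x := (reach (@ends _) G [set x]).

(** Doubling the range adds 2^k terms, each at most 2^(-k). This bound stands in for the
    logarithm. *)
Lemma harmonic_dyadic (R : realFieldType) (k : nat) :
  \sum_(i < 2 ^ k) (1 + i.+1%:R)^-1 <= k.+1%:R :> R.
Proof.
elim: k => [|k IH].
  by rewrite expn0 big_ord_recl big_ord0 addr0 invf_le1 ?lerDl// addr_gt0.
rewrite expnS mul2n -addnn big_split_ord/= -[leRHS]natr1; apply: lerD => //.
apply: (@le_trans _ _ (\sum_(i < 2 ^ k) (2 ^ k)%:R^-1)).
  apply: ler_sum => i _; rewrite lef_pV2 ?posrE ?ltr0n ?expn_gt0//.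
    apply: (@le_trans _ _ (2 ^ k + i).+1%:R); first by rewrite ler_nat; lia.
    by rewrite lerDr.
by rewrite sumr_const card_ord -[leLHS]mulr_natr mulVf// pnatr_eq0 -lt0n expn_gt0.
Qed.

Lemma harmonic_le (R : realFieldType) (n k : nat) : (n <= 2 ^ k)%N ->
  \sum_(i < n) (1 + i.+1%:R)^-1 <= k.+1%:R :> R.
Proof.
move=> nk; apply: le_trans (harmonic_dyadic R k).
rewrite (big_ord_widen _ (fun i => (1 + i.+1%:R)^-1) nk) big_mkcond/=.
apply: ler_sum => i _; case: ifP => //.
Qed.

(** The mean value bound x^n - y^n <= n (x - y) x^(n-1), multiplied by x to keep predecessors out of
    the exponent. *)
Lemma exprB_le (R : realFieldType) (x y : R) n : 0 <= y -> y <= x ->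
  (x ^+ n - y ^+ n) * x <= n%:R * (x - y) * x ^+ n.
Proof.
move=> y0 yx; have x0 := le_trans y0 yx.
elim: n => [|n IH]; first by rewrite !expr0 subrr !mul0r.
have -> : (x ^+ n.+1 - y ^+ n.+1) * x =
    x * ((x ^+ n - y ^+ n) * x) + (x - y) * x * y ^+ n by rewrite !exprS; ring.
have -> : n.+1%:R * (x - y) * x ^+ n.+1 =
    x * (n%:R * (x - y) * x ^+ n) + (x - y) * x * x ^+ n.
  by rewrite exprS -natr1; ring.
apply: lerD; first exact: ler_wpM2l.
apply: ler_wpM2l; last exact: lerXn2r.
by rewrite mulr_ge0// subr_ge0.
Qed.

(** * Uniqueness of the infinite cluster *)

Section box_growth.
Context (R : realFieldType) (d : nat).

Lemma card_bxR n : #|` bx d n|%:R = (n.*2.+1)%:R ^+ d :> R.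
Proof. by rewrite card_bx natrX. Qed.

Lemma card_bx_gt0 n : 0 < #|` bx d n|%:R :> R.
Proof. by rewrite card_bxR exprn_gt0. Qed.

Lemma bx_sub n m : (n <= m)%N -> (bx d n `<=` bx d m)%fset.
Proof. by move=> nm; apply/fsubsetP => x /in_bx/(box_le nm)/in_bx. Qed.

Lemma card_bx_diff n m : (n <= m)%N ->
  #|` bx d m|%:R - #|` bx d n|%:R <=
  d%:R * (2 * (m%:R - n%:R)) / (m.*2.+1)%:R * #|` bx d m|%:R :> R.
Proof.
move=> nm; rewrite !card_bxR; set x : R := (m.*2.+1)%:R; set y : R := (n.*2.+1)%:R.
have -> : 2 * (m%:R - n%:R) = x - y.
  by rewrite /x /y -!natr1 -!muln2 !natrM; ring.
have x0 : 0 < x by rewrite ltr0n.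
rewrite mulrAC ler_pdivlMr//; apply: exprB_le; first exact: ler0n.
by rewrite ler_nat ltnS leq_double.
Qed.

End box_growth.

Section uniqueness.
Context (R : realType) (d : nat) (p : R) (mu : probability (subgraph_space d) R).
Hypotheses (p01 : 0 < p < 1) (hmu : bond_percolation p mu).
Implicit Types (x y z v w u : Zd d) (e : edge d) (G : subgraph d) (n m : nat).

Lemma reach_mono (E V : choiceType) (inc : E -> set V) (H H' : set E) S (c : V) :
  H `<=` H' -> reach inc H S c -> reach inc H' S c.
Proof.
move=> HH'; elim=> [a Sa|a e b _ IH He ea eb]; first exact: reach_start.
exact: (reach_step IH (HH' _ He) ea eb).
Qed.

Definition box_edges n : seq (edge d) :=
  fset_set [set e : edge d | ends e `<=` box d n].

Lemma in_box_edges n e : e \in box_edges n <-> ends e `<=` box d n.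
Proof.
by rewrite /box_edges in_fset_set ?inE//; apply: finite_edges; exact: finite_box.
Qed.

Lemma uniq_box_edges n : uniq (box_edges n).
Proof. exact: fset_uniq. Qed.

Lemma size_box_edges n : (size (box_edges n) <= #|` bx d n| * #|` bx d 1|)%N.
Proof.
(* An edge is encoded by one endpoint and the displacement to the other, which lies in the box of
   radius 1. *)
have /choice[pt ptE] : forall e, exists uv : Zd d * Zd d, ends e = [set uv.1; uv.1 + uv.2].
  move=> e; have [u [v euv]] := ends2 e; exists (u, v - u) => /=.
  by rewrite addrC subrK.
have pt_inj : injective pt by move=> e e' ee'; apply: ends_inj; rewrite !ptE ee'.
rewrite -(size_map pt) -(size_allpairs pair (bx d n) (bx d 1)).
apply: uniq_leq_size; first by rewrite map_inj_uniq// uniq_box_edges.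
move=> uv /mapP[e /in_box_edges eb ->].
apply/allpairsP; exists (pt e).
have e1 : ends e (pt e).1 by rewrite ptE; left.
have e2 : ends e ((pt e).1 + (pt e).2) by rewrite [in ends e]ptE; right.
split; last by case: (pt e).
  by apply/in_bx; exact: eb.
by apply/in_bx; have := ends_box e2 e1; rewrite addrAC subrr add0r.
Qed.

Definition boundary n : seq (Zd d) := (bx d n `\` bx d n.-1)%fset.

Lemma size_boundary n : size (boundary n) = (#|` bx d n| - #|` bx d n.-1|)%N.
Proof. by rewrite -cardfsDS//; apply: bx_sub; exact: leq_pred. Qed.

Lemma conn_boundary n G u y : box d n.+1 u -> conn G u y -> ~ box d n.+1 y ->
  reach (@ends d) (open_in (box_edges n.+1) G) [set` boundary n.+1] u.
Proof.
move=> bu uy; set H := open_in _ _.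
(* Invariant along the walk: either it has used only edges of the box so far, or it has already met
   the boundary. *)
have : (box d n.+1 y /\ reach (@ends d) H [set u] y) \/
    exists2 b, b \in boundary n.+1 & reach (@ends d) H [set u] b.
  elim: uy => [_ ->|{}y e z _ IH Ge ey ez].
    by left; split => //; exact: reach_start.
  case: IH => [[yb uy]|]; last by right.
  have [->|yz] := eqVneq z y; first by left.
  have [bz|nbz] := pselect (box d n.+1 z).
    left; split => //; apply: (reach_step uy _ ey ez); split => //.
    apply/in_box_edges; have [a [b eab]] := ends2 e.
    have eyz c : ends e c -> c = y \/ c = z.
      move: ey ez yz; rewrite eab => -[/= ->|/= ->] [/= ->|/= ->];
      by rewrite ?eqxx// => _ [/= ->|/= ->]; solve [by left|by right].
    by move=> c /eyz[->|->].
  right; exists y => //; rewrite !inE; apply/andP; split; last exact/in_bx.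
  apply/negP => /in_bx /= byn; apply: nbz.
  by have := box_add byn (ends_box ez ey); rewrite addrC subrK addn1.
move=> [[yb _] /(_ yb)//|[b bb ub] _].
apply: (reach_trans _ (reach_sym ub)); exact: reach_start.
Qed.

Definition joins u v : set (subgraph_space d) :=
  [set G | [/\ inf_cluster G u, inf_cluster G v & ~ conn G u v]].

Lemma measurable_joins u v : measurable (joins u v).
Proof.
rewrite (_ : joins u v = [set G | inf_cluster G u] `&`
   ([set G | inf_cluster G v] `&` ~` [set G | conn G u v])).
  apply: measurableI; first exact: measurable_inf_cluster.
  apply: measurableI; first exact: measurable_inf_cluster.
  by apply: measurableC; exact: measurable_conn.
by apply/seteqP; split => G /=; [case|case=> ? []].
Qed.

Lemma joins_shift w u v : shift_graph w @^-1` joins u v = joins (u + w) (v + w).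
Proof.
apply/seteqP; split => G /= [iu iv uv]; split.
- exact: (iffLR (inf_cluster_shift _ _ _) iu).
- exact: (iffLR (inf_cluster_shift _ _ _) iv).
- by rewrite -conn_shift.
- exact: (iffRL (inf_cluster_shift _ _ _) iu).
- exact: (iffRL (inf_cluster_shift _ _ _) iv).
- by rewrite conn_shift.
Qed.

(** Infinite clusters leave every box, so both meet the boundary; being distinct in [G], they stay
    distinct when only the edges of the box are kept. *)
Lemma joins_sep n e u v G : ends e = [set u; v] -> box d n.+1 u -> box d n.+1 v ->
  joins u v G -> sep (@ends d) (box_edges n.+1) G (boundary n.+1) e.
Proof.
move=> euv bu bv [iu iv nuv]; split.
  move=> Ge; apply: nuv; apply: (reach_step (conn_refl G u) Ge); rewrite euv.
    by left.
  by right.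
have out x : inf_cluster G x -> exists2 y, conn G x y & ~ box d n.+1 y.
  move=> ix; apply: contrapT => no; apply: ix.
  apply: (@sub_finite_set _ _ (box d n.+1)); last exact: finite_box.
  by move=> y xy; apply: contrapT => by_; apply: no; exists y.
exists u, v; split => //.
- by have [y uy ny] := out u iu; exact: conn_boundary uy ny.
- by have [y uy ny] := out v iv; exact: conn_boundary uy ny.
- by move=> uv; apply: nuv; apply: reach_mono uv => e' [].
Qed.

Lemma determined_sep (D : seq (edge d)) (B : seq (Zd d)) e : e \in D ->
  determined D [set G : subgraph d | sep (@ends d) D G B e].
Proof.
move=> eD G G' GG'; rewrite /sep /=.
have -> : open_in D G = open_in D G'.
  by apply/seteqP; split => e' [e'D]; move/(GG' _ e'D).
by move=> [Ge ?]; split => // /(GG' _ eD).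
Qed.

(** A translation that preserves an edge fixes an endpoint or swaps the two, and in the latter case
    its double is zero. Either way it is trivial. *)
Lemma shift_edge_injl e : injective (fun w => shift_edge w e).
Proof.
move=> w w' ww'; have [u [v euv]] := ends2 e.
have Q x : ends e x -> x + w - w' = u \/ x + w - w' = v.
  move=> ex; have : ends (shift_edge w e) (x + w) by apply/ends_shift; rewrite addrK.
  by rewrite [shift_edge w e]ww' ends_shift euv.
have key (a : Zd d) : a + w - w' = a -> w = w'.
  by move=> /eqP; rewrite -addrA -[X in _ == X]addr0 (inj_eq (addrI _)) subr_eq0 => /eqP.
have [|h1] : u + w - w' = u \/ u + w - w' = v by apply: Q; rewrite euv; left.
  exact: key.
have [h2|] : v + w - w' = u \/ v + w - w' = v by apply: Q; rewrite euv; right.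
  apply/ffunP => i; have : (u + w - w') i = v i by rewrite h1.
  have : (v + w - w') i = u i by rewrite h2.
  by rewrite !zdD !zdN; move: (u i) (v i) (w i) (w' i); clear; lia.
exact: key.
Qed.

(** By stationarity, the volume times the probability is the expected number of translates of [e] by
    vectors of the box of radius n that join two infinite clusters. These translates are distinct
    edges of the box of radius N and separating there. *)
Lemma sum_joins_le e u v m n N (lam : R) : ends e = [set u; v] ->
  box d m u -> box d m v -> 0 < lam ->
  N = (n + m).+1 ->
  p * (#|` bx d n|%:R * fine (mu (joins u v))) <=
  lam * ((size (boundary N))%:R * \sum_(i < size (box_edges N)) (1 + i.+1%:R)^-1) +
  ((size (boundary N))%:R + 2 * (size (box_edges N))%:R) / lam.
Proof.
move=> euv bu bv l0 NE; have /andP[p0 p1] := p01.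
have p01' : 0 <= p <= 1 by rewrite !ltW.
have inc2 e' : exists u v, ends e' = [set u; v] by exact: ends2.
apply: (le_trans _ (bexp_sep_le p01' inc2 (boundary N) (uniq_box_edges N) l0)).
apply: ler_wpM2l; first exact: ltW.
pose F e' := bexp p (box_edges N)
  (fun G => (`[< sep (@ends d) (box_edges N) G (boundary N) e' >])%:R).
rewrite [leRHS](_ : _ = \sum_(e' <- box_edges N) F e')//.
have F0 e' : 0 <= F e' by rewrite -(bexp_cst p (box_edges N) 0); exact: le_bexp.
have DN w : w \in bx d n -> shift_edge w e \in box_edges N.
  move=> /in_bx bw; apply/in_box_edges => x /ends_shift.
  have B y : box d m y -> x - w = y -> box d N x.
    move=> by_ xy; apply: (@box_le _ (m + n)); first by rewrite NE addnC.
    by rewrite -(subrK w x) xy; exact: box_add.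
  by rewrite euv => -[]; exact: B.
have -> : #|` bx d n|%:R * fine (mu (joins u v)) = \sum_(w <- bx d n) fine (mu (joins u v)).
  by rewrite big_const_seq count_predT iter_addr_0 mulr_natl.
apply: (@le_trans _ _ (\sum_(w <- bx d n) F (shift_edge w e))).
  rewrite !big_seq; apply: ler_sum => w wn.
  have eD := DN _ wn.
  have euvw : ends (shift_edge w e) = [set u + w; v + w].
    by rewrite -[ends _]/[set x + w | x in ends e] euv image_setU !image_set1.
  have dS := @determined_sep _ (boundary N) _ eD.
  rewrite -(mu_shift w hmu (measurable_joins u v)) joins_shift.
  rewrite -[F _]/(fine (F _)%:E) /F -(mu_determined p01 hmu (uniq_box_edges N) dS).
  apply: fine_le; rewrite ?fin_num_measure//.
  - exact: measurable_joins.
  - exact: (determined_measurable dS).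
  apply: le_measure; rewrite ?inE.
  - exact: measurable_joins.
  - exact: (determined_measurable dS).
  move=> G; have /in_box_edges eb := eD.
  by rewrite NE in eb *; apply: joins_sep => //; apply: eb; rewrite euvw; [left|right].
rewrite -(big_map (fun w => shift_edge w e) xpredT).
have um : uniq [seq shift_edge w e | w <- bx d n].
  by rewrite map_inj_uniq ?fset_uniq// => w w'; exact: shift_edge_injl.
rewrite [leRHS](bigID (mem [seq shift_edge w e | w <- bx d n]))/=.
apply: ler_wpDr; first exact: sumr_ge0.
rewrite -[leRHS]big_filter le_eqVlt; apply/orP; left; apply/eqP/perm_big.
apply: uniq_perm => //; first by rewrite filter_uniq// uniq_box_edges.
move=> e'; rewrite mem_filter; apply/idP/idP => [e'm|/andP[]//].
by rewrite e'm; move: e'm => /mapP[w wn ->]; exact: DN.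
Qed.

Lemma le0_of_le_harmonic (x C : R) : (forall t : nat, x <= C / t.+1%:R) -> x <= 0.
Proof.
move=> h; rewrite leNgt; apply/negP => x0.
have := h (Num.truncn (C / x)); rewrite ler_pdivlMr ?ltr0n// leNgt => /negP; apply.
rewrite mulrC -ltr_pdivrMr//.
have [C0|C0] := leP 0 (C / x); first by rewrite truncnS_gt.
by rewrite (lt_le_trans C0).
Qed.

Lemma null_joins e u v : ends e = [set u; v] -> mu (joins u v) = 0%E.
Proof.
move=> euv; have mj := measurable_joins u v.
have [m bm] : exists m, [set u; v] `<=` box d m by apply: finite_sub_box.
have /andP[p0 p1] := p01.
rewrite -[LHS]fineK ?fin_num_measure//; congr EFin; set s := fine _.
have s0 : 0 <= s by apply: fine_ge0.
apply/eqP; rewrite eq_le s0 andbT.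
(* The factor 2^d compares the volumes of the boxes of radii N and n = N - m - 1. *)
pose c : R := p / 2 ^+ d.
have c0 : 0 < c by rewrite divr_gt0 ?exprn_gt0.
(* In the constants below, [C2] combines the surface ratio d / N with the bound (4 d + 1)(j + 1) on
   the harmonic sum, and [C3] bounds |B| + 2 |D| per vertex, a box having at most 3^d edges per
   vertex. *)
suff : c * s <= 0 by rewrite pmulr_rle0.
pose C2 : R := d%:R * (4 * d + 1)%:R; pose C3 : R := 1 + 2 * 3 ^+ d.
apply: (@le0_of_le_harmonic _ (C2 + C3)) => t.
set l : R := t.+1%:R; have l0 : 0 < l by rewrite ltr0n.
(* Relative to the volume, the second term of the bound is O(1 / lam) for lam = t + 1, and [j] makes
   the first one as small. As N = 4^j, the harmonic sum is O(j), and (t + 1)^2 <= j + 1 with (j +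
   1)^2 <= N give lam (j + 1) / N <= 1 / lam. *)
pose j := (m.+1 + t.+1 ^ 2)%N; pose N := (4 ^ j)%N.
have jN : (j.+1 ^ 2 <= N)%N.
  by rewrite /N -[4%N]/(2 ^ 2)%N -expnM mulnC expnM leq_exp2r// ltn_expl.
have N0 : (0 < N)%N by rewrite expn_gt0.
have mN : (2 * m.+1 <= N)%N by apply: leq_trans jN; rewrite /j; nia.
pose n := (N - m.+1)%N.
have NE : N = (n + m).+1 by rewrite /n; lia.
have := sum_joins_le euv (bm u _) (bm v _) l0 NE; rewrite -/s => /(_ (or_introl erefl) (or_intror erefl)).
set B := size (boundary N); set D := size (box_edges N); set H := \sum_(i < _) _.
set b : R := #|` bx d N|%:R.
have b0 : 0 < b by exact: card_bx_gt0.
have bn : b <= 2 ^+ d * #|` bx d n|%:R.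
  rewrite /b !card_bxR -exprMn lerXn2r ?nnegrE ?mulr_ge0// -natrM ler_nat.
  by rewrite /n; lia.
have Bb : B%:R <= d%:R / N%:R * b.
  rewrite /B size_boundary natrB; last by apply: fsubset_leq_card; apply: bx_sub; exact: leq_pred.
  apply: (le_trans (card_bx_diff R d (leq_pred N))).
  rewrite ler_pM2r// -mulrA ler_wpM2l// ler_pdivrMr ?ltr0n// [leRHS]mulrC ler_pdivlMr ?ltr0n//.
  have -> : N.-1%:R = N%:R - 1 :> R by rewrite -[in RHS](prednK N0) -natr1 addrK.
  by rewrite -[(_.+1)%:R in leRHS]natr1 -muln2 natrM; lra.
have Bb' : B%:R <= b.
  by rewrite /B size_boundary /b ler_nat leq_subr.
have Db : D%:R <= b * 3 ^+ d.
  rewrite /D /b; apply: (@le_trans _ _ (#|` bx d N| * #|` bx d 1|)%N%:R).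
    by rewrite ler_nat; exact: size_box_edges.
  by rewrite natrM [X in _ * X]card_bxR.
have H2 : H <= (4 * d + 1)%:R * j.+1%:R.
  rewrite -natrM; have DK : (D <= 2 ^ ((4 + 2 * j) * d))%N.
    apply: (leq_trans (size_box_edges N)); rewrite !card_bx expnM -expnMn.
    have [d0|d0] := posnP d; first by rewrite [in leqLHS]d0 [in X in (_ <= X)%N]d0.
    rewrite leq_exp2r// expnD expnM -[(2 ^ 2)%N]/4%N -/N -[(2 ^ 4)%N]/16%N.
    by rewrite -[(1.*2.+1)%N]/3%N -muln2; lia.
  by apply: (le_trans (harmonic_le R DK)); rewrite ler_nat; nia.
have lj : l * j.+1%:R / N%:R <= l^-1.
  rewrite ler_pdivrMr ?ltr0n// -(ler_pM2l l0) mulVKf ?gt_eqF// /l.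
  rewrite -!natrM ler_nat; apply: leq_trans jN.
  by rewrite /j; nia.
move=> main; rewrite -(ler_pM2r b0).
apply: (@le_trans _ _ (p * (#|` bx d n|%:R * s))).
  have -> : c * s * b = p * ((b / 2 ^+ d) * s) by rewrite /c; ring.
  by rewrite ler_pM2l// ler_wpM2r// ler_pdivrMr ?exprn_gt0// mulrC.
apply: (le_trans main).
have -> : (C2 + C3) / l * b = C2 * l^-1 * b + C3 * b / l by ring.
apply: lerD; last first.
  rewrite ler_pM2r ?invr_gt0// /C3; lra.
apply: (@le_trans _ _ (l * ((d%:R / N%:R * b) * ((4 * d + 1)%:R * j.+1%:R)))).
  rewrite ler_pM2l//; apply: ler_pM => //.
  by apply: sumr_ge0 => i _; rewrite invr_ge0 addr_ge0.
have -> : l * ((d%:R / N%:R * b) * ((4 * d + 1)%:R * j.+1%:R)) =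
  C2 * (l * j.+1%:R / N%:R) * b by rewrite /C2; ring.
by rewrite ler_pM2r// ler_wpM2l// /C2 mulr_ge0.
Qed.

End uniqueness.

Lemma negligible_exists d (T : measurableType d) (R : realType)
    (mu : {measure set T -> \bar R}) (U : countType) (F : U -> set T) :
  (forall u, mu.-negligible (F u)) -> mu.-negligible [set t | exists u, F u t].
Proof.
move=> nF; have : mu.-negligible (\bigcup_n (if @choice.unpickle U n is Some u then F u else set0)).
  apply: negligible_bigcup => n; case: (@choice.unpickle U n) => [u|]; first exact: nF.
  exact: negligible_set0.
by apply: negligibleS => t [u Fu]; exists (choice.pickle u) => //; rewrite choice.pickleK.
Qed.

(** * Connectedness of the full lattice *)

Section lattice_connected.
Context (d : nat).
Implicit Types (x y u v w : Zd d).

(** The full lattice is convertible to its translates, so the vertices connected to 0 form a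
    subgroup; it will contain the unit vectors. *)
Lemma conn_add u v : conn (setT : subgraph d) 0 u -> conn (setT : subgraph d) 0 v ->
  conn (setT : subgraph d) 0 (u + v).
Proof.
move=> cu cv; apply: (reach_trans cu).
have : conn (shift_graph u setT) 0 v by [].
by rewrite conn_shift add0r addrC.
Qed.

Lemma conn_opp u : conn (setT : subgraph d) 0 u -> conn (setT : subgraph d) 0 (- u).
Proof.
move=> /reach_sym cu.
have : conn (shift_graph u setT) 0 (- u) by rewrite conn_shift add0r addNr.
by [].
Qed.

Definition unit_vec (i : 'I_d) : Zd d := [ffun j => (j == i)%:Z].

Lemma conn_unit i : conn (setT : subgraph d) 0 (unit_vec i).
Proof.
have E : Ed d [set 0; unit_vec i].
  exists 0, (unit_vec i); split => //.
  rewrite (bigD1 i)//= big1 => [|j ji]; rewrite zd0 ffunE ?eqxx//.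
  by rewrite (negbTE ji).
pose e : edge d := SigSub (mem_set E).
apply: (@reach_step _ _ _ _ _ 0 e); [exact: conn_refl|by []| |].
  by left.
by right.
Qed.

Lemma conn_setT x y : conn (setT : subgraph d) x y.
Proof.
have c0 : conn (setT : subgraph d) 0 (y - x).
  have -> : y - x = \sum_(i < d) unit_vec i *~ (y - x) i.
    apply/ffunP => j; rewrite sum_ffunE (bigD1 j)//= big1 => [|i ij].
      rewrite addr0; have -> : (unit_vec j *~ (y - x) j) j = unit_vec j j *~ (y - x) j.
        by case: ((y - x) j) => n; rewrite ?NegzE ?mulrNz -?pmulrn ?zdN ffunMnE.
      by rewrite [unit_vec j j]ffunE eqxx intz.
    have -> : (unit_vec i *~ (y - x) i) j = unit_vec i j *~ (y - x) i.
      by case: ((y - x) i) => n; rewrite ?NegzE ?mulrNz -?pmulrn ?zdN ffunMnE.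
    by rewrite [unit_vec i j]ffunE eq_sym (negbTE ij) mul0rz.
  elim/big_ind: _ => [|a b|i _]; [exact: conn_refl|exact: conn_add|].
  have cn n : conn (setT : subgraph d) 0 (unit_vec i *+ n).
    elim: n => [|n IH]; first exact: conn_refl.
    by rewrite mulrS; apply: conn_add => //; exact: conn_unit.
  case: ((y - x) i) => n; first exact: cn.
  by rewrite NegzE mulrNz; apply: conn_opp; exact: cn.
have : conn (shift_graph x setT) 0 (y - x) by [].
by rewrite conn_shift add0r subrK.
Qed.

End lattice_connected.

(** * Finite modifications and exclusion of two infinite clusters *)

Section uniqueness_of_infinite_cluster.
Context (R : realType) (d : nat) (p : R) (mu : probability (subgraph_space d) R).
Hypotheses (p01 : 0 < p < 1) (hmu : bond_percolation p mu).
Implicit Types (x y z v w u : Zd d) (e : edge d) (G : subgraph d) (n m : nat).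

(** Modifications are indexed by pairs of vertices, whose finite lists form a countable type, as the
    final union of null events requires. A pair that is not an edge changes nothing. *)
Definition open_pair (uv : Zd d * Zd d) G : subgraph d :=
  [set e | ends e = [set uv.1; uv.2]] `|` G.

Fixpoint open_pairs (l : seq (Zd d * Zd d)) G : subgraph d :=
  if l is uv :: l' then open_pairs l' (open_pair uv G) else G.

Lemma open_pair_edge uv e : ends e = [set uv.1; uv.2] -> open_pair uv = open_edge e.
Proof.
move=> euv; apply/funext => G; congr setU; apply/seteqP; split => e' /=.
  by rewrite -euv => /ends_inj.
by move=> ->.
Qed.

Lemma open_pair_noedge uv : ~ (exists e, ends e = [set uv.1; uv.2]) -> open_pair uv = id.
Proof.
move=> ne; apply/funext => G; apply/seteqP; split => e'; last by right.
by move=> [/= euv|//]; case: ne; exists e'.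
Qed.

Lemma null_open_pairs l (A : set (subgraph_space d)) : measurable A -> mu A = 0%E ->
  measurable (open_pairs l @^-1` A : set (subgraph_space d)) /\
  mu (open_pairs l @^-1` A) = 0%E.
Proof.
move=> mA A0; elim: l => [//|uv l [mlA lA0]].
have [[e euv]|ne] := pselect (exists e, ends e = [set uv.1; uv.2]).
  rewrite (_ : open_pairs (uv :: l) @^-1` A = open_edge e @^-1` (open_pairs l @^-1` A)).
    split; last exact: (null_open_edge p01 hmu e mlA lA0).
    exact: (measurable_preimage (measurable_open_edge e) mlA).
  by apply/seteqP; split => G; rewrite /= (open_pair_edge euv).
rewrite (_ : open_pairs (uv :: l) @^-1` A = open_pairs l @^-1` A)//.
by apply/seteqP; split => G; rewrite /= (open_pair_noedge ne).
Qed.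

Lemma conn_open_pair uv G x y : conn G x y -> conn (open_pair uv G) x y.
Proof. by apply: reach_mono => e; right. Qed.

Lemma conn_open_pair_off x z G y w : ~ conn G y x -> ~ conn G y z ->
  conn (open_pair (x, z) G) y w -> conn G y w.
Proof.
move=> yx yz; elim=> [_ ->|{}w e t _ yw [/= exz|Ge] ew et]; first exact: conn_refl.
  by move: ew; rewrite exz => -[] /= ?; subst w.
exact: (reach_step yw Ge ew et).
Qed.

Lemma inf_open_pair uv G x : inf_cluster G x -> inf_cluster (open_pair uv G) x.
Proof.
move=> ix /(sub_finite_set _) fx; apply: ix; apply: fx => y; exact: conn_open_pair.
Qed.

(* Opening the edges of a lattice path one by one, as long as they lead to a
   finite cluster, eventually produces an edge between two infinite clusters. *)
Lemma open_pairs_joins s G x : path (fun u v => `[< adj (setT : subgraph d) u v >]) x s ->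
  inf_cluster G x -> inf_cluster G (last x s) -> ~ conn G x (last x s) ->
  exists luv : seq (Zd d * Zd d) * (Zd d * Zd d),
    (exists e, ends e = [set luv.2.1; luv.2.2]) /\
    joins luv.2.1 luv.2.2 (open_pairs luv.1 G).
Proof.
elim: s G x => [|z s IH] G x /=; first by move=> _ _ _ /(_ (conn_refl _ _)).
move=> /andP[/asboolP[e [_ exz]] zs] ix il nxl.
have [iz|niz] := pselect (inf_cluster G z).
  have [xz|nxz] := pselect (conn G x z).
    by apply: (IH G z) => // zl; apply: nxl; exact: reach_trans zl.
  by exists ([::], (x, z)); split; first by exists e.
(* The infinite cluster of [y] contains neither [x] nor [z], whose cluster is finite. Opening the
   edge between [x] and [z] therefore leaves it intact, and the induction continues from [z]. *)
set y := last z s in il nxl *.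
have nyz : ~ conn G y z by move=> yz; apply: niz; exact: inf_cluster_conn il.
have nyx : ~ conn G y x by move=> /reach_sym.
have xz' : conn (open_pair (x, z) G) x z.
  apply: (@reach_step _ _ _ _ _ x e); first exact: conn_refl.
  - by left.
  - by rewrite /ends exz; left.
  - by rewrite /ends exz; right.
have [|||[l uv] luv] := IH (open_pair (x, z) G) z zs.
- by apply: inf_cluster_conn xz' _; exact: inf_open_pair.
- exact: inf_open_pair.
- by move=> /reach_sym /(conn_open_pair_off nyx nyz).
by exists ((x, z) :: l, uv).
Qed.

Definition two_inf_clusters : set (subgraph_space d) :=
  [set G | exists x y, [/\ inf_cluster G x, inf_cluster G y & ~ conn G x y]].

Lemma negligible_two_inf_clusters : mu.-negligible two_inf_clusters.
Proof.
pose F (luv : seq (Zd d * Zd d) * (Zd d * Zd d)) : set (subgraph_space d) :=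
  [set G | (exists e, ends e = [set luv.2.1; luv.2.2]) /\
    joins luv.2.1 luv.2.2 (open_pairs luv.1 G)].
suff : mu.-negligible [set G | exists luv, F luv G].
  apply: negligibleS => G [x [y [ix iy nxy]]].
  have [s [ps ls _]] := conn_linked (conn_setT x y).
  by apply: (@open_pairs_joins s G x) => //; rewrite ls.
apply: negligible_exists => -[l [u v]].
have [[e euv]|ne] := pselect (exists e, ends e = [set u; v]); last first.
  by apply: negligibleS (negligible_set0 mu) => G [] /ne.
have [mA A0] := null_open_pairs l (measurable_joins u v) (null_joins p01 hmu euv).
by exists (open_pairs l @^-1` joins u v); split => // G [].
Qed.

End uniqueness_of_infinite_cluster.

(** * Maximal inequality and ergodic averages *)

Section covering.
Context (R : realFieldType) (d : nat).
Implicit Types (n : nat) (x y z : Zd d) (U : {fset Zd d}) (F : Zd d -> R) (r : Zd d -> nat).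

Definition zball x n : {fset Zd d} := [fset (x + y)%R | y in bx d n]%fset.

Lemma in_zballP x n y : (y \in zball x n) <-> box d n (y - x).
Proof.
split; first by move=> /imfsetP[z /= /in_bx zn ->]; rewrite addrC addKr.
by move=> yx; apply/imfsetP; exists (y - x); [exact/in_bx|rewrite addrC subrK].
Qed.

Lemma sum_zball x n F : \sum_(y <- zball x n) F y = \sum_(y <- bx d n) F (x + y).
Proof. by rewrite big_imfset//= => y z _ _; exact: addrI. Qed.

Lemma card_zball x n : #|` zball x n| = #|` bx d n|.
Proof. by rewrite card_imfset//; exact: addrI. Qed.

Lemma card_bx_double n : #|` bx d n.*2|%:R <= 2 ^+ d * #|` bx d n|%:R :> R.
Proof.
by rewrite !card_bxR -exprMn lerXn2r ?nnegrE ?mulr_ge0// -natrM ler_nat; lia.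
Qed.

Lemma sum_fsetD U (A : {fset Zd d}) F : (A `<=` U)%fset ->
  \sum_(y <- U) F y = \sum_(y <- A) F y + \sum_(y <- (U `\` A)%fset) F y.
Proof.
move=> AU; rewrite (bigID (fun y => y \in A))/=; congr (_ + _).
  rewrite big_fset_condE/=; apply: perm_big; apply: uniq_perm; rewrite ?fset_uniq// => y.
  by rewrite !inE/=; apply/andP/idP => [[]//|yA]; rewrite yA (fsubsetP AU).
rewrite big_fset_condE/=; apply: perm_big; apply: uniq_perm; rewrite ?fset_uniq// => y.
by rewrite !inE/= andbC.
Qed.

Lemma exists_maxr (s : seq (Zd d)) r : s != [::] ->
  exists2 x, x \in s & forall y, y \in s -> (r y <= r x)%N.
Proof.
elim: s => // a s IH _; have [->|/IH[x xs mx]] := eqVneq s [::].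
  by exists a; rewrite ?inE// => y; rewrite inE => /eqP ->.
have [ax|xa] := leqP (r a) (r x).
  exists x; rewrite ?inE ?xs ?orbT// => y; rewrite inE => /predU1P[->//|]; exact: mx.
exists a; rewrite ?inE ?eqxx// => y; rewrite inE => /predU1P[->//|/mx yx].
exact: leq_trans yx (ltnW xa).
Qed.

(* Vitali covering: a ball of maximal radius eliminates only the centers of
   balls meeting it, which lie in the ball of twice its radius. *)
Lemma vitali_covering (s : seq (Zd d)) U F r (lam : R) : uniq s -> 0 <= lam ->
  (forall y, 0 <= F y) ->
  (forall x, x \in s -> (zball x (r x) `<=` U)%fset) ->
  (forall x, x \in s -> lam * #|` bx d (r x)|%:R <= \sum_(y <- zball x (r x)) F y) ->
  lam * (size s)%:R <= 2 ^+ d * \sum_(y <- U) F y.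
Proof.
move=> + l0 F0; move: {2}(size s) (leqnn (size s)) => n.
elim: n s U => [|n IH] s U.
  by rewrite leqn0 => /nilP -> _ _ _; rewrite mulr0 mulr_ge0 ?exprn_ge0// sumr_ge0.
move=> sn us sU sF.
have [->|s0] := eqVneq s [::]; first by rewrite mulr0 mulr_ge0 ?exprn_ge0// sumr_ge0.
have [x xs mx] := exists_maxr r s0.
pose close y := y \in zball x (r x).*2.
pose s' := seq.filter (predC close) s.
have xc : close x by apply/in_zballP; rewrite subrr; exact: box0.
have sE : size s = (size (seq.filter close s) + size s')%N.
  by rewrite !size_filter count_predC.
have s'n : (size s' <= n)%N.
  rewrite -ltnS; apply: leq_trans sn; rewrite sE -[ltnLHS]add0n ltn_add2r.
  by rewrite size_filter -has_count; apply/hasP; exists x.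
have sc : (size (seq.filter close s) <= #|` bx d (r x).*2|)%N.
  rewrite -(card_zball x); apply: uniq_leq_size; first exact: filter_uniq.
  by move=> y; rewrite mem_filter => /andP[].
have h1 : lam * (size s')%:R <= 2 ^+ d * \sum_(y <- (U `\` zball x (r x))%fset) F y.
  apply: IH => //; first exact: filter_uniq.
    move=> y; rewrite mem_filter => /andP[/= nyc ys]; apply/fsubsetP => z zy.
    rewrite !inE (fsubsetP (sU y ys) _ zy) andbT; apply/negP => zx.
    move/negP : nyc; apply; apply/in_zballP.
    move: zx zy => /in_zballP zx /in_zballP zy.
    apply: (@box_le _ (r x + r y)); first by rewrite -addnn leq_add2l; exact: mx.
    by have := box_sub zx zy; rewrite opprB addrC subrKA.
  by move=> y; rewrite mem_filter => /andP[_ ys]; exact: sF.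
rewrite (sum_fsetD _ (sU x xs)) mulrDr sE natrD mulrDr; apply: lerD => //.
apply: (@le_trans _ _ (2 ^+ d * (lam * #|` bx d (r x)|%:R))).
  rewrite mulrCA ler_wpM2l//; apply: le_trans (card_bx_double (r x)).
  by rewrite ler_nat.
by rewrite ler_wpM2l ?exprn_ge0//; exact: sF.
Qed.

Lemma sum_fset_diff (A U : {fset Zd d}) F (M : R) : (A `<=` U)%fset ->
  (forall y, `|F y| <= M) ->
  `|\sum_(y <- U) F y - \sum_(y <- A) F y| <= M * (#|` U|%:R - #|` A|%:R).
Proof.
move=> AU FM; rewrite (sum_fsetD _ AU) addrC addKr.
apply: (le_trans (ler_norm_sum _ _ _)); rewrite -natrB ?fsubset_leq_card//.
rewrite -cardfsDS// mulr_natr.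
rewrite [leRHS](_ : _ = \sum_(y <- (U `\` A)%fset) M); first exact: ler_sum.
by rewrite big_const_seq count_predT iter_addr_0.
Qed.

End covering.

Section ergodic.
Context (R : realType) (d : nat) (dd : measure_display) (T : measurableType dd).
Context (P : probability T R) (tau : Zd d -> T -> T).
Hypothesis mtau : forall v, measurable_fun setT (tau v).
Hypothesis Ptau : forall v A, measurable A -> P (tau v @^-1` A) = P A.
Hypothesis tauD : forall v w t, tau v (tau w t) = tau (w + v) t.
Implicit Types (f g : T -> R) (n : nat).

Definition bsum f n t : R := \sum_(x <- bx d n) f (tau x t).

Definition bavg f n t : R := #|` bx d n|%:R^-1 * bsum f n t.

Lemma measurable_bsum f n : measurable_fun setT f -> measurable_fun setT (bsum f n).
Proof.
by move=> mf; apply: measurable_sum => x; apply: measurableT_comp => //; exact: mtau.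
Qed.

Lemma measurable_bavg f n : measurable_fun setT f -> measurable_fun setT (bavg f n).
Proof.
by move=> mf; apply: measurable_funM => //; exact: measurable_bsum.
Qed.

Lemma measurable_gt_cst f (c : R) : measurable_fun setT f -> measurable [set t | c < f t].
Proof.
move=> mf; rewrite (_ : [set t | _] = ~` ([set: T] `&` [set t | f t <= cst c t])).
  by apply: measurableC; apply: measurable_fun_le.
by rewrite setTI; apply/seteqP; split => t /=; rewrite ltNge => /negP.
Qed.

Definition exceed f (lam : R) n : set T := [set t | lam < bavg f n t].

Lemma measurable_exceed f lam n : measurable_fun setT f -> measurable (exceed f lam n).
Proof. by move=> mf; apply: measurable_gt_cst; exact: measurable_bavg. Qed.

Lemma bsum_zball f x n t : bsum f n (tau x t) = \sum_(y <- zball x n) f (tau y t).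
Proof. by rewrite sum_zball; apply: eq_bigr => y _; rewrite tauD. Qed.

(** Transference: the covering lemma is applied along the orbit of [t], to the function sending y to
    f (tau y t). Balls of radius at most N centered in the box of radius N stay in the box of radius
    2 N. *)
Lemma exceed_count f lam N t : 0 <= lam -> (forall t, 0 <= f t) ->
  lam * \sum_(x <- bx d N) (\1_[set t | exists2 n, (n <= N)%N & exceed f lam n t] (tau x t) : R)
  <= 2 ^+ d * bsum f N.*2 t.
Proof.
move=> l0 f0; set B := [set t | _].
have /choice[r rP] : forall x, exists n, B (tau x t) -> (n <= N)%N /\ exceed f lam n (tau x t).
  move=> x; have [[n nN en]|nB] := pselect (B (tau x t)); first by exists n.
  by exists 0%N.
pose s := seq.filter (fun x => tau x t \in B) (bx d N).
have -> : \sum_(x <- bx d N) (\1_B (tau x t) : R) = (size s)%:R.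
  rewrite size_filter -sum1_count natr_sum [RHS]big_mkcond/=.
  by apply: eq_bigr => x _; rewrite indicE; case: ifP.
apply: (@vitali_covering _ _ s (bx d N.*2) (fun y => f (tau y t)) r) => //.
- by rewrite filter_uniq// fset_uniq.
- move=> x; rewrite mem_filter => /andP[/set_mem/rP[rN _] xN].
  apply/fsubsetP => y /in_zballP yx; apply/in_bx.
  rewrite -(subrK x y) -addnn; apply: box_add; last exact/in_bx.
  exact: box_le yx.
- move=> x; rewrite mem_filter => /andP[/set_mem/rP[_ /ltW]] + _.
  rewrite /bavg mulrC ler_pdivlMr ?card_bx_gt0//.
  by rewrite bsum_zball.
Qed.

Local Open Scope ereal_scope.

Lemma integral_tau f x : measurable_fun setT f -> (forall t, (0 <= f t)%R) ->
  \int[P]_t (f (tau x t))%:E = \int[P]_t (f t)%:E.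
Proof.
move=> mf f0.
transitivity (\int[pushforward P (tau x)]_t (f t)%:E).
  rewrite ge0_integral_pushforward//.
    exact/measurable_EFinP.
  by move=> t _; rewrite lee_fin.
apply: eq_measure_integral => A mA _; exact: Ptau.
Qed.

Lemma integral_bsum f n : measurable_fun setT f -> (forall t, (0 <= f t)%R) ->
  \int[P]_t (bsum f n t)%:E = (#|` bx d n|%:R)%:E * \int[P]_t (f t)%:E.
Proof.
move=> mf f0; under eq_integral do rewrite /bsum -sumEFin.
rewrite ge0_integral_sum//; last 2 first.
- move=> x; apply/measurable_EFinP; apply: measurableT_comp => //; exact: mtau.
- by move=> x t _; rewrite lee_fin.
under eq_bigr do rewrite integral_tau//.
have I0 : 0 <= \int[P]_t (f t)%:E by apply: integral_ge0 => t _; rewrite lee_fin.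
elim: (enum_fset (bx d n)) => [|x s IH]; first by rewrite big_nil mul0e.
by rewrite big_cons IH /= -addn1 natrD addrC EFinD ge0_muleDl ?lee_fin// mul1e.
Qed.

(** Integrating [exceed_count] against the invariant measure turns both sums into multiples of
    volumes. One factor 2^d comes from the covering, the other from doubling the box. *)
Lemma maximal_ineq_bounded f (lam : R) N : measurable_fun setT f ->
  (forall t, (0 <= f t)%R) -> (0 <= lam)%R ->
  lam%:E * P [set t | exists2 n, (n <= N)%N & exceed f lam n t] <=
  (4 ^+ d)%:E * \int[P]_t (f t)%:E.
Proof.
move=> mf f0 l0; set B := [set t | _].
have mB : measurable B.
  rewrite (_ : B = [set t | exists n, (if (n <= N)%N then exceed f lam n else set0) t]).
    apply: (@measurable_exists _ _ _ (fun n => if (n <= N)%N then exceed f lam n else set0)) => n.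
    by case: ifP => // _; exact: measurable_exceed.
  apply/seteqP; split => t [n]; first by move=> nN en; exists n; rewrite nN.
  by case: ifP => // nN en; exists n.
have I0 : 0 <= \int[P]_t (f t)%:E by apply: integral_ge0 => t _; rewrite lee_fin.
have B0 : (0 < #|` bx d N|%:R :> R)%R by exact: card_bx_gt0.
rewrite -(@lee_pmul2l _ (#|` bx d N|%:R)%:E)//.
have mi : measurable_fun setT (\1_B : T -> R) by exact: measurable_indic.
have i0 : forall t, (0 <= \1_B t :> R)%R by move=> t; rewrite indicE.
have -> : (#|` bx d N|%:R)%:E * (lam%:E * P B) =
    \int[P]_t (lam * bsum \1_B N t)%:E.
  under [RHS]eq_integral do rewrite EFinM.
  rewrite ge0_integralZl_EFin//; last 2 first.
  - by move=> t _; rewrite lee_fin sumr_ge0.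
  - exact/measurable_EFinP/measurable_bsum.
  by rewrite integral_bsum// integral_indic// setIT muleCA.
apply: (@le_trans _ _ (\int[P]_t (2 ^+ d * bsum f N.*2 t)%:E)).
  apply: ge0_le_integral => //.
  - by move=> t _; rewrite lee_fin mulr_ge0// sumr_ge0.
  - by apply/measurable_EFinP; apply: measurable_funM => //; exact: measurable_bsum.
  - by apply/measurable_EFinP; apply: measurable_funM => //; exact: measurable_bsum.
  - by move=> t _; rewrite lee_fin; exact: exceed_count.
under eq_integral do rewrite EFinM.
rewrite ge0_integralZl_EFin//; last 2 first.
- by move=> t _; rewrite lee_fin sumr_ge0.
- exact/measurable_EFinP/measurable_bsum.
rewrite integral_bsum// !muleA; apply: lee_wpmul2r => //.
rewrite -!EFinM lee_fin -[4%R]/((2 * 2)%:R) natrM exprMn.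
rewrite [leRHS]mulrC -mulrA ler_wpM2l ?exprn_ge0//.
exact: card_bx_double.
Qed.

Lemma maximal_ineq f (lam : R) : measurable_fun setT f ->
  (forall t, (0 <= f t)%R) -> (0 < lam)%R ->
  P [set t | exists n, exceed f lam n t] <=
  (4 ^+ d / lam)%:E * \int[P]_t (f t)%:E.
Proof.
move=> mf f0 l0.
pose F N := [set t | exists2 n, (n <= N)%N & exceed f lam n t].
have mF N : measurable (F N).
  rewrite (_ : F N = [set t | exists n, (if (n <= N)%N then exceed f lam n else set0) t]).
    apply: (@measurable_exists _ _ _ (fun n => if (n <= N)%N then exceed f lam n else set0)) => n.
    by case: ifP => // _; exact: measurable_exceed.
  apply/seteqP; split => t [n]; first by move=> nN en; exists n; rewrite nN.
  by case: ifP => // nN en; exists n.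
have -> : [set t | exists n, exceed f lam n t] = \bigcup_N F N.
  apply/seteqP; split => t; first by move=> [n en]; exists n => //; exists n.
  by move=> [N _ [n _ en]]; exists n.
have mU : measurable (\bigcup_N F N) by exact: bigcupT_measurable.
have ndF : nondecreasing_seq F.
  by move=> N M NM; apply/subsetPset => t [n nN en]; exists n => //; exact: leq_trans NM.
have cF := nondecreasing_cvg_mu mF mU ndF (mu := P).
rewrite -(cvg_lim _ cF)//; apply: lime_le; first by apply/cvg_ex; eexists; exact: cF.
apply: nearW => N /=.
rewrite -(@lee_pmul2l _ lam%:E)//; apply: (le_trans (maximal_ineq_bounded N mf f0 (ltW l0))).
by rewrite muleA -EFinM mulrCA mulfV ?mulr1// gt_eqF.
Qed.

Local Close Scope ereal_scope.

Lemma bx_ratio K (eps : R) : 0 < eps -> exists n0, forall n, (n0 <= n)%N ->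
  #|` bx d (n + K)|%:R - #|` bx d n|%:R <= eps * #|` bx d n|%:R.
Proof.
move=> e0; pose C : R := d%:R * (2 * K%:R) * 2 ^+ d.
(* n >= K gives n + K <= 2 n, so the enlarged volume is at most 2^d times the original; n > C / eps
   makes the remaining ratio at most eps. *)
exists (maxn K (Num.truncn (C / eps)).+1) => n; rewrite geq_max => /andP[Kn Cn].
apply: (le_trans (card_bx_diff R d (leq_addr K n))).
have -> : (n + K)%:R - n%:R = K%:R :> R by rewrite natrD addrC addKr.
have n1 : 0 < ((n + K).*2.+1)%:R :> R by rewrite ltr0n.
have h : #|` bx d (n + K)|%:R <= 2 ^+ d * #|` bx d n|%:R :> R.
  apply: le_trans (card_bx_double R d n); rewrite ler_nat; apply: fsubset_leq_card.
  by apply: bx_sub; rewrite -addnn leq_add2l.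
apply: (@le_trans _ _ (d%:R * (2 * K%:R) / ((n + K).*2.+1)%:R * (2 ^+ d * #|` bx d n|%:R))).
  by rewrite ler_wpM2l// mulr_ge0 ?invr_ge0// mulr_ge0.
rewrite mulrA ler_pM2r ?card_bx_gt0// mulrAC ler_pdivrMr// -/C mulrC -ler_pdivrMr//.
apply: (@le_trans _ _ (Num.truncn (C / eps)).+1%:R).
  by rewrite ltW// truncnS_gt.
by rewrite ler_nat; apply: (leq_trans Cn); lia.
Qed.

(** The sum of the K-averages is the mean, over z in the box of radius K, of the sums over the boxes
    of radius n centered at z. Each of these boxes, like the one centered at 0, lies in the box of
    radius n + K and misses the same number of its points, whence the factor 2. *)
Lemma bsum_bavg_diff f (M : R) n K t : (forall t, `|f t| <= M) ->
  `|bsum f n t - bsum (bavg f K) n t| <= 2 * M * (#|` bx d (n + K)|%:R - #|` bx d n|%:R).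
Proof.
move=> fM; set D := #|` bx d (n + K)|%:R - #|` bx d n|%:R.
have B0 : (0 < #|` bx d K|%:R :> R) by exact: card_bx_gt0.
have -> : bsum f n t - bsum (bavg f K) n t = #|` bx d K|%:R^-1 *
    \sum_(z <- bx d K) (bsum f n t - \sum_(y <- zball z n) f (tau y t)).
  rewrite sumrB mulrBr.
  have -> : \sum_(z <- bx d K) bsum f n t = #|` bx d K|%:R * bsum f n t.
    by rewrite big_const_seq count_predT iter_addr_0 mulr_natl.
  rewrite mulKf ?gt_eqF//.
  congr (_ - _); rewrite /bsum /bavg -mulr_sumr; congr (_ * _).
  rewrite exchange_big/=; apply: eq_bigr => z _; rewrite sum_zball.
  by apply: eq_bigr => x _; rewrite tauD addrC.
rewrite normrM ger0_norm ?invr_ge0//.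
rewrite mulrC ler_pdivrMr//; apply: (le_trans (ler_norm_sum _ _ _)).
have -> : 2 * M * D * #|` bx d K|%:R = \sum_(z <- bx d K) (2 * M * D).
  by rewrite big_const_seq count_predT iter_addr_0 mulr_natr.
rewrite !big_seq; apply: ler_sum => z /in_bx zK.
set S := \sum_(y <- bx d (n + K)) f (tau y t).
have h1 : `|S - bsum f n t| <= M * D.
  by apply: (@sum_fset_diff _ _ _ _ (fun y => f (tau y t))) => //; apply: bx_sub; exact: leq_addr.
have h2 : `|S - \sum_(y <- zball z n) f (tau y t)| <= M * D.
  rewrite /D -(card_zball z n); apply: (@sum_fset_diff _ _ _ _ (fun y => f (tau y t))) => //.
  apply/fsubsetP => y /in_zballP yz; apply/in_bx.
  by rewrite -(subrK z y); apply: box_add.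
have -> : bsum f n t - \sum_(y <- zball z n) f (tau y t) =
  (S - \sum_(y <- zball z n) f (tau y t)) - (S - bsum f n t) by ring.
apply: (le_trans (ler_normB _ _)).
have -> : 2 * M * D = M * D + M * D by ring.
exact: lerD.
Qed.

Lemma ler_bavg_norm f n t : `|bavg f n t| <= bavg (fun t => `|f t|) n t.
Proof.
rewrite /bavg normrM ger0_norm ?invr_ge0// ler_wpM2l ?invr_ge0//.
exact: ler_norm_sum.
Qed.

Lemma bavgB f g n t : bavg f n t - bavg g n t = bavg (fun t => f t - g t) n t.
Proof. by rewrite /bavg -mulrBr /bsum -sumrB. Qed.

Lemma bavg_cst (c : R) n t : bavg (fun=> c) n t = c.
Proof.
rewrite /bavg /bsum big_const_seq count_predT iter_addr_0 -[c *+ _]mulr_natl mulKf//.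
by rewrite gt_eqF// card_bx_gt0.
Qed.

(* A Banach-principle form of the ergodic theorem: by the maximal inequality,
   almost sure convergence of the averages of [f] follows from the L^1
   convergence of the averages of bounded approximations of [f]. *)
Lemma ergodic_theorem f (c : R) : measurable_fun setT f ->
  (forall eps : R, 0 < eps -> exists g, [/\ measurable_fun setT g,
     exists M : R, forall t, `|g t| <= M,
     (\int[P]_t `|f t - g t|%:E <= eps%:E)%E &
     exists K, (\int[P]_t `|bavg g K t - c|%:E <= eps%:E)%E]) ->
  {ae P, forall t, bavg f n t @[n --> \oo] --> c}.
Proof.
move=> mf approx.
have step (del : R) : 0 < del -> P.-negligible
    [set t | ~ exists n0, forall n, (n0 <= n)%N -> `|bavg f n t - c| <= 3 * del].
  move=> del0.
  pose eps k : R := k.+1%:R^-1.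
  have eps0 k : 0 < eps k by rewrite invr_gt0.
  have /choice[g gP] := fun k => approx (eps k) (eps0 k).
  have /choice[K KP] : forall k, exists K, (\int[P]_t `|bavg (g k) K t - c|%:E <= (eps k)%:E)%E.
    by move=> k; have [_ _ _] := gP k.
  have mg k : measurable_fun setT (g k) by have [] := gP k.
  pose h1 k t := `|f t - g k t|; pose h2 k t := `|bavg (g k) (K k) t - c|.
  have mh1 k : measurable_fun setT (h1 k).
    by apply: measurableT_comp => //; exact: measurable_funB.
  have mh2 k : measurable_fun setT (h2 k).
    by apply: measurableT_comp => //; apply: measurable_funB => //; exact: measurable_bavg.
  (* Off both events every box average of [h1 k] and of [h2 k] is at most [del]; by the maximal
     inequality their probabilities are O(eps k) for fixed [del]. *)
  pose E1 k := [set t | exists n, exceed (h1 k) del n t].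
  pose E2 k := [set t | exists n, exceed (h2 k) del n t].
  have mE1 k : measurable (E1 k).
    by apply: (@measurable_exists _ _ _ (exceed (h1 k) del)) => n; exact: measurable_exceed.
  have mE2 k : measurable (E2 k).
    by apply: (@measurable_exists _ _ _ (exceed (h2 k) del)) => n; exact: measurable_exceed.
  have mE : measurable (\bigcap_k (E1 k `|` E2 k)).
    by apply: bigcapT_measurable => k; exact: measurableU.
  exists (\bigcap_k (E1 k `|` E2 k)); split => //; last first.
    move=> t /= not_cvg k _; apply: contrapT => /not_orP[n1 n2]; apply: not_cvg.
    have [_ [M gM] _ _] := gP k.
    have M0 : 0 <= M by apply: le_trans (gM t).
    (* The denominator 2 M + 1 absorbs the factor 2 M of [bsum_bavg_diff] and stays positive when M
       = 0. *)
    have [n0 n0P] := @bx_ratio (K k) (del / (2 * M + 1)) (divr_gt0 del0 (ltr_wpDl (mulr_ge0 (ler0n _ 2) M0) ltr01)).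
    exists n0 => n nn0.
    have B0 : (0 < #|` bx d n|%:R :> R) by exact: card_bx_gt0.
    (* The first term is controlled off [E1 k], the second is a boundary effect for the bounded
       function [g k], and the third is controlled off [E2 k]. *)
    have -> : bavg f n t - c = (bavg f n t - bavg (g k) n t) +
       (bavg (g k) n t - bavg (bavg (g k) (K k)) n t) + (bavg (bavg (g k) (K k)) n t - c) by ring.
    have -> : 3 * del = del + del + del by ring.
    apply: (le_trans (ler_normD _ _)); apply: lerD.
      apply: (le_trans (ler_normD _ _)); apply: lerD.
        rewrite bavgB; apply: (le_trans (ler_bavg_norm _ _ _)).
        by rewrite leNgt; apply/negP => ?; apply: n1; exists n.
      rewrite /bavg -mulrBr normrM ger0_norm ?invr_ge0// mulrC ler_pdivrMr//.
      apply: (le_trans (bsum_bavg_diff n (K k) t gM)).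
      apply: (@le_trans _ _ (2 * M * (del / (2 * M + 1) * #|` bx d n|%:R))).
        by rewrite ler_wpM2l ?mulr_ge0//; exact: n0P.
      rewrite mulrA ler_pM2r// mulrCA -[leRHS]mulr1 ler_pM2l//.
      by rewrite ler_pdivrMr ?ltr_wpDl ?mulr_ge0// mul1r lerDl.
    rewrite -{1}(bavg_cst c n t) bavgB; apply: (le_trans (ler_bavg_norm _ _ _)).
    by rewrite leNgt; apply/negP => ?; apply: n2; exists n.
  have bound k : (P (\bigcap_k (E1 k `|` E2 k)) <= (2 * 4 ^+ d / del * eps k)%:E)%E.
    apply: (@le_trans _ _ (P (E1 k `|` E2 k))).
      apply: le_measure; rewrite ?inE//; first exact: measurableU.
      exact: bigcap_inf.
    apply: (le_trans (measureU2 _ _ _)) => //.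
    have -> : 2 * 4 ^+ d / del * eps k = 4 ^+ d / del * eps k + 4 ^+ d / del * eps k by ring.
    have D0 : (0 <= (4 ^+ d / del)%:E :> \bar R)%E.
      by rewrite lee_fin divr_ge0 ?exprn_ge0// ltW.
    rewrite EFinD; apply: leeD; rewrite EFinM.
      apply: (le_trans (maximal_ineq (mh1 k) (fun t => normr_ge0 _) del0)).
      by apply: lee_wpmul2l => //; have [] := gP k.
    apply: (le_trans (maximal_ineq (mh2 k) (fun t => normr_ge0 _) del0)).
    by apply: lee_wpmul2l => //; exact: KP.
  apply/eqP; rewrite eq_le measure_ge0 andbT.
  have fin : P (\bigcap_k (E1 k `|` E2 k)) \is a fin_num by exact: fin_num_measure.
  rewrite -(fineK fin) lee_fin.
  apply: (@le0_of_le_harmonic _ _ (2 * 4 ^+ d / del)) => k.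
  by rewrite -lee_fin fineK//; exact: bound.
have : P.-negligible (\bigcup_k [set t | ~ exists n0, forall n, (n0 <= n)%N ->
    `|bavg f n t - c| <= 3 * (k.+1%:R^-1)]).
  by apply: negligible_bigcup => k; apply: step; rewrite invr_gt0.
apply: negligibleS => t /= ncvg; apply: contrapT => nU; apply: ncvg.
apply/cvgrPdist_le => e e0; pose k := Num.truncn (3 / e).
have [n0 n0P] : exists n0, forall n, (n0 <= n)%N -> `|bavg f n t - c| <= 3 * (k.+1%:R^-1).
  by apply: contrapT => no; apply: nU; exists k.
exists n0 => // n /= /n0P h; rewrite distrC; apply: (le_trans h).
rewrite ler_pdivrMr// mulrC -ler_pdivrMr//.
by rewrite ltW// truncnS_gt.
Qed.

End ergodic.

(** * I.i.d. colors attached to the roots of the finite clusters *)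

Section iid_colors.
Context (R : realType) (d : nat) (nu : probability (measurableTypeR R) R).
Implicit Types (J : {fset Zd d}) (B : Zd d -> set (measurableTypeR R)) (x y v : Zd d).

(** A second sigma-algebra on colorings, beside the Borel one of [coloring_space]: being generated
    by the coordinates, it allows laws to be compared on finite rectangles. Color measures are
    pushed to it by measurable maps. *)
Definition coord_events : set (set (Zd d -> R)) :=
  [set A | exists x (B : set (measurableTypeR R)), measurable B /\ A = [set w | B (w x)]].

Definition cspace := g_sigma_algebraType coord_events.
HB.instance Definition _ := Measurable.on cspace.

Definition rect J B : set cspace := [set w | forall i, i \in J -> B i (w i)].

Definition iid (P : probability cspace R) := forall J B,
  (forall i, measurable (B i)) -> P (rect J B) = (\prod_(i <- J) nu (B i))%E.

Lemma measurable_coord x : measurable_fun setT (fun w : cspace => w x : measurableTypeR R).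
Proof.
move=> _ B mB; rewrite setTI; apply: sub_sigma_algebra; exists x, B; split => //.
Qed.

Lemma measurable_coord_preimage x (B : set (measurableTypeR R)) : measurable B ->
  measurable [set w : cspace | B (w x)].
Proof. exact: measurable_preimage (@measurable_coord x). Qed.

Lemma measurable_rect J B : (forall i, measurable (B i)) -> measurable (rect J B).
Proof.
move=> mB; rewrite (_ : rect J B = \bigcap_(i in [set` J]) [set w : cspace | B i (w i)]).
  by apply: fin_bigcap_measurable => // i _; exact: measurable_coord_preimage.
by apply/seteqP; split.
Qed.

Lemma eq_measure_rect (m1 m2 : {measure set cspace -> \bar R}) :
  (m1 setT < +oo)%E ->
  (forall J B, (forall i, measurable (B i)) -> m1 (rect J B) = m2 (rect J B)) ->
  forall A, measurable A -> m1 A = m2 A.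
Proof.
move=> m1T m12; apply: (@eq_measure_gsigma R _ coord_events
  [set A | exists J B, (forall i, measurable (B i)) /\ A = rect J B]) => //.
- move=> A [x [B [mB ->]]]; exists [fset x]%fset, (fun=> B); split => //.
  apply/seteqP; split => w /=; first by move=> Bw i; rewrite inE => /eqP ->.
  by apply; rewrite inE.
- by move=> A [J [B [mB ->]]]; exact: measurable_rect.
- move=> _ _ [J [B [mB ->]]] [J' [B' [mB' ->]]].
  exists (J `|` J')%fset, (fun i => (if i \in J then B i else setT) `&`
    (if i \in J' then B' i else setT)); split.
    by move=> i; apply: measurableI; case: ifP.
  apply/seteqP; split => w /=.
    by move=> [wB wB'] i _; split; case: ifP => //; [exact: wB|exact: wB'].
  move=> h; split => i iJ; have := h i; rewrite inE iJ ?orbT => /(_ isT) [].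
    by [].
  by move=> _.
- exists fset0, (fun=> setT); split => //.
  by apply/seteqP; split => // w _ i; rewrite inE.
- by move=> A [J [B [mB ->]]]; exact: m12.
Qed.

Definition shift_color v (w : cspace) : cspace := fun x => w (x + v).

Lemma measurable_shift_color v : measurable_fun setT (shift_color v).
Proof.
apply: measurable_fun_gsigma => _ [x [B [mB ->]]].
exact: (@measurable_coord_preimage (x + v)).
Qed.

Section fixed_iid.
Context (P : probability cspace R).
Hypothesis iidP : iid P.

Lemma iid_shift v A : measurable A -> P (shift_color v @^-1` A) = P A.
Proof.
move=> mA; rewrite -(image_probE P (measurable_shift_color v)).
apply: eq_measure_rect mA => /=.
  by rewrite -ge0_fin_numE ?measure_ge0// fin_num_measure.
move=> J B mB; rewrite [LHS]/distribution /pushforward [RHS](iidP _ mB).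
have -> : shift_color v @^-1` rect J B =
    rect [fset (x + v)%R | x in J]%fset (fun x => B (x - v)).
  apply/seteqP; split => w /= h i.
    by move=> /imfsetP[x /= xJ ->]; rewrite addrK; exact: h.
  by move=> iJ; have := h (i + v); rewrite addrK; apply; apply/imfsetP; exists i.
rewrite iidP// big_imfset/=; last by move=> x y _ _; exact: addIr.
by apply: eq_bigr => x _; rewrite addrK.
Qed.

Lemma iid1 x (B : set (measurableTypeR R)) : measurable B -> P [set w | B (w x)] = nu B.
Proof.
move=> mB; have := iidP [fset x]%fset (fun _ : Zd d => mB); rewrite big_seq_fset1 => <-.
congr (P _); apply/seteqP; split => w /=; first by move=> Bw i; rewrite inE => /eqP ->.
by apply; rewrite inE.
Qed.

Lemma iid2 x y (A B : set (measurableTypeR R)) : x != y -> measurable A -> measurable B ->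
  P [set w | A (w x) /\ B (w y)] = (nu A * nu B)%E.
Proof.
move=> xy mA mB.
have := @iidP [fset x; y]%fset (fun z => if z == x then A else B).
rewrite big_fsetU1/=; last by rewrite inE.
rewrite big_seq_fset1 eqxx eq_sym (negbTE xy) => <-; last by move=> i; case: ifP.
congr (P _); apply/seteqP; split => w /=.
  by move=> [Aw Bw] i; rewrite !inE => /orP[] /eqP ->; rewrite ?eqxx// eq_sym (negbTE xy).
move=> h; split; first by have := h x; rewrite !inE eqxx; apply.
by have := h y; rewrite !inE eqxx orbT eq_sym (negbTE xy); apply.
Qed.

Local Open Scope ereal_scope.

Lemma integral_coord x (phi : R -> R) : measurable_fun setT phi -> (forall r, (0 <= phi r)%R) ->
  \int[P]_w (phi (w x))%:E = \int[nu]_r (phi r)%:E.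
Proof.
move=> mphi phi0.
transitivity (\int[pushforward P (fun w : cspace => w x : measurableTypeR R)]_r (phi r)%:E).
  rewrite ge0_integral_pushforward//.
  - exact: measurable_coord.
  - exact/measurable_EFinP.
  - by move=> r _; rewrite lee_fin.
apply: eq_measure_integral; first exact: measurable_coord.
by move=> mc A mA _; exact: (iid1 x mA).
Qed.

Lemma integral_coord2 x y (phi : R -> R) : x != y -> measurable_fun setT phi ->
  (forall r, (0 <= phi r)%R) ->
  \int[P]_w (phi (w x) * phi (w y))%:E =
  \int[nu]_r (phi r)%:E * \int[nu]_r (phi r)%:E.
Proof.
move=> xy mphi phi0.
pose h (w : cspace) : measurableTypeR R * measurableTypeR R := (w x, w y).
have mh : measurable_fun setT h.
  by apply: measurable_fun_pair; exact: measurable_coord.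
have I0 : 0 <= \int[nu]_r (phi r)%:E by apply: integral_ge0 => r _; rewrite lee_fin.
have mphi2 : measurable_fun setT (fun z : measurableTypeR R * measurableTypeR R =>
    (phi z.1 * phi z.2)%:E).
  apply/measurable_EFinP; apply: measurable_funM; apply: measurableT_comp => //.
transitivity (\int[pushforward P h]_z (phi z.1 * phi z.2)%:E).
  by rewrite ge0_integral_pushforward// => r _; rewrite lee_fin mulr_ge0.
transitivity (\int[nu \x nu]_z (phi z.1 * phi z.2)%:E).
  apply: eq_measure_integral => A mA _; apply/esym.
  have := @product_measure_unique _ _ _ _ R nu nu (image_prob P mh) _ A mA.
  apply => A1 A2 mA1 mA2; exact: (iid2 xy mA1 mA2).
rewrite fubini_tonelli1//; last by move=> z; rewrite lee_fin mulr_ge0.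
rewrite /fubini_F.
under eq_integral => r _.
  under eq_integral do rewrite /= EFinM.
  rewrite ge0_integralZl_EFin//; last 2 first.
  - by move=> ? _; rewrite lee_fin.
  - exact/measurable_EFinP.
  over.
rewrite ge0_integralZr//; first exact/measurable_EFinP.
by move=> r _; rewrite lee_fin.
Qed.

End fixed_iid.
End iid_colors.

(** * Roots of the finite clusters *)

Section roots.
Context (d : nat).
Implicit Types (u v w x y z : Zd d) (G : subgraph d).

(* Positivity for the lexicographic order, which is translation invariant. *)
Definition pos v : Prop := exists i, 0 < v i /\ forall j : 'I_d, (j < i)%N -> v j = 0.

Lemma pos_add u v : pos u -> pos v -> pos (u + v).
Proof.
move=> [i [ui ui0]] [j [vj vj0]]; have [ij|ji|ij] := ltngtP i j.
- exists i; rewrite zdD vj0// addr0; split => // k ki.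
  by rewrite zdD ui0// vj0 ?addr0//; exact: ltn_trans ij.
- exists j; rewrite zdD ui0// add0r; split => // k kj.
  by rewrite zdD vj0// ui0 ?addr0//; exact: ltn_trans ji.
- have {}ij : i = j by exact/val_inj.
  subst j; exists i; rewrite zdD addr_gt0//; split => // k ki.
  by rewrite zdD ui0// vj0 ?addr0.
Qed.

Lemma pos_neq0 v : pos v -> v <> 0.
Proof. by move=> [i [vi _]] v0; move: vi; rewrite v0 zd0 ltxx. Qed.

Lemma pos_total v : [\/ v = 0, pos v | pos (- v)].
Proof.
have [->|/eqP v0] := eqVneq v 0; first by constructor 1.
have [i0 vi0] : exists i, v i != 0.
  apply/existsP; apply: contra_notT v0 => /existsPn h; apply/ffunP => i.
  by rewrite zd0; apply/eqP; rewrite -[_ == _]negbK; exact: h.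
case: (@arg_minnP _ i0 (fun i => v i != 0) (fun i => i : nat) vi0) => i vi mi.
have vj (j : 'I_d) : (j < i)%N -> v j = 0.
  by move=> ji; apply/eqP; apply: contraTT ji => /mi; rewrite -leqNgt.
have [vi_lt|vi_gt|vi_eq] := ltgtP (v i) 0.
- constructor 3; exists i; rewrite zdN oppr_gt0; split => // j /vj vj0.
  by rewrite zdN vj0 oppr0.
- by constructor 2; exists i.
- by rewrite vi_eq eqxx in vi.
Qed.

Definition isroot G x y : Prop :=
  conn G x y /\ forall z, conn G x z -> z = y \/ pos (z - y).

Lemma isroot_uniq G x y y' : isroot G x y -> isroot G x y' -> y = y'.
Proof.
move=> [xy my] [xy' my'].
have [//|p1] := my' _ xy; have [//|p2] := my _ xy'.
by have := pos_neq0 (pos_add p1 p2); rewrite addrC subrKA subrr.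
Qed.

Lemma isroot_ex G x : ~ inf_cluster G x -> exists y, isroot G x y.
Proof.
move=> /contrapT/finite_fsetP[F FE].
have xF : x \in F by have := conn_refl G x; rewrite FE.
suff [y yF my] : exists2 y, y \in enum_fset F &
    forall z, z \in enum_fset F -> z = y \/ pos (z - y).
  exists y; split; first by rewrite FE.
  by move=> z; rewrite FE; exact: my.
move: xF; rewrite -[x \in F]/(x \in enum_fset F); elim: (enum_fset F) x {FE} => // a s IH x _.
have [->|] := eqVneq s [::].
  by exists a; rewrite ?inE// => z; rewrite inE => /eqP ->; left.
case: s IH => // b s IH _.
have [|y ys my] := IH b; first by rewrite inE eqxx.
have [/subr0_eq ay|p|p] := pos_total (a - y).
- exists y; first by rewrite inE ys orbT.
  by move=> z; rewrite inE => /predU1P[->|/my//]; left.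
- exists y; first by rewrite inE ys orbT.
  by move=> z; rewrite inE => /predU1P[->|/my//]; right.
- exists a; first by rewrite inE eqxx.
  rewrite opprB in p.
  move=> z; rewrite inE => /predU1P[->|/my[->|pz]]; [by left|by right|right].
  by have := pos_add pz p; rewrite subrKA.
Qed.

Lemma isroot_shift v G x y :
  isroot (shift_graph v G) x y <-> isroot G (x + v) (y + v).
Proof.
split=> -[xy my]; split.
- exact: (iffLR (conn_shift _ _ _ _) xy).
- move=> z xz; have [|zy|p] := my (z - v).
  + by apply: (iffRL (conn_shift _ _ _ _)); rewrite subrK.
  + by left; rewrite -zy subrK.
  + by right; rewrite opprD addrA addrAC.
- exact: (iffRL (conn_shift _ _ _ _) xy).
- move=> z xz; have [|/addIr zy|p] := my (z + v).
  + exact: (iffLR (conn_shift _ _ _ _) xz).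
  + by left.
  + by right; move: p; rewrite opprD addrACA subrr addr0.
Qed.

Lemma measurable_isroot x y :
  measurable ([set G | isroot G x y] : set (subgraph_space d)).
Proof.
apply: measurableI; first exact: measurable_conn.
apply: (@measurable_forall _ (subgraph_space d) _
  (fun z => [set G : subgraph d | conn G x z -> z = y \/ pos (z - y)])) => z.
rewrite (_ : [set _ | _] = ~` [set G : subgraph d | conn G x z] `|`
    [set _ | z = y \/ pos (z - y)]).
  apply: measurableU; last exact: measurable_prop.
  by apply: measurableC; exact: measurable_conn.
apply/seteqP; split => G /=; last by case.
by move=> h; have [c|] := pselect (conn G x z); [right; exact: h|left].
Qed.

Definition root G x : Zd d := xget 0 [set y | isroot G x y].

Lemma rootP G x : ~ inf_cluster G x -> isroot G x (root G x).
Proof. by move=> /isroot_ex[y xy]; rewrite /root; apply: (xgetPex 0); exists y. Qed.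

Lemma root_eq G x y : isroot G x y -> root G x = y.
Proof.
move=> xy; apply: (isroot_uniq _ xy).
by rewrite /root; apply: (xgetPex 0); exists y.
Qed.

Lemma measurable_root x y :
  measurable ([set G | root G x = y] : set (subgraph_space d)).
Proof.
(* The second alternative is the default value 0 of [xget] when the cluster has no root. *)
rewrite (_ : [set G | _] = [set G | isroot G x y] `|`
  (~` [set G | exists z, isroot G x z] `&` [set _ | y = 0])).
  apply: measurableU; first exact: measurable_isroot.
  apply: measurableI; last exact: measurable_prop.
  apply: measurableC.
  apply: (@measurable_exists _ (subgraph_space d) _
    (fun z => [set G : subgraph d | isroot G x z])) => z.
  exact: measurable_isroot.
apply/seteqP; split => G /=.
  rewrite /root; case: xgetP => [z _ /= xz <-|noz <-]; first by left.
  by right; split => // -[z /noz].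
move=> [/root_eq//|[noz ->]]; rewrite /root; case: xgetP => // z _ /= xz.
by exfalso; apply: noz; exists z.
Qed.

(** The order being translation invariant, the root is covariant, which makes the colored field
    stationary. An infinite cluster without a least vertex has the default root 0, which does not
    follow translations. *)
Lemma root_shift v G x : ~ inf_cluster G (x + v) ->
  root (shift_graph v G) x + v = root G (x + v).
Proof.
move=> fx; apply/esym/root_eq/(iffLR (isroot_shift _ _ _ _))/rootP.
by move=> /(iffLR (inf_cluster_shift _ _ _)).
Qed.

Lemma root_conn G x y : ~ inf_cluster G x -> conn G x y -> root G y = root G x.
Proof.
move=> fx xy; apply: root_eq; rewrite /isroot -(conn_eq xy); exact: rootP.
Qed.

End roots.

(** * The joint law of the graph and the i.i.d. colors *)

Section joint.
Context (R : realType) (d : nat) (p : R) (mu : probability (subgraph_space d) R).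
Hypotheses (p01 : 0 < p < 1) (hmu : bond_percolation p mu).
Context (nu : probability (measurableTypeR R) R) (P0 : probability (cspace R d) R).
Hypothesis iidP : iid nu P0.
Implicit Types (G : subgraph d) (x y v : Zd d).

Notation joint := (subgraph_space d * cspace R d)%type.

Definition Pj : probability joint R := (mu \x P0)%E.

Definition shift_joint v (t : joint) : joint := (shift_graph v t.1, shift_color v t.2).

Lemma measurable_shift_joint v : measurable_fun setT (shift_joint v).
Proof.
apply: measurable_fun_pair; apply: measurableT_comp => //.
  exact: measurable_shift_graph.
exact: measurable_shift_color.
Qed.

Lemma Pj_shift v A : measurable A -> Pj (shift_joint v @^-1` A) = Pj A.
Proof.
move=> mA; rewrite -(image_probE Pj (measurable_shift_joint v)); apply/esym.
apply: product_measure_unique mA => A1 A2 mA1 mA2 /=.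
rewrite /distribution /pushforward.
have -> : shift_joint v @^-1` (A1 `*` A2) =
    (shift_graph v @^-1` A1) `*` (shift_color v @^-1` A2) by [].
rewrite -(mu_shift v hmu mA1) -(iid_shift iidP v mA2); apply: product_measure1E.
- exact: (measurable_preimage (measurable_shift_graph v) mA1).
- exact: (measurable_preimage (@measurable_shift_color R d v) mA2).
Qed.

Lemma shift_jointD v w t : shift_joint v (shift_joint w t) = shift_joint (w + v) t.
Proof.
rewrite /shift_joint /= shift_graphD addrC; congr pair.
by apply/funext => x; rewrite /shift_color -addrA [v + w]addrC.
Qed.

Definition root_color (t : joint) : R := t.2 (root t.1 0).

Lemma measurable_root_color : measurable_fun setT (root_color : joint -> measurableTypeR R).
Proof.
move=> _ B mB; rewrite setTI.
rewrite (_ : _ @^-1` _ = [set t : joint | exists y, ([set G : subgraph d | root G 0 = y] `*`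
    [set w : cspace R d | B (w y)]) t]).
  apply: measurable_exists => y; apply: measurableX; first exact: measurable_root.
  exact: measurable_coord_preimage.
apply/seteqP; split => t; first by move=> Bt; exists (root t.1 0).
by move=> [y [/= <-]].
Qed.

(** With [A] the finiteness event this is the field at the origin, with [A] a ball event its local
    approximation; in both cases the indicator confines the root to a finite cluster. [phi] will be
    the positive or negative part, possibly truncated, or the constant 1. *)
Definition fld (A : set (subgraph_space d)) (phi : R -> R) (t : joint) : R :=
  \1_A t.1 * phi (root_color t).

Section fld.
Variables (phi : R -> R).
Hypotheses (mphi : measurable_fun setT phi) (phi0 : forall r, 0 <= phi r).

Lemma fld_ge0 A t : 0 <= fld A phi t.
Proof. by rewrite /fld mulr_ge0// indicE. Qed.

Lemma measurable_fld A : measurable A -> measurable_fun setT (fld A phi).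
Proof.
move=> mA; apply: measurable_funM.
  by apply: measurableT_comp => //; exact: measurable_indic.
apply: measurableT_comp => //; exact: measurable_root_color.
Qed.

Local Open Scope ereal_scope.

(** Given the graph, the root is a fixed site, and every site has a color of law [nu]. Fubini then
    separates the two factors. *)
Lemma integral_fld A : measurable A ->
  \int[Pj]_t (fld A phi t)%:E = mu A * \int[nu]_r (phi r)%:E.
Proof.
move=> mA; rewrite /Pj fubini_tonelli1//=; last 2 first.
- by apply/measurable_EFinP; exact: measurable_fld.
- by move=> t; rewrite lee_fin; exact: fld_ge0.
have I0 : 0 <= \int[nu]_r (phi r)%:E by apply: integral_ge0 => r _; rewrite lee_fin.
rewrite /fubini_F.
under eq_integral => G _.
  under eq_integral do rewrite /fld/= EFinM.
  rewrite ge0_integralZl_EFin//; last 2 first.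
  - by move=> ? _; rewrite lee_fin.
  - by apply/measurable_EFinP; apply: measurableT_comp => //; exact: measurable_coord.
  rewrite (integral_coord iidP)//.
  over.
rewrite ge0_integralZr//; last first.
  by apply/measurable_EFinP; exact: measurable_indic.
by rewrite integral_indic// setIT.
Qed.

Local Close Scope ereal_scope.

Definition ball_event K : set (subgraph_space d) := [set G | in_ball K G 0].

Lemma measurable_ball_event K : measurable (ball_event K).
Proof. exact: (determined_measurable (@determined_in_ball d K 0)). Qed.

Lemma not_inf_in_ball K G x : in_ball K G x -> ~ inf_cluster G x.
Proof. by move=> h; apply/finite_clusterP; exists K. Qed.

Lemma fld_shift A x G w : fld A phi (shift_joint x (G, w)) =
  \1_(shift_graph x @^-1` A) G * phi (w (root (shift_graph x G) 0 + x)).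
Proof. by []. Qed.

Lemma ball_event_indep K x y : ~ box d (K.+1 + K.+1) (x - y) ->
  mu ((shift_graph x @^-1` ball_event K) `&` (shift_graph y @^-1` ball_event K)) =
  (mu (ball_event K) * mu (ball_event K))%E.
Proof.
move=> xy.
have bE z : shift_graph z @^-1` ball_event K = [set G | in_ball K G z].
  by apply/seteqP; split => G /=; rewrite /ball_event/= in_ball_shift add0r.
have mb := measurable_ball_event K.
have my := measurable_preimage (measurable_shift_graph y) mb.
rewrite -{1}(mu_shift x hmu mb) -{1}(mu_shift y hmu mb).
apply: (mu_independent p01 hmu (D := near_edges K x)) => //.
  by rewrite bE; exact: determined_in_ball.
rewrite bE => G G' GG'; apply: (@determined_in_ball d K y) => e ey; apply: GG'.
apply/negP => ex; move: ey; apply/negP; exact: near_edges_disjoint ex.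
Qed.

(** Two independences combine. The ball events at distant sites are determined by disjoint sets of
    edges, and on both events the two roots are distinct sites, whose colors are independent given
    the graph. *)
Lemma integral_fld2 K x y : ~ box d (K.+1 + K.+1) (x - y) ->
  let I := (mu (ball_event K) * \int[nu]_r (phi r)%:E)%E in
  (\int[Pj]_t (fld (ball_event K) phi (shift_joint x t) *
               fld (ball_event K) phi (shift_joint y t))%:E = I * I)%E.
Proof.
move=> xy I; set A := ball_event K.
have mA : measurable A := measurable_ball_event K.
have mf z : measurable_fun setT (fun t => fld A phi (shift_joint z t)).
  by apply: measurableT_comp; [exact: measurable_fld|exact: measurable_shift_joint].
rewrite /Pj fubini_tonelli1//=; last 2 first.
- by apply/measurable_EFinP; exact: measurable_funM.
- by move=> t; rewrite lee_fin mulr_ge0// fld_ge0.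
rewrite /fubini_F.
have I0 : (0 <= \int[nu]_r (phi r)%:E)%E by apply: integral_ge0 => r _; rewrite lee_fin.
pose B : set (subgraph_space d) := (shift_graph x @^-1` A) `&` (shift_graph y @^-1` A).
have mB : measurable B.
  by apply: measurableI; apply: (measurable_preimage (measurable_shift_graph _) mA).
under eq_integral => G _.
  rewrite (_ : (\int[P0]_w _)%E = ((\1_B G)%:E *
      (\int[nu]_r (phi r)%:E * \int[nu]_r (phi r)%:E))%E).
  over.
  rewrite /=.
  have [BG|nBG] := pselect (B G); last first.
    rewrite indicE memNset// mul0e; apply: integral0_eq => w _.
    rewrite !fld_shift !indicE.
    have [|] := pselect ((shift_graph x @^-1` A) G) => Ax; last first.
      by rewrite (memNset Ax) !mul0r.
    have [|] := pselect ((shift_graph y @^-1` A) G) => Ay; last first.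
      by rewrite (memNset Ay) mul0r mulr0.
    by exfalso; apply: nBG.
  rewrite indicE mem_set// mul1e.
  have [Ax Ay] := BG.
  rewrite -(@integral_coord2 _ _ _ _ iidP (root (shift_graph x G) 0 + x)
     (root (shift_graph y G) 0 + y))//.
    by apply: eq_integral => w _; rewrite !fld_shift !indicE !mem_set// !mul1r.
  (* A common root would put [x - y] in the box of radius 2 K, since each root lies within K of its
     site. *)
  apply/eqP => xyE; apply: xy.
  have [cx _] := rootP (not_inf_in_ball Ax); have [cy _] := rootP (not_inf_in_ball Ay).
  have := box_sub (Ay _ cy) (Ax _ cx); rewrite !subr0 => b.
  apply: (@box_le _ (K + K)); first by rewrite leq_add.
  have -> : x - y = root (shift_graph y G) 0 - root (shift_graph x G) 0; last by [].
  apply/eqP; rewrite subr_eq addrAC -xyE.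
  by rewrite [root _ _ + x]addrC addrK.
rewrite ge0_integralZr//; last 2 first.
- by apply/measurable_EFinP; exact: measurable_indic.
- by rewrite mule_ge0.
rewrite integral_indic// setIT [X in (X * _)%E = _](_ : _ = (mu A * mu A)%E).
  by rewrite muleACA.
exact: ball_event_indep xy.
Qed.

End fld.
End joint.

Lemma card_bx_ge d n : (0 < d)%N -> (n <= #|` bx d n|)%N.
Proof.
move=> d_gt0; rewrite card_bx; apply: (@leq_trans (n.*2.+1)); first by lia.
by rewrite -[leqLHS]expn1 leq_pexp2l.
Qed.

Lemma integral_prob_cst dd (T : measurableType dd) (R : realType)
    (P : probability T R) (c : R) : (\int[P]_t c%:E = c%:E)%E.
Proof.
by rewrite integral_cst// -[RHS]mule1; congr (_ * _)%E; exact: probability_setT.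
Qed.

(** * Law of large numbers under the joint law *)

Section joint_lln.
Context (R : realType) (d : nat) (p : R) (mu : probability (subgraph_space d) R).
Hypotheses (d_gt0 : (0 < d)%N) (p01 : 0 < p < 1) (hmu : bond_percolation p mu).
Context (nu : probability (measurableTypeR R) R) (P0 : probability (cspace R d) R).
Hypothesis iidP : iid nu P0.
Implicit Types (G : subgraph d) (x y v : Zd d).

Notation joint := (subgraph_space d * cspace R d)%type.
Notation Pj := (Pj mu P0).
Notation ball_event := (@ball_event d).
Notation shift := (@shift_joint R d).

Section bounded_fld.
Variables (phi : R -> R) (M : R) (K : nat).
Hypotheses (mphi : measurable_fun setT phi) (phi0 : forall r, 0 <= phi r).
Hypothesis phiM : forall r, phi r <= M.
Let g := fld (ball_event K) phi.
Let c : R := fine (mu (ball_event K)) * fine (\int[nu]_r (phi r)%:E)%E.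

Let M0 : 0 <= M. Proof. exact: le_trans (phi0 0) (phiM 0). Qed.

Let int_phi_fin : (\int[nu]_r (phi r)%:E)%E \is a fin_num.
Proof.
rewrite ge0_fin_numE; last by apply: integral_ge0 => r _; rewrite lee_fin.
apply: (@le_lt_trans _ _ (\int[nu]_r (M%:E))%E).
  apply: ge0_le_integral => //.
  - by move=> r _; rewrite lee_fin.
  - exact/measurable_EFinP.
  - by move=> r _; rewrite lee_fin.
by rewrite integral_prob_cst ltry.
Qed.

Let cE : (mu (ball_event K) * \int[nu]_r (phi r)%:E)%E = c%:E.
Proof. by rewrite EFinM !fineK// fin_num_measure//; exact: measurable_ball_event. Qed.

Lemma fld_le t : g t <= M.
Proof.
rewrite /g /fld indicE; case: (_ \in _); first by rewrite mul1r.
by rewrite mul0r.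
Qed.

Let mg : measurable_fun setT g.
Proof. by apply: measurable_fld => //; exact: measurable_ball_event. Qed.

Let g0 t : 0 <= g t. Proof. exact: fld_ge0. Qed.

(** Pairs of sites differing by more than 2 K + 2 in some coordinate contribute exactly c^2. Each
    site has at most as many nearer partners as the box of radius 2 K + 2 has points, and such a
    pair contributes at most M^2. *)
Lemma second_moment n : (\int[Pj]_t (bsum shift g n t ^+ 2)%:E <=
  ((#|` bx d n|%:R * c) ^+ 2 + #|` bx d n|%:R * (#|` bx d (K.+1 + K.+1)|%:R * M ^+ 2))%:E)%E.
Proof.
pose gg xy t := g (shift xy.1 t) * g (shift xy.2 t).
have mgx x : measurable_fun setT (fun t => g (shift x t)).
  by apply: measurableT_comp; [exact: mg|exact: measurable_shift_joint].
have mgg xy : measurable_fun setT (gg xy) by exact: measurable_funM.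
pose bb := [seq (x, y) | x <- bx d n, y <- bx d n].
have E t : bsum shift g n t ^+ 2 = \sum_(xy <- bb) gg xy t.
  rewrite expr2 /bsum mulr_suml /bb big_allpairs_dep/=.
  by apply: eq_bigr => x _; rewrite mulr_sumr.
under eq_integral do rewrite E -sumEFin.
rewrite ge0_integral_sum//; last 2 first.
- by move=> xy; exact/measurable_EFinP.
- by move=> xy t _; rewrite lee_fin mulr_ge0.
pose close (xy : Zd d * Zd d) := xy.1 \in zball xy.2 (K.+1 + K.+1).
have B xy : (\int[Pj]_t (gg xy t)%:E <= (c ^+ 2 + (close xy)%:R * M ^+ 2)%:E)%E.
  have [nxy|fxy] := boolP (close xy); last first.
    rewrite mul0r addr0 /gg (integral_fld2 p01 hmu iidP)//.
      by rewrite cE -EFinM -expr2.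
    by move=> h; move/negP: fxy; apply; apply/in_zballP.
  rewrite mul1r; apply: (@le_trans _ _ (\int[Pj]_t (M ^+ 2)%:E)%E).
    apply: ge0_le_integral => //.
    - by move=> t _; rewrite lee_fin mulr_ge0.
    - exact/measurable_EFinP.
    - by move=> t _; rewrite lee_fin expr2 ler_pM// fld_le.
  by rewrite integral_prob_cst lee_fin lerDr sqr_ge0.
apply: (le_trans (lee_sum _ (fun xy _ => B xy))).
rewrite sumEFin lee_fin /bb big_allpairs_dep/= exchange_big/=.
have -> : (#|` bx d n|%:R * c) ^+ 2 + #|` bx d n|%:R * (#|` bx d (K.+1 + K.+1)|%:R * M ^+ 2) =
  \sum_(y <- bx d n) (#|` bx d n|%:R * c ^+ 2 + #|` bx d (K.+1 + K.+1)|%:R * M ^+ 2).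
  by rewrite big_const_seq count_predT iter_addr_0 -[RHS]mulr_natl; ring.
apply: ler_sum => y _; rewrite big_split/=; apply: lerD.
  by rewrite big_const_seq count_predT iter_addr_0 -[leLHS]mulr_natl.
rewrite -mulr_suml ler_wpM2r ?sqr_ge0// /close/=.
rewrite -(card_zball y) -natr_sum ler_nat.
rewrite (eq_bigr (fun x => if x \in zball y (K.+1 + K.+1) then 1%N else 0%N)); last first.
  by move=> x _; case: (_ \in _).
rewrite -big_mkcond/= sum1_count -size_filter; apply: uniq_leq_size.
  by rewrite filter_uniq// fset_uniq.
by move=> x; rewrite mem_filter => /andP[].
Qed.

Lemma bavg_fld_L1 (del : R) : 0 < del -> exists n,
  (\int[Pj]_t `|bavg shift g n t - c|%:E <= del%:E)%E.
Proof.
move=> del0; pose e := del / 2; have e0 : 0 < e by rewrite divr_gt0.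
pose V := #|` bx d (K.+1 + K.+1)|%:R * M ^+ 2; have V0 : 0 <= V by rewrite mulr_ge0// sqr_ge0.
pose n := (Num.truncn (V / e ^+ 2)).+1; exists n.
have Vn : V / #|` bx d n|%:R <= e ^+ 2.
  rewrite ler_pdivrMr ?card_bx_gt0// mulrC -ler_pdivrMr ?exprn_gt0//.
  apply: (@le_trans _ _ n%:R); first by rewrite ltW// truncnS_gt.
  by rewrite ler_nat card_bx_ge.
have B0 : 0 < #|` bx d n|%:R :> R by exact: card_bx_gt0.
set u := bavg shift g n.
have u0 t : 0 <= u t by rewrite mulr_ge0 ?invr_ge0// sumr_ge0.
have mu_ : measurable_fun setT u.
  apply: measurable_bavg => //; exact: measurable_shift_joint.
have c0 : 0 <= c by rewrite mulr_ge0// fine_ge0// integral_ge0// => r _; rewrite lee_fin.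
have Eu : (\int[Pj]_t (u t)%:E = c%:E)%E.
  rewrite /u /bavg; under eq_integral do rewrite EFinM.
  rewrite ge0_integralZl_EFin ?invr_ge0//; last 2 first.
  - by move=> t _; rewrite lee_fin sumr_ge0.
  - apply/measurable_EFinP; apply: measurable_bsum => //; exact: measurable_shift_joint.
  rewrite integral_bsum//; last 2 first.
  - exact: measurable_shift_joint.
  - by move=> v A; exact: (Pj_shift hmu iidP).
  rewrite muleA -EFinM mulVf ?gt_eqF// mul1e /g (integral_fld mu iidP)//.
  exact: measurable_ball_event.
have Eu2 : (\int[Pj]_t (u t ^+ 2)%:E <= (c ^+ 2 + e ^+ 2)%:E)%E.
  have u2 t : u t ^+ 2 = (#|` bx d n|%:R ^- 2) * bsum shift g n t ^+ 2.
    by rewrite /u /bavg exprMn exprVn.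
  under eq_integral do rewrite u2 EFinM.
  rewrite ge0_integralZl_EFin//; last 2 first.
  - by move=> t _; rewrite lee_fin sqr_ge0.
  - apply/measurable_EFinP; apply: measurable_funX; apply: measurable_bsum => //.
    exact: measurable_shift_joint.
  apply: (@le_trans _ _ ((#|` bx d n|%:R ^- 2)%:E *
     ((#|` bx d n|%:R * c) ^+ 2 + #|` bx d n|%:R * V)%:E)%E).
    by apply: lee_wpmul2l; [rewrite lee_fin invr_ge0 exprn_ge0|exact: second_moment].
  rewrite -EFinM lee_fin.
  have -> : #|` bx d n|%:R ^- 2 * ((#|` bx d n|%:R * c) ^+ 2 + #|` bx d n|%:R * V) =
     c ^+ 2 + V / #|` bx d n|%:R by field; rewrite gt_eqF.
  by rewrite lerD2l.
(* This is e a <= e^2 + a^2 integrated, with a = |u - c| and the term 2 c u moved to the left so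
   that only nonnegative functions are integrated. The moments of [u] then bound e times the
   integral of a by 2 e^2 = e del. *)
have key : ((e%:E * \int[Pj]_t `|u t - c|%:E) + (2 * c)%:E * \int[Pj]_t (u t)%:E <=
   (e ^+ 2 + c ^+ 2)%:E + \int[Pj]_t (u t ^+ 2)%:E)%E.
  have mabs : measurable_fun setT (fun t => `|u t - c|).
    by apply: measurableT_comp => //; exact: measurable_funB.
  have e0' := ltW e0; have c2 : 0 <= 2 * c by rewrite mulr_ge0.
  rewrite -ge0_integralZl_EFin//; last exact/measurable_EFinP.
  rewrite -ge0_integralZl_EFin//; [|by move=> t _; rewrite lee_fin|exact/measurable_EFinP].
  have -> : ((e ^+ 2 + c ^+ 2)%:E = \int[Pj]_t (e ^+ 2 + c ^+ 2)%:E)%E.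
    by rewrite integral_prob_cst.
  rewrite -ge0_integralD//; last 4 first.
  - by move=> t _; rewrite mule_ge0// lee_fin.
  - by apply/measurable_EFinP; exact: measurable_funM.
  - by move=> t _; rewrite mule_ge0// lee_fin.
  - by apply/measurable_EFinP; exact: measurable_funM.
  rewrite -ge0_integralD//; last 3 first.
  - by move=> t _; rewrite lee_fin addr_ge0// sqr_ge0.
  - by move=> t _; rewrite lee_fin sqr_ge0.
  - by apply/measurable_EFinP; exact: measurable_funX.
  apply: ge0_le_integral => //.
  - by move=> t _; rewrite -!EFinM -EFinD lee_fin addr_ge0// mulr_ge0.
  - apply/measurable_EFinP; apply: measurable_funD; exact: measurable_funM.
  - apply/measurable_EFinP; apply: measurable_funD => //; exact: measurable_funX.
  - move=> t _; rewrite -!EFinM -!EFinD lee_fin.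
    have h : `|u t - c| ^+ 2 = (u t - c) ^+ 2 by rewrite real_normK ?num_real.
    have := normr_ge0 (u t - c); move: h; set a := `|u t - c|; move: (u t) => b h a0.
    have : 0 <= (e - a) ^+ 2 by exact: sqr_ge0.
    have : 0 <= e * a by exact: mulr_ge0.
    nra.
have {}key := le_trans key (leeD (lexx _) Eu2).
rewrite Eu -EFinM -EFinD in key.
rewrite -(@lee_pmul2l _ e%:E)// -(@leeD2rE _ (2 * c * c)%:E)//.
apply: (le_trans key); rewrite -EFinM -EFinD lee_fin /e.
have -> : del = 2 * (del / 2) by field.
by rewrite -/e; nra.
Qed.

End bounded_fld.

Definition fin_event : set (subgraph_space d) := [set G | ~ inf_cluster G 0].

Lemma measurable_fin_event : measurable fin_event.
Proof. by apply: measurableC; exact: measurable_inf_cluster. Qed.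

Lemma ball_event_fin K : ball_event K `<=` fin_event.
Proof. by move=> G; exact: not_inf_in_ball. Qed.

Lemma cvg_ball_event : fine (mu (ball_event K)) @[K --> \oo] --> fine (mu fin_event).
Proof.
have fE : \bigcup_K ball_event K = fin_event.
  apply/seteqP; split => G; first by move=> [K _]; exact: ball_event_fin.
  by move=> /finite_clusterP[n nG]; exists n.
apply: fine_cvg; rewrite fineK; last first.
  by apply: fin_num_measure; exact: measurable_fin_event.
rewrite -fE; apply: nondecreasing_cvg_mu.
- exact: measurable_ball_event.
- by rewrite fE; exact: measurable_fin_event.
- move=> K L KL; apply/subsetPset => G /= h y /h; exact: box_le.
Qed.

Section integrable_fld.
Variables (phi : R -> R).
Hypotheses (mphi : measurable_fun setT phi) (phi0 : forall r, 0 <= phi r).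
Hypothesis phi_fin : (\int[nu]_r (phi r)%:E < +oo)%E.

Let phiK K r := Num.min (phi r) K%:R.

Let mphiK K : measurable_fun setT (phiK K).
Proof. exact: measurable_minr. Qed.

Let phiK0 K r : 0 <= phiK K r.
Proof. by rewrite /phiK le_min phi0 ler0n. Qed.

Let phiK_le K r : phiK K r <= phi r.
Proof. by rewrite /phiK ge_min lexx. Qed.

Let phiK_leK K r : phiK K r <= K%:R.
Proof. by rewrite /phiK ge_min lexx orbT. Qed.

Let int_fin : (\int[nu]_r (phi r)%:E)%E \is a fin_num.
Proof. by rewrite ge0_fin_numE// integral_ge0// => r _; rewrite lee_fin. Qed.

Let int_leK K : (\int[nu]_r (phiK K r)%:E <= \int[nu]_r (phi r)%:E)%E.
Proof.
apply: ge0_le_integral => //.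
- by move=> r _; rewrite lee_fin.
- by apply/measurable_EFinP; exact: mphiK.
- exact/measurable_EFinP.
- by move=> r _; rewrite lee_fin.
Qed.

Let intK_fin K : (\int[nu]_r (phiK K r)%:E)%E \is a fin_num.
Proof.
rewrite ge0_fin_numE ?integral_ge0//; first by apply: le_lt_trans phi_fin.
by move=> r _; rewrite lee_fin.
Qed.

Lemma cvg_int_trunc : fine (\int[nu]_r (phiK K r)%:E)%E @[K --> \oo] -->
  fine (\int[nu]_r (phi r)%:E)%E.
Proof.
apply: fine_cvg; rewrite fineK//.
have limE r : limn (fun K => (phiK K r)%:E) = (phi r)%:E.
  apply/cvg_lim => //; apply: cvg_near_cst.
  exists (Num.truncn (phi r)).+1 => // K /= rK; rewrite /phiK min_l//.
  apply: (@le_trans _ _ (Num.truncn (phi r)).+1%:R); last by rewrite ler_nat.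
  by rewrite ltW// truncnS_gt.
rewrite (_ : (fun r => (phi r)%:E) = (fun r => limn (fun K => (phiK K r)%:E))); last first.
  by apply/funext => r; rewrite limE.
apply: cvg_monotone_convergence => //.
- by move=> n; apply/measurable_EFinP; exact: mphiK.
- by move=> n r _; rewrite lee_fin.
- move=> r _ m n mn; rewrite lee_fin /phiK le_min ge_min lexx/=.
  by rewrite ge_min ler_nat mn orbT.
Qed.

Let c := fine (mu fin_event) * fine (\int[nu]_r (phi r)%:E)%E.
Let cK K := fine (mu (ball_event K)) * fine (\int[nu]_r (phiK K r)%:E)%E.

(** One integer [K] bounds both the size of the clusters kept and the truncation of [phi]. The
    approximation lies below the field, so their L^1 distance is the difference of the means, which
    tends to 0 under a first moment alone. *)
Lemma joint_lln : {ae Pj, forall t,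
  bavg shift (fld fin_event phi) n t @[n --> \oo] --> c}.
Proof.
pose f := fld fin_event phi.
have mf : measurable_fun setT f by apply: measurable_fld => //; exact: measurable_fin_event.
apply: ergodic_theorem => //.
- exact: measurable_shift_joint.
- by move=> v A; exact: (Pj_shift hmu iidP).
- exact: shift_jointD.
move=> eps eps0.
have [K cKc] : exists K, `|c - cK K| <= eps / 2.
  have : cK K @[K --> \oo] --> c.
    by apply: cvgM; [exact: cvg_ball_event|exact: cvg_int_trunc].
  move=> /cvgrPdist_le/(_ _ (divr_gt0 eps0 (ltr0n _ 2)))[N _ h].
  by exists N; apply: h => /=.
pose g := fld (ball_event K) (phiK K).
have mb := @measurable_ball_event d K.
have mg : measurable_fun setT g by exact: measurable_fld.
have gf t : g t <= f t.
  rewrite /g /f /fld; apply: ler_pM => //; rewrite !indicE//.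
  case: (boolP (t.1 \in ball_event K)) => [/set_mem h|_]; last exact: ler0n.
  by rewrite mem_set//; exact: ball_event_fin h.
have g0 t : 0 <= g t by apply: fld_ge0; exact: phiK0.
have intf : (\int[Pj]_t (f t)%:E = c%:E)%E.
  rewrite (integral_fld mu iidP)//; last exact: measurable_fin_event.
  by rewrite EFinM !fineK// fin_num_measure//; exact: measurable_fin_event.
have intg : (\int[Pj]_t (g t)%:E = (cK K)%:E)%E.
  by rewrite (integral_fld mu iidP)// EFinM !fineK// fin_num_measure.
exists g; split => //.
- exists K%:R => t; rewrite ger0_norm//; exact: fld_le.
- have : (\int[Pj]_t `|f t - g t|%:E + (cK K)%:E = c%:E)%E.
    rewrite -intg -intf -ge0_integralD//; last 3 first.
    + apply/measurable_EFinP; apply: measurableT_comp => //; exact: measurable_funB.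
    + by move=> t _; rewrite lee_fin.
    + exact/measurable_EFinP.
    apply: eq_integral => t _; rewrite -EFinD ger0_norm ?subr_ge0//.
    by rewrite subrK.
  move=> E; rewrite -(@leeD2rE _ (cK K)%:E)// E -EFinD lee_fin.
  have := ler_norm (c - cK K); lra.
- have e2 : 0 < eps / 2 by rewrite divr_gt0.
  have [n hn] := bavg_fld_L1 K (mphiK K) (phiK0 K) (phiK_leK K) e2.
  exists n; apply: (@le_trans _ _ (\int[Pj]_t (`|bavg shift g n t - cK K| + `|c - cK K|)%:E)%E).
    have mu1 : measurable_fun setT (bavg shift g n).
      by apply: measurable_bavg => //; exact: measurable_shift_joint.
    apply: ge0_le_integral => //.
    + apply/measurable_EFinP; apply: measurableT_comp => //; exact: measurable_funB.
    + apply/measurable_EFinP; apply: measurable_funD => //; apply: measurableT_comp => //.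
      exact: measurable_funB.
    + move=> t _; rewrite lee_fin.
      have -> : bavg shift g n t - c = (bavg shift g n t - cK K) - (c - cK K) by ring.
      exact: ler_normB.
  under eq_integral do rewrite EFinD.
  rewrite ge0_integralD//; last first.
    apply/measurable_EFinP; apply: measurableT_comp => //; apply: measurable_funB => //.
    by apply: measurable_bavg => //; exact: measurable_shift_joint.
  rewrite integral_prob_cst (_ : eps = eps / 2 + eps / 2); last by field.
  by rewrite EFinD; apply: leeD.
Qed.

End integrable_fld.
End joint_lln.

(** * From i.i.d. colors to the color measure *)

Section coloring_transfer.
Context (R : realType) (d : nat).
Implicit Types (G : subgraph d) (x y : Zd d) (J : {fset Zd d}).

Lemma measurable_X x :
  measurable_fun setT (X x : coloring_space d R -> measurableTypeR R).
Proof.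
apply: (measurability _ (RGenOpens.measurableE R)) => _ [_ [a [b ->]] <-].
rewrite setTI; apply: sub_sigma_algebra.
apply: open_comp; last exact: interval_open.
by move=> w _; exact: (@proj_continuous _ (fun=> R) x).
Qed.

Lemma ae_section dd1 dd2 (T1 : measurableType dd1) (T2 : measurableType dd2)
    (P1 : probability T1 R) (P2 : probability T2 R) (Q : T1 * T2 -> Prop) :
  {ae (P1 \x P2)%E, forall t, Q t} -> {ae P1, forall s, {ae P2, forall u, Q (s, u)}}.
Proof.
move=> [A [mA A0 QA]].
have : ae_eq P1 setT (fun s => P2 (xsection A s)) (cst 0%E).
  apply/ae_eq_integral_abs => //; first exact: measurable_fun_xsection.
  by rewrite -[RHS]A0 /product_measure1; apply: eq_integral => s _; rewrite gee0_abs.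
apply: filterS => s /(_ I) Ax0; exists (xsection A s); split => //.
  exact: measurable_xsection.
by move=> u nQ; rewrite /xsection/= inE; exact: QA.
Qed.

(* Whether [iota] is injective or not, the variables [w (iota i)] are functions
   of independent variables indexed by the image of [iota]. *)
Lemma rect_comp (nu : probability (measurableTypeR R) R) (Q : set (Zd d -> R) -> \bar R)
    (S : set (Zd d)) (iota : Zd d -> Zd d) J (B : Zd d -> set (measurableTypeR R)) :
  (forall J' B', [set` J'] `<=` S -> (forall i, measurable (B' i)) ->
    Q [set w | forall i, i \in J' -> B' i (w i)] = (\prod_(i <- J') nu (B' i))%E) ->
  (forall i, i \in J -> S (iota i)) -> (forall i, measurable (B i)) ->
  Q [set w | forall i, i \in J -> B i (w (iota i))] =
  (\prod_(r <- [fset iota i | i in J]%fset)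
     nu [set a | forall i, i \in J -> iota i = r -> B i a])%E.
Proof.
move=> QE JS mB.
pose B' r := [set a | forall i, i \in J -> iota i = r -> B i a] : set (measurableTypeR R).
rewrite -(QE _ B'); last 2 first.
- by move=> r /imfsetP[i /= iJ ->]; exact: JS.
- move=> r; rewrite (_ : B' r = \bigcap_(i in [set` J]) (if iota i == r then B i else setT)).
    apply: fin_bigcap_measurable; first exact: finite_fset.
    by move=> i _; case: ifP => _; [exact: mB|exact: measurableT].
  apply/seteqP; split => a /= h i iJ; first by case: eqP => // /(h i iJ).
  by move=> ir; have := h i iJ; rewrite ir eqxx.
congr (Q _); apply/seteqP; split => w /=.
  by move=> h r _ i iJ ir; rewrite -ir; exact: h.
by move=> h i iJ; apply: (h (iota i)) => //; apply/imfsetP; exists i.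
Qed.

Section fixed_graph.
Context (nu : probability (measurableTypeR R) R) (G : subgraph d).
Context (P : probability (coloring_space d R) R).
Hypothesis hP : color_measure G nu P.

Definition roots : set (Zd d) := [set r | exists2 x, ~ inf_cluster G x & r = root G x].

(** Distinct roots lie in distinct clusters, and there the color measure makes the colors
    independent with law [nu]. *)
Lemma color_roots J (B : Zd d -> set (measurableTypeR R)) :
  [set` J] `<=` roots -> (forall i, measurable (B i)) ->
  P [set w | forall i, i \in J -> B i (w i)] = (\prod_(i <- J) nu (B i))%E.
Proof.
move=> JS mB; have [hlaw hind _] := hP.
have ind : independent_vars_on P roots (@X d R).
  apply: hind => r s [x fx ->] [y fy ->] rs; rewrite !cluster_ofE => cE; apply: rs.
  have [xr _] := rootP fx; have [ys _] := rootP fy.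
  apply/esym/root_conn => //.
  by rewrite (conn_eq xr) cE -(conn_eq ys); exact: conn_refl.
rewrite (_ : [set w | _] = \bigcap_(i in [set` J]) (X i @^-1` B i)).
  by rewrite ind//; apply: eq_bigr => i _; exact: hlaw.
by apply/seteqP; split.
Qed.

(* Under i.i.d. colors and under the color measure of [G], [spread] has the same
   law; the infinite clusters receive the junk color 0. *)
Definition spread (w : Zd d -> R) : Zd d -> R :=
  fun x => if `[< inf_cluster G x >] then 0 else w (root G x).

Lemma measurable_spread dd (T : measurableType dd) (h : T -> Zd d -> R) :
  (forall x, measurable_fun setT (fun t => h t x : measurableTypeR R)) ->
  measurable_fun setT (fun t => spread (h t) : cspace R d).
Proof.
move=> mh; apply: measurable_fun_gsigma => _ [x [B [mB ->]]].
have [ix|fx] := pselect (inf_cluster G x).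
  rewrite (_ : _ @^-1` _ = [set _ | B 0]); first exact: measurable_prop.
  by apply/seteqP; split => t /=; rewrite /spread asboolT.
rewrite (_ : _ @^-1` _ = (fun t => h t (root G x)) @^-1` B).
  exact: (measurable_preimage (mh _) mB).
by apply/seteqP; split => t /=; rewrite /spread asboolF.
Qed.

(** [Q1] and [Q2] are bare set functions because the two measures to be compared live on different
    sigma-algebras over the same set of colorings. *)
Lemma spread_rect (Q1 Q2 : set (Zd d -> R) -> \bar R) J (B : Zd d -> set (measurableTypeR R)) :
  Q1 set0 = 0%E -> Q2 set0 = 0%E ->
  (forall J B, [set` J] `<=` roots -> (forall i, measurable (B i)) ->
    Q1 [set w | forall i, i \in J -> B i (w i)] = (\prod_(i <- J) nu (B i))%E) ->
  (forall J B, [set` J] `<=` roots -> (forall i, measurable (B i)) ->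
    Q2 [set w | forall i, i \in J -> B i (w i)] = (\prod_(i <- J) nu (B i))%E) ->
  (forall i, measurable (B i)) ->
  Q1 (spread @^-1` rect J B) = Q2 (spread @^-1` rect J B).
Proof.
move=> Q10 Q20 Q1E Q2E mB.
(* On infinite clusters [spread] is constantly 0: either this violates a constraint of the rectangle
   and the preimage is empty, or these sites impose nothing. *)
have [bad|good] := pselect (exists i, [/\ i \in J, inf_cluster G i & ~ B i 0]).
  rewrite (_ : spread @^-1` rect J B = set0) ?Q10 ?Q20//.
  apply/seteqP; split => // w; have [i [iJ ii nB]] := bad.
  by move=> /(_ i iJ); rewrite /spread asboolT.
pose Jf := [fset i in J | `[< ~ inf_cluster G i >]]%fset.
have -> : spread @^-1` rect J B = [set w | forall i, i \in Jf -> B i (w (root G i))].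
  apply/seteqP; split => w /= h i; have := h i; rewrite /spread.
    by move=> {}h; rewrite !inE/= => /andP[iJ /asboolP fi]; have := h iJ; rewrite asboolF.
  move=> {}h iJ; case: asboolP => [ii|fi].
    by apply: contrapT => nB; apply: good; exists i.
  by apply: h; rewrite !inE/= iJ; exact/asboolP.
have JfS i : i \in Jf -> roots (root G i).
  by rewrite !inE/= => /andP[_ /asboolP fi]; exists i.
by rewrite (rect_comp Q1E JfS mB) (rect_comp Q2E JfS mB).
Qed.

End fixed_graph.
End coloring_transfer.

Lemma cvg_harmonicP (R : realType) (u : nat -> R) (c : R) :
  (u n @[n --> \oo] --> c) <->
  forall k, exists N, forall n, (N <= n)%N -> `|u n - c| <= k.+1%:R^-1.
Proof.
split=> [/cvgrPdist_le uc k|h].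
  have [|N _ hN] := uc k.+1%:R^-1; first by rewrite invr_gt0.
  by exists N => n Nn; rewrite distrC; exact: hN.
apply/cvgrPdist_le => e e0; have [N hN] := h (Num.truncn e^-1).
exists N => // n /= /hN h'; rewrite distrC; apply: (le_trans h').
by rewrite invf_ple ?posrE// ltW// truncnS_gt.
Qed.

Lemma measurable_cvg dd (T : measurableType dd) (R : realType) (h : nat -> T -> R) (c : R) :
  (forall n, measurable_fun setT (h n)) ->
  measurable [set t | h n t @[n --> \oo] --> c].
Proof.
move=> mh; rewrite (_ : [set t | _] = [set t | forall k, exists N, forall n,
    (N <= n)%N -> `|h n t - c| <= k.+1%:R^-1]); last first.
  by apply/seteqP; split => t /cvg_harmonicP.
apply: (@measurable_forall _ _ _ (fun k => [set t | exists N, forall n,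
  (N <= n)%N -> `|h n t - c| <= k.+1%:R^-1])) => k.
apply: (@measurable_exists _ _ _ (fun N => [set t | forall n,
  (N <= n)%N -> `|h n t - c| <= k.+1%:R^-1])) => N.
apply: (@measurable_forall _ _ _ (fun n => [set t |
  (N <= n)%N -> `|h n t - c| <= k.+1%:R^-1])) => n.
case: (leqP N n) => Nn; last first.
  by rewrite (_ : [set t | _] = setT)//; apply/seteqP; split.
rewrite (_ : [set t | _] = [set: T] `&` [set t | `|h n t - c| <= cst k.+1%:R^-1 t]).
  apply: measurable_fun_le => //; apply: measurableT_comp => //.
  exact: measurable_funB.
by rewrite setTI; apply/seteqP; split => t /=; [apply|].
Qed.

Section color_lln.
Context (R : realType) (d : nat).
Implicit Types (G : subgraph d) (x y : Zd d).

(** The choice [phi] = 1 gives the proportion of the vertices lying in finite clusters, whatever the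
    coloring. *)
Definition fin_avg G (phi : R -> R) n (u : Zd d -> R) : R :=
  #|` bx d n|%:R^-1 * \sum_(x <- bx d n) (if `[< inf_cluster G x >] then 0 else phi (u x)).

Lemma measurable_fin_avg G phi n : measurable_fun setT phi ->
  measurable_fun setT (fin_avg G phi n : cspace R d -> R).
Proof.
move=> mphi; apply: measurable_funM => //; apply: measurable_sum => x.
case: asboolP => _ //; apply: measurableT_comp => //; exact: measurable_coord.
Qed.

Lemma fin_avg_spread G phi n w : fin_avg G phi n (spread G w) =
  bavg (@shift_joint R d) (fld (@fin_event d) phi) n (G, w).
Proof.
rewrite /fin_avg /bavg /bsum; congr (_ * _); apply: eq_bigr => x _.
rewrite fld_shift indicE; case: asboolP => ix.
  rewrite memNset ?mul0r// => -[]; apply/(iffRL (inf_cluster_shift _ _ _)).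
  by rewrite add0r.
rewrite mem_set; last by move=> /(iffLR (inf_cluster_shift _ _ _)); rewrite add0r.
by rewrite mul1r /spread asboolF// root_shift add0r.
Qed.

Section percolation.
Context (p : R) (mu : probability (subgraph_space d) R).
Hypotheses (d_gt0 : (0 < d)%N) (p01 : 0 < p < 1) (hmu : bond_percolation p mu).

Lemma ae_fin_avg (nu : probability (measurableTypeR R) R) (P0 : probability (cspace R d) R)
    (phi : R -> R) :
  iid nu P0 -> measurable_fun setT phi -> (forall r, 0 <= phi r) ->
  (\int[nu]_r (phi r)%:E < +oo)%E ->
  {ae mu, forall G : subgraph_space d, {ae P0, forall w,
    fin_avg G phi n (spread G w) @[n --> \oo] -->
    fine (mu (@fin_event d)) * fine (\int[nu]_r (phi r)%:E)%E}}.
Proof.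
move=> iidP mphi phi0 phi_fin.
have := ae_section (joint_lln d_gt0 p01 hmu iidP mphi phi0 phi_fin).
apply: filterS => G; apply: filterS => w.
by under [X in _ -> X @ _ --> _]eq_fun do rewrite fin_avg_spread.
Qed.

Section fixed_graph.
Context (nu : probability (measurableTypeR R) R) (P0 : probability (cspace R d) R).
Hypothesis iidP : iid nu P0.
Context (G : subgraph d) (P : probability (coloring_space d R) R).
Hypothesis hP : color_measure G nu P.

Lemma ae_color_conn x : {ae P, forall w, forall y, conn G x y -> X x w = X y w}.
Proof.
have [_ _ h] := hP; have := h _ (@connected_cluster d G x).
apply: filterS => w hw y xy; apply: hw; rewrite cluster_ofE//; exact: conn_refl.
Qed.

Lemma ae_color_const : {ae P, forall w, forall x y, conn G x y -> X x w = X y w}.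
Proof.
have : P.-negligible [set w | exists x, ~ (forall y, conn G x y -> X x w = X y w)].
  by apply: negligible_exists => x; exact: ae_color_conn.
by apply: negligibleS => w /= /existsNP[x nx]; exists x.
Qed.

(** [spread G] has the same law under [P0] and under [P], since the colors of the roots are i.i.d.
    under both. Under [P] a coloring is almost surely constant on each cluster, hence agrees with
    its [spread] on the finite ones. *)
Lemma fin_avg_transfer (phi : R -> R) (c : R) : measurable_fun setT phi ->
  {ae P0, forall w, fin_avg G phi n (spread G w) @[n --> \oo] --> c} ->
  {ae P, forall w : coloring_space d R, fin_avg G phi n w @[n --> \oo] --> c}.
Proof.
move=> mphi h0; pose C : set (cspace R d) := [set u | fin_avg G phi n u @[n --> \oo] --> c].
have mC : measurable C by apply: measurable_cvg => n; exact: measurable_fin_avg.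
pose s0 (w : cspace R d) : cspace R d := spread G w.
pose s1 (w : coloring_space d R) : cspace R d := spread G w.
have ms0 : measurable_fun setT s0.
  by apply: measurable_spread => x; exact: measurable_coord.
have ms1 : measurable_fun setT s1.
  by apply: measurable_spread => x; exact: measurable_X.
have eqP A : measurable A -> P (s1 @^-1` A) = P0 (s0 @^-1` A).
  apply: (@eq_measure_rect R d (image_prob P ms1) (image_prob P0 ms0)).
    by rewrite -ge0_fin_numE ?measure_ge0// fin_num_measure.
  move=> J B mB; apply: (@spread_rect _ _ nu G P P0) => //.
  - by move=> J' B' J'S mB'; exact: (color_roots hP).
  - by move=> J' B' _ mB'; exact: iidP.
have mCC : measurable (~` C) by exact: measurableC.
have P_0 : P (s1 @^-1` (~` C)) = 0%E.
  rewrite (eqP _ mCC); apply: measure_negligible; last exact: h0.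
  exact: (measurable_preimage ms0 mCC).
have hs : {ae P, forall w : coloring_space d R, C (s1 w)}.
  exists (s1 @^-1` (~` C)); split => //.
  exact: (measurable_preimage ms1 mCC).
apply: filterS2 hs ae_color_const => w Cw wc.
have E n : fin_avg G phi n w = fin_avg G phi n (spread G w).
  rewrite /fin_avg; congr (_ * _); apply: eq_bigr => x _; rewrite /spread.
  case: asboolP => // fx; congr phi; have [xr _] := rootP fx.
  exact: (wc _ _ xr).
by under eq_fun do rewrite E.
Qed.

End fixed_graph.
End percolation.
End color_lln.

(** * Existence of an i.i.d. family *)

Section existence_of_iid.
Context (R : realType) (d : nat).
Implicit Types (G : subgraph d) (x y : Zd d).

(** For a Dirac mass, a constant coloring is an i.i.d. family. The limit theorem can thus be applied
    before any other family is known to exist, which yields the density of the finite clusters. *)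
Lemma iid_dirac :
  iid (@dirac _ (measurableTypeR R) 0 R) (@dirac _ (cspace R d) (fun=> 0) R).
Proof.
move=> J B mB; rewrite (eq_bigr (fun i => ((0%R \in B i)%:R)%:E)); last first.
  by move=> i _; exact: diracE.
have -> : (\prod_(i <- J) ((0%R \in B i)%:R)%:E)%E =
    ((all (fun i => 0%R \in B i) J)%:R)%:E :> \bar R.
  elim: (enum_fset J) => [|i s IH]; first by rewrite big_nil.
  by rewrite big_cons IH -EFinM /=; case: (_ \in _); rewrite ?mul1r ?mul0r.
transitivity (((((fun=> 0) : cspace R d) \in rect J B)%:R)%:E : \bar R); first exact: diracE.
congr (_%:R)%:E; congr nat_of_bool; apply/idP/allP => [/set_mem h i iJ|h].
  by apply/mem_set; exact: h.
by apply/mem_set => i iJ; apply/set_mem; exact: h.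
Qed.

Lemma ae_ex dd (T : measurableType dd) (P : probability T R) (Q : T -> Prop) :
  {ae P, forall t, Q t} -> exists t, Q t.
Proof.
move=> aeQ; apply: contrapT => nQ.
have : P.-negligible setT by apply: negligibleS aeQ => t _ /= Qt; apply: nQ; exists t.
move=> /(measure_negligible measurableT) PT.
have : (1 = 0 :> \bar R)%E by rewrite -PT; apply/esym/probability_setT.
by move=> /eqP; rewrite eqe oner_eq0.
Qed.

Section percolation.
Context (p : R) (mu : probability (subgraph_space d) R).
Hypotheses (d_gt0 : (0 < d)%N) (p01 : 0 < p < 1) (hmu : bond_percolation p mu).

Lemma null_close_edges (l : seq (edge d)) (A : set (subgraph_space d)) :
  measurable A -> mu A = 0%E ->
  mu [set G | A (foldr (@close_edge (edge d)) G l)] = 0%E.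
Proof.
elim: l A => [//|e l IH] A mA A0 /=.
have := IH _ (measurable_preimage (measurable_close_edge e) mA) (null_close_edge p01 hmu e mA A0).
by [].
Qed.

(** Finite energy again: closing the finitely many edges near the origin isolates it, so the
    corresponding preimage of the event is the whole space. *)
Lemma mu_fin_event_neq0 : mu (@fin_event d) != 0%E.
Proof.
apply/eqP => /(null_close_edges (near_edges 0 0) (@measurable_fin_event d)).
rewrite (_ : [set G | _] = setT).
  move=> PT; have : (1 = 0 :> \bar R)%E by rewrite -PT; apply/esym/probability_setT.
  by move=> /eqP; rewrite eqe oner_eq0.
apply/seteqP; split => // G _ /=; apply: (@not_inf_in_ball d 0).
set H := foldr _ _ _.
have nH e : e \in near_edges 0 (0 : Zd d) -> ~ H e.
  rewrite /H; elim: (near_edges _ _) => //= e' l IH; rewrite inE.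
  have [->|ne /= el] := eqVneq e e'; first by rewrite close_edgeE => _ [].
  by rewrite close_edge_neq//; exact: IH.
move=> y; elim=> [_ ->|{}y e z _ IH He ey ez]; first by rewrite subrr; exact: box0.
exfalso; apply: (nH e) => //; apply/in_near_edges => w ew /=.
by have := box_add IH (ends_box ew ey); rewrite addrC subrKA.
Qed.

End percolation.

(** Finitely many roots would leave finitely many vertices in finite clusters, a set of density
    zero. *)
Lemma infinite_roots G (q : R) : (0 < d)%N -> q != 0 ->
  (fin_avg G (fun=> 1) n (fun=> 0) @[n --> \oo] --> q) -> infinite_set (roots G).
Proof.
move=> d_gt0 q0 Gq fr; move/eqP: q0; apply.
suff : finite_set [set x | ~ inf_cluster G x].
  move=> /finite_fsetP[F FE].
  apply: (cvg_unique _ Gq) => //; apply/cvg_harmonicP => k.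
  exists (k.+1 * #|` F|)%N => n kn; rewrite subr0 /fin_avg.
  have s0 : 0 <= \sum_(x <- bx d n) (if `[< inf_cluster G x >] then 0 else 1 : R).
    by apply: sumr_ge0 => x _; case: ifP.
  rewrite ger0_norm ?mulr_ge0 ?invr_ge0// mulrC ler_pdivrMr ?card_bx_gt0//.
  rewrite mulrC ler_pdivlMr ?ltr0n//.
  apply: (@le_trans _ _ (#|` F|%:R * k.+1%:R)).
    rewrite ler_wpM2r//.
    rewrite (eq_bigr (fun x => (if x \in F then 1 else 0)%N%:R)); last first.
      move=> x _; have -> : (x \in F) = ~~ `[< inf_cluster G x >].
        rewrite -asbool_neg; apply/idP/asboolP => [xF|fx].
          by have : [set` F] x by []; rewrite -FE.
        by have : [set x | ~ inf_cluster G x] x by []; rewrite FE.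
      by case: `[< _ >].
    rewrite -natr_sum ler_nat -big_mkcond/= sum1_count -size_filter.
    apply: uniq_leq_size; first by rewrite filter_uniq// fset_uniq.
    by move=> x; rewrite mem_filter => /andP[].
  rewrite -natrM ler_nat mulnC; apply: (leq_trans kn). exact: card_bx_ge.
apply: (@sub_finite_set _ _ (\bigcup_(r in roots G) conn G r)).
  move=> x fx; exists (root G x); first by exists x.
  by have [/reach_sym] := rootP fx.
apply: bigcup_finite => // r [x fx ->]; have [xr _] := rootP fx.
by rewrite -(conn_eq xr); apply: contrapT.
Qed.

Lemma iid_of_color_measure (nu : probability (measurableTypeR R) R) G
    (P : probability (coloring_space d R) R) :
  infinite_set (roots G) -> color_measure G nu P ->
  exists P0 : probability (cspace R d) R, iid nu P0.
Proof.
move=> /infiniteP/card_leP[f] hP.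
(* The sites are numbered by [pickle], and [f] injects the integers into the infinite set of
   roots. *)
pose iota x : Zd d := val (f (SigSub (mem_set (I : [set: nat] (choice.pickle x))))).
have iota_inj : injective iota.
  move=> x y /val_inj/(inj (f := f)) xy; apply: (pcan_inj choice.pickleK).
  by have [] := xy (mem_set I) (mem_set I).
have iotaS x : roots G (iota x) by exact: set_valP.
have mh : measurable_fun setT (fun w : coloring_space d R => (fun x => w (iota x)) : cspace R d).
  apply: measurable_fun_gsigma => _ [x [B [mB ->]]].
  exact: (measurable_preimage (@measurable_X R d (iota x)) mB).
exists (image_prob P mh) => J B mB; rewrite image_probE.
have := @rect_comp R d nu P (roots G) iota J B (color_roots hP) (fun i _ => iotaS i) mB.
move=> E; rewrite [LHS]E big_imfset/=; last by move=> x y _ _; exact: iota_inj.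
rewrite big_seq [RHS]big_seq; apply: eq_bigr => i iJ; congr (nu _).
apply/seteqP; split => a /=; first by apply.
by move=> Ba j _ /iota_inj ->.
Qed.

End existence_of_iid.

(** * Assembling the limit of the box averages *)

Section main.
Context (R : realType) (d : nat).
Implicit Types (G : subgraph d) (x y : Zd d).

Lemma avg_box_split G (w : coloring_space d R) (z : R) n :
  (0 < d)%N -> (forall x, inf_cluster G x -> X x w = z) ->
  #|` fset_set (box d n)|%:R^-1 * \sum_(x \in box d n) X x w =
  fin_avg G (fun r => Num.max r 0) n w - fin_avg G (fun r => Num.max (- r) 0) n w
    + (1 - fin_avg G (fun=> 1) n (fun=> 0)) * z.
Proof.
move=> d_gt0 hz; rewrite fsbig_finite/=; last exact: finite_box.
have b0 : (#|` bx d n|%:R : R) != 0 by rewrite gt_eqF// card_bx_gt0.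
have E1 : 1 - fin_avg G (fun=> 1) n (fun=> 0) =
    #|` bx d n|%:R^-1 * \sum_(x <- bx d n) (if `[< inf_cluster G x >] then 1 else 0) :> R.
  rewrite -[X in X - _](mulVf b0) /fin_avg.
  rewrite -mulrBr -sum1_size natr_sum -sumrB; congr (_ * _).
  by apply: eq_bigr => x _; case: ifP => _; rewrite ?subr0 ?subrr.
rewrite E1 /fin_avg -mulrA -mulrBr -mulrDr -sumrB mulr_suml -big_split/=.
congr (_ * _); apply: eq_bigr => x _; case: asboolP => [/hz ->|_].
  by rewrite subrr add0r mul1r.
rewrite mul0r addr0 /X.
by case: (lerP (w x) 0) => w0; [rewrite max_l|rewrite max_r]; lra.
Qed.

Lemma infinite_cluster_colorE G (w : coloring_space d R) x :
  ~ @two_inf_clusters d G -> (forall x y, conn G x y -> X x w = X y w) ->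
  inf_cluster G x -> X x w = infinite_cluster_color G w.
Proof.
move=> uG wc ix; rewrite /infinite_cluster_color; case: pselect => [[y iy]|[]]; last first.
  by exists x; rewrite /= inf_clusterE.
have := xgetPex 0 (ex_intro _ y iy); set z := xget _ _.
rewrite /= inf_clusterE => iz.
by apply: wc; apply: contrapT => nxz; apply: uG; exists x, z.
Qed.

Section percolation.
Context (p : R) (mu : probability (subgraph_space d) R).
Hypotheses (d_gt0 : (0 < d)%N) (p01 : 0 < p < 1) (hmu : bond_percolation p mu).

Lemma fin_eventE : fine (mu (@fin_event d)) =
  1 - fine (mu [set G : subgraph_space d | infinite_set (cluster_of G 0)]).
Proof.
pose F : set (subgraph_space d) := @fin_event d.
have mF : measurable F := @measurable_fin_event d.
have -> : [set G : subgraph_space d | infinite_set (cluster_of G 0)] = ~` F.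
  by apply/seteqP; split => G /=; rewrite inf_clusterE /F /fin_event /= notK.
by rewrite (probability_setC mu mF) fineB ?fin_num_measure//= subKr.
Qed.

(** The limit theorem for [phi] = 1 and Dirac colors: these averages depend on the graph alone, so
    convergence for one coloring, supplied by [ae_ex], is enough. *)
Lemma ae_density :
  {ae mu, forall G : subgraph_space d, fin_avg G (fun=> 1) n (fun=> 0) @[n --> \oo]
    --> fine (mu (@fin_event d))}.
Proof.
pose nu := @dirac _ (measurableTypeR R) 0%R R.
have i1 : (\int[nu]_r (((fun=> 1) : R -> R) r)%:E = 1%:E)%E by exact: integral_prob_cst.
have i_fin : (\int[nu]_r (((fun=> 1) : R -> R) r)%:E < +oo)%E by rewrite i1 ltry.
have := ae_fin_avg d_gt0 p01 hmu (@iid_dirac R d) _ (fun=> ler01) i_fin.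
move=> /(_ (measurable_cst _)).
by rewrite i1 mulr1; apply: filterS => G /ae_ex[w].
Qed.

End percolation.
Section fixed_graph.
Context (nu : probability (measurableTypeR R) R) (P : probability (coloring_space d R) R).

Lemma cvg_avg_box G (a b q : R) :
  (0 < d)%N -> ~ @two_inf_clusters d G -> color_measure G nu P ->
  {ae P, forall w : coloring_space d R,
    fin_avg G (fun r => Num.max r 0) n w @[n --> \oo] --> a} ->
  {ae P, forall w : coloring_space d R,
    fin_avg G (fun r => Num.max (- r) 0) n w @[n --> \oo] --> b} ->
  fin_avg G (fun=> 1) n (fun=> 0) @[n --> \oo] --> q ->
  {ae P, forall w : coloring_space d R,
    (#|` fset_set (box d n)|%:R^-1 * \sum_(x \in box d n) X x w) @[n --> \oo] -->
      a - b + (1 - q) * infinite_cluster_color G w}.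
Proof.
move=> d_gt0 uG hP ha hb hq; apply: filterS3 (ae_color_const hP) ha hb => w wc ha hb.
under eq_fun do
  rewrite (avg_box_split _ d_gt0 (fun x => infinite_cluster_colorE uG wc (x := x))).
apply: cvgD; first exact: cvgB.
by apply: cvgM; [apply: cvgB => //; exact: cvg_cst|exact: cvg_cst].
Qed.

End fixed_graph.
End main.

Lemma integrable_max (R : realType) (nu : probability (measurableTypeR R) R) (f : R -> R) :
  nu.-integrable [set: measurableTypeR R] (fun x : R => (f x)%:E) ->
  nu.-integrable [set: measurableTypeR R] (fun x : R => (Num.max (f x) 0)%:E).
Proof.
move=> intf; apply: le_integrable (intf) => //.
  have /measurable_EFinP mf := measurable_int _ intf.
  by apply/measurable_EFinP; apply: measurable_maxr => //.
move=> x _; rewrite lee_fin; case: (lerP (f x) 0) => //.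
by rewrite normr0.
Qed.

Theorem theorem1 (R : realType) (d : nat) (hd : (1 <= d)%N)
    (mu : R -> probability (subgraph_space d) R)
    (hmu : forall q : R, 0 < q < 1 -> bond_percolation q (mu q))
    (nu : probability (measurableTypeR R) R)
    (hnu : nu.-integrable [set: measurableTypeR R] (fun x : R => x%:E))
    (p : R) (hp : 0 < p < 1) (hpc : p <> pc mu) :
  {ae mu p, forall G : subgraph_space d,
    forall P : probability (coloring_space d R) R, color_measure G nu P ->
    {ae P, forall w : coloring_space d R,
      (#|` fset_set (box d n)|%:R^-1 * \sum_(x \in box d n) X x w)
        @[n --> \oo] -->
      (1 - theta mu p) * (\int[nu]_x x)
        + theta mu p * infinite_cluster_color G w}}.
Proof.
have hm := hmu p hp; have dens := ae_density hd hp hm.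
(* If no i.i.d. family of law [nu] existed, almost every graph would have no color measure, and the
   claim would be vacuous. *)
have [[P0 iidP]|nP0] := pselect (exists P0 : probability (cspace R d) R, iid nu P0); last first.
  apply: filterS dens => G hG P hP; exfalso; apply: nP0.
  apply: iid_of_color_measure hP; apply: infinite_roots hG => //.
  have /fin_num_measure := @measurable_fin_event d; move=> /(_ R (mu p)) fm.
  by rewrite fine_eq0// (mu_fin_event_neq0 hp hm).
have int_neg : nu.-integrable [set: measurableTypeR R] (fun x : R => (- x)%:E).
  by have := integrableN hnu.
have ipos := integrable_max hnu; have ineg := integrable_max int_neg.
(* The exceptional graphs are discarded before [P] is chosen: they depend only on the convergence
   under [P0]. *)
have lln (f : R -> R) :
    nu.-integrable [set: measurableTypeR R] (fun x : R => (Num.max (f x) 0)%:E) ->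
    {ae mu p, forall G : subgraph_space d,
      forall P : probability (coloring_space d R) R, color_measure G nu P ->
      {ae P, forall w : coloring_space d R,
        fin_avg G (fun r => Num.max (f r) 0) n w @[n --> \oo] -->
          fine (mu p (@fin_event d)) * \int[nu]_r Num.max (f r) 0}}.
  move=> intf; have /measurable_EFinP mf := measurable_int _ intf.
  have f0 r : 0 <= Num.max (f r) 0 by rewrite le_max lexx orbT.
  have finf : (\int[nu]_r (Num.max (f r) 0)%:E < +oo)%E.
    have /integrableP[_] := intf; congr (_ < _)%E.
    by apply: eq_integral => r _; rewrite gee0_abs// lee_fin.
  have := ae_fin_avg hd hp hm iidP mf f0 finf.
  apply: filterS => G hG P hP; exact: (fin_avg_transfer iidP hP mf).
have uniq : {ae mu p, forall G : subgraph_space d, ~ @two_inf_clusters d G}.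
  by apply: negligibleS (negligible_two_inf_clusters hp hm) => G /= /contrapT.
have dens_uniq : {ae mu p, forall G : subgraph_space d, ~ @two_inf_clusters d G /\
    fin_avg G (fun=> 1) n (fun=> 0) @[n --> \oo] --> fine (mu p (@fin_event d))}.
  by apply: filterS2 uniq dens => G; split.
apply: filterS3 dens_uniq (lln id ipos) (lln (fun r => - r) ineg).
move=> G [uG hq] hpos hneg P hP.
have := cvg_avg_box hd uG hP (hpos P hP) (hneg P hP) hq.
(* The limits of the two parts recombine into 1 - theta times the difference of their means, and the
   coefficient of the infinite cluster's color becomes 1 - (1 - theta) = theta. *)
rewrite (fin_eventE (mu p)) -mulrBr subKr.
rewrite -RintegralB// (_ : \int[nu]_r (Num.max r 0 - Num.max (- r) 0) = \int[nu]_r r)//.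
apply: eq_Rintegral => r _.
by case: (lerP r 0) => r0; [rewrite max_l|rewrite max_r]; lra.
Qed.
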